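(* For each $N$ let $M$ be an $N\times N$ real random symmetric matrix, and assume that this ensemble satisfies the Regularity, Rigidity, Linear statistics and Tracy–Widom conditions stated in the context. Let $F_N(\beta)$ be the free energy and $\beta_c$ the critical inverse temperature. Then there is a function $F:(0,\infty)\to[0,\infty)$ such that the free energy satisfies $$F_N(\beta)\Rightarrow F(\beta)$$ in distribution as $N\to\infty$, for every $\beta>0$ with $\beta\neq\beta_c$. The function $F(\beta)$ is $C^2$, but its third derivative $\partial_\beta^3F(\beta)$ is discontinuous at $\beta=\beta_c$. This function is given explicitly by $$F(\beta)=\beta\widehat\gamma(\beta)-\frac12\left(\int_{C_-}^{C_+}\log(\widehat\gamma(\beta)-k)\,d\nu(k)+1+\log(2\beta)\right),\qquad \beta<\beta_c,$$ $$F(\beta)=\beta C_+-\frac12\left(\int_{C_-}^{C_+}\log(C_+-k)\,d\nu(k)+1+\log(2\beta)\right),\qquad \beta\ge\beta_c.$$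
   Context: Free energy: for $\beta>0$, $F_N(\beta)=\frac1N\log Z_N$, $Z_N=\int_{S_{N-1}}e^{\beta\langle\sigma,M\sigma\rangle}d\omega_N(\sigma)$, where $\langle\sigma,M\sigma\rangle=\sum_{i,j=1}^N M_{ij}\sigma_i\sigma_j$ and $d\omega_N$ is the normalized uniform measure on $S_{N-1}=\{\sigma\in\mathbb{R}^N:\|\sigma\|^2=N\}$. Let $\lambda_1\ge\cdots\ge\lambda_N$ be the eigenvalues of $M$ and $\nu_N=\frac1N\sum_j\delta_{\lambda_j}$. High probability: an $N$-dependent event $\Omega_N$ holds with high probability if for every $D>0$ there is $N_0>0$ such that $\mathbb{P}(\Omega_N^c)\le N^{-D}$ for all $N>N_0$. Regularity: $\nu_N$ converges weakly to a probability measure $\nu$ such that $\nu$ is supported on an interval $[C_-,C_+]$ and is positive on $(C_-,C_+)$; $\nu$ is absolutely continuous and $\frac{d\nu}{dx}(x)=s_\nu\sqrt{C_+-x}\,(1+O(C_+-x))$ as $x\nearrow C_+$ for some $s_\nu>0$. Rigidity: for integers $1\le k\le N$ let $\hat k=\min\{k,N+1-k\}$ and let $\gamma_k$ be defined by $\int_{\gamma_k}^\infty d\nu=\frac1N(k-\frac12)$. For any $\epsilon>0$, $|\lambda_k-\gamma_k|\le \hat k^{-1/3}N^{-2/3+\epsilon}$ holds for all $k$ with high probability. Linear statistics: for every function $\varphi:\mathbb{R}\to\mathbb{R}$ that is analytic in an open neighborhood of $[C_-,C_+]$ and has compact support, $\sum_i\varphi(\lambda_i)-N\int_{C_-}^{C_+}\varphi(\lambda)\,d\nu(\lambda)$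 converges in distribution to a Gaussian random variable, whose mean and variance depend only on $\varphi$ restricted to the support of $\nu$. Tracy–Widom: $(s_\nu\pi)^{-2/3}N^{2/3}(\lambda_1-C_+)$ converges in distribution to the GOE Tracy–Widom distribution. Critical value: $\beta_c=\frac12\int_{C_-}^{C_+}\frac{d\nu(x)}{C_+-x}$ (finite by Regularity). For $0<\beta<\beta_c$, $\widehat\gamma(\beta)$ is the unique number in $(C_+,\infty)$ with $\frac12\int_{C_-}^{C_+}\frac{d\nu(x)}{\widehat\gamma(\beta)-x}=\beta$. $\Rightarrow$ denotes convergence in distribution as $N\to\infty$.
   Formalization: F is taken real-valued, and F ≥ 0 on (0,∞) is claimed only when ν has nonnegative mean; without this it is false (shifting GOE by −100·I keeps all hypotheses but gives F(β) = β² − 100β for small β), and the condition is necessary and sufficient. *)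

(* Defs.v *)
From HB Require Import structures.
From mathcomp Require Import all_boot all_order all_algebra.
From mathcomp Require Import all_classical all_reals all_analysis.

Set Implicit Arguments.
Unset Strict Implicit.
Unset Printing Implicit Defensive.

Import Order.TTheory GRing.Theory Num.Theory.
Import numFieldTopology.Exports numFieldNormedType.Exports.

Local Open Scope ring_scope.
Local Open Scope classical_set_scope.

(* The eigenvalues of [A] with multiplicity, in nonincreasing order. The list
   exists and is unique for symmetric [A]; the k-th largest eigenvalue is
   [(spectrum A)`_k.-1]. *)
Definition spectrum (R : realType) (N : nat) (A : 'M[R]_N) : seq R :=
  xget [::] [set s : seq R |
    sorted >=%R s /\ char_poly A = \prod_(x <- s) ('X - x%:P)].

Definition rotate (R : realType) (N : nat) (Q : 'M[R]_N) (x : N.-tuple R) :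
    N.-tuple R :=
  [tuple \sum_(j < N) Q i j * tnth x j | i < N].

(* The normalized uniform measure on the sphere of radius [sqrt N] is the only
   Borel probability measure carried by that sphere and invariant under the
   orthogonal group. *)
Definition uniform_on_sphere (R : realType) (N : nat)
    (w : probability (N.-tuple (measurableTypeR R)) R) : Prop :=
  w [set x : N.-tuple R | \sum_(i < N) tnth x i ^+ 2 = N%:R] = 1%E /\
  forall Q : 'M[R]_N, Q *m Q^T = 1%:M ->
    forall A : set (N.-tuple (measurableTypeR R)), measurable A ->
      w (rotate Q @^-1` A) = w A.

Definition quad_form (R : realType) (N : nat) (A : 'M[R]_N) (x : N.-tuple R) : R :=
  \sum_(i < N) \sum_(j < N) A i j * tnth x i * tnth x j.

Definition partition_function (R : realType) (N : nat)
    (w : probability (N.-tuple (measurableTypeR R)) R) (A : 'M[R]_N) (b : R) : R :=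
  \int[w]_x expR (b * quad_form A x).

Definition free_energy (R : realType) (N : nat)
    (w : probability (N.-tuple (measurableTypeR R)) R) (A : 'M[R]_N) (b : R) : R :=
  N%:R^-1 * ln (partition_function w A b).

Definition bounded_continuous (R : realType) (f : R -> R) : Prop :=
  continuous f /\ exists K : R, forall x, `|f x| <= K.

(* The variables [X N] may live on different probability spaces. *)
Definition cvg_in_distribution (R : realType) (d : nat -> measure_display)
    (T : forall N, measurableType (d N)) (P : forall N, probability (T N) R)
    (X : forall N, T N -> R) (mu : probability (measurableTypeR R) R) : Prop :=
  (forall N, measurable_fun [set: T N] (X N)) /\
  forall f : R -> R, bounded_continuous f ->
    \int[P N]_t f (X N t) @[N --> \oo] --> \int[mu]_x f x.

Definition cvg_in_probability (R : realType) (d : nat -> measure_display)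
    (T : forall N, measurableType (d N)) (P : forall N, probability (T N) R)
    (X : forall N, T N -> R) (c : R) : Prop :=
  forall e : R, 0 < e ->
    P N [set t | e <= `|X N t - c|] @[N --> \oo] --> 0%E.

Definition with_high_probability (R : realType) (d : nat -> measure_display)
    (T : forall N, measurableType (d N)) (P : forall N, probability (T N) R)
    (E : forall N, set (T N)) : Prop :=
  forall D : R, 0 < D -> exists2 N0 : nat, (0 < N0)%N &
    forall N, (N0 < N)%N -> (P N (~` E N) <= (N%:R `^ (- D))%:E)%E.

(* [nu] is a deterministic measure and the empirical measures [nu_N] are random:
   weak convergence is understood in probability. The last conjunct gives the
   density [dnu/dx] through a version [rho] of it. *)
Definition regularity (R : realType) (d : nat -> measure_display)
    (T : forall N, measurableType (d N)) (P : forall N, probability (T N) R)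
    (M : forall N, T N -> 'M[R]_N) (nu : probability (measurableTypeR R) R)
    (Cm Cp s : R) : Prop :=
  [/\ forall f : R -> R, bounded_continuous f ->
        cvg_in_probability P
          (fun N t => N%:R^-1 * \sum_(x <- spectrum (M N t)) f x)
          (\int[nu]_x f x),
      Cm < Cp /\ nu `[Cm, Cp]%classic = 1%E,
      forall a b : R, Cm <= a -> a < b -> b <= Cp -> (0 < nu `]a, b[%classic)%E,
      0 < s &
      exists rho : R -> R,
        [/\ measurable_fun [set: measurableTypeR R] rho,
            forall x, 0 <= rho x,
            forall A : set (measurableTypeR R), measurable A ->
              nu A = (\int[lebesgue_measure]_(x in A) (rho x)%:E)%E &
            exists2 h : R -> R, h =O_ (Cp^'-) (fun x : R => Cp - x) &
              \forall x \near Cp^'-,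
                rho x = s * Num.sqrt (Cp - x) * (1 + h x)]].

(* The point [gamma_k]: unique for [1 <= k <= N] under [regularity]. *)
Definition classical_location (R : realType)
    (nu : probability (measurableTypeR R) R) (N k : nat) : R :=
  xget 0 [set g : R | nu `[g, +oo[%classic = ((k%:R - 2^-1) / N%:R)%:E].

Definition rigidity (R : realType) (d : nat -> measure_display)
    (T : forall N, measurableType (d N)) (P : forall N, probability (T N) R)
    (M : forall N, T N -> 'M[R]_N) (nu : probability (measurableTypeR R) R) : Prop :=
  forall e : R, 0 < e ->
    with_high_probability P (fun N => [set t | forall k, (1 <= k <= N)%N ->
      `|(spectrum (M N t))`_k.-1 - classical_location nu N k| <=
        (minn k (N.+1 - k))%:R `^ (- 3^-1) * N%:R `^ (- (2 / 3) + e)]).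

Definition analytic_at (R : realType) (f : R -> R) (x : R) : Prop :=
  exists a : nat -> R, \forall h \near (0 : R),
    pseries a h n @[n --> \oo] --> f (x + h).

(* [phi] is arbitrary away from [[Cm, Cp]] apart from the compact support;
   measurability makes its linear statistics random variables. *)
Definition admissible_test_function (R : realType) (Cm Cp : R) (phi : R -> R) : Prop :=
  [/\ measurable_fun [set: measurableTypeR R] phi,
      exists U : set R, [/\ open U, `[Cm, Cp] `<=` U &
        forall x, U x -> analytic_at phi x] &
      compact (closure [set x | phi x != 0])].

(* Law of a Gaussian variable with mean [m] and variance [v]. [normal_prob] takes
   a standard deviation and is not a point mass for standard deviation zero. *)
Definition gaussian_law (R : realType) (m v : R) :
    probability (measurableTypeR R) R :=
  if v == 0 then (\d_(m : measurableTypeR R) : probability _ R)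
  else (normal_prob m (Num.sqrt v) : probability _ R).

Definition linear_statistics (R : realType) (d : nat -> measure_display)
    (T : forall N, measurableType (d N)) (P : forall N, probability (T N) R)
    (M : forall N, T N -> 'M[R]_N) (nu : probability (measurableTypeR R) R)
    (Cm Cp : R) : Prop :=
  exists mean var : (R -> R) -> R,
    (forall phi psi : R -> R, {in `[Cm, Cp], phi =1 psi} ->
       mean phi = mean psi /\ var phi = var psi) /\
    forall phi : R -> R, admissible_test_function Cm Cp phi ->
      0 <= var phi /\
      cvg_in_distribution P
        (fun N t => \sum_(x <- spectrum (M N t)) phi x -
                    N%:R * \int[nu]_(x in `[Cm, Cp]) phi x)
        (gaussian_law (mean phi) (var phi)).

Definition airy (R : realType) (x : R) : R :=
  pi^-1 * lim (\int[lebesgue_measure]_(t in `[0, L]) cos (t ^+ 3 / 3 + x * t)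
               @[L --> +oo]).

(* The solution of the Painleve II equation asymptotic to the Airy function. *)
Definition hastings_mcleod (R : realType) (q : R -> R) : Prop :=
  (forall s : R, [/\ derivable q s 1, derivable q^`() s 1 &
     q^`(2) s = s * q s + 2 * q s ^+ 3]) /\
  q s / airy s @[s --> +oo] --> (1 : R).

Definition is_goe_tracy_widom (R : realType)
    (mu : probability (measurableTypeR R) R) : Prop :=
  exists2 q : R -> R, hastings_mcleod q &
    forall x : R, mu `]-oo, x]%classic =
      (expR (- 2^-1 * \int[lebesgue_measure]_(s in `[x, +oo[)
                        (q s + (s - x) * q s ^+ 2)))%:E.

Definition tracy_widom_limit (R : realType) (d : nat -> measure_display)
    (T : forall N, measurableType (d N)) (P : forall N, probability (T N) R)
    (M : forall N, T N -> 'M[R]_N) (Cp s : R) : Prop :=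
  exists2 mu : probability (measurableTypeR R) R, is_goe_tracy_widom mu &
    cvg_in_distribution P
      (fun N t => (s * pi) `^ (- (2 / 3)) * N%:R `^ (2 / 3) *
                  ((spectrum (M N t))`_0 - Cp)) mu.

Definition critical_beta (R : realType) (nu : probability (measurableTypeR R) R)
    (Cm Cp : R) : R :=
  2^-1 * \int[nu]_(x in `[Cm, Cp]) (Cp - x)^-1.

Definition gamma_hat (R : realType) (nu : probability (measurableTypeR R) R)
    (Cm Cp b : R) : R :=
  xget 0 [set z : R | Cp < z /\
    2^-1 * \int[nu]_(x in `[Cm, Cp]) (z - x)^-1 = b].

(* Main.v *)
Require Import Defs.
From HB Require Import structures.
From mathcomp Require Import all_boot all_order all_algebra.
From mathcomp Require Import perm complex.
From mathcomp Require Import all_classical all_reals all_analysis.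
From mathcomp Require Import measurable_realfun ring lra.

Set Implicit Arguments.
Unset Strict Implicit.
Unset Printing Implicit Defensive.

Import Order.TTheory GRing.Theory Num.Theory.
Import numFieldTopology.Exports numFieldNormedType.Exports.

Local Open Scope ring_scope.
Local Open Scope classical_set_scope.

(** The free energy is computed without evaluating any spherical integral, from
    one moment identity. For a diagonal form V(x) = sum_i a_i x_i^2 with a_i > 0
    on the sphere |x|^2 = N, invariance under infinitesimal rotations of the
    coordinate planes forces E[(V/N)^(-N/2)] = prod_i a_i^(-1/2)
    ([sphere_determinant]). Since w^(1/2) exp(-w/2) <= exp(-1/2), this bounds
    E[exp(-V/2)] above by exp(-N/2) prod_i a_i^(-1/2) ([sphere_laplace_le]). Under
    the law tilted by V^(-N/2), the mean of (V + s N)^(-N/2) / V^(-N/2) is again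
    given by the identity and serves as an exponential moment; V concentrates at N as soon as the mean of the 1/a_i is 1, and the
    upper bound is then sharp up to a factor exp(-k N) ([sphere_laplace_ge]).

    The spectral theorem makes the matrix diagonal, and |x|^2 = N allows its
    spectrum to be shifted by any z above it: with a_i = 2 b (z - lambda_i),
    F_N(b) <= b z - ((1/N) sum_i ln(z - lambda_i) + 1 + ln(2b))/2, with near
    equality when sum_i 1/(z - lambda_i) = 2 b N ([log_partition_le],
    [log_partition_ge]). At low temperature this saddle point sticks to the largest
    eigenvalue and the form degenerates. Gathering the eigenvalues of a small window
    at the edge into one point changes F_N little, and it creates an atom of
    positive mass, which keeps the saddle point at a fixed distance.

    Rigidity confines the spectrum to any neighbourhood of the support, and weak
    convergence then turns the logarithmic mean into the potential
    J(z) = int ln(z - x) dnu(x). Thus F_N(b) converges in probability to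
    F(b) = inf_{z >= C_+} (b z - (J(z) + 1 + ln(2b))/2). The minimiser [saddle] is
    gamma_hat below the critical point and C_+ above it, because J is concave with
    slope K_1(z) = int dnu(x)/(z - x), which decreases from 2 beta_c.

    As an infimum of functions affine in b up to the explicit term ln(2b)/2, F has
    the derivative saddle(b) - 1/(2b). With K_n(z) = int (z - x)^(-n) dnu(x), the
    square-root edge gives K_2(C_+ + r^2) of order 1/r and K_3(C_+ + r^2) at least
    of order 1/r^3. Hence gamma_hat' = -2/K_2 tends to 0 at the critical point and
    F'' is continuous, while gamma_hat'' = 8 K_3/K_2^3 stays above a positive
    constant on the left, whereas on the right the saddle is constant: F''' jumps. *)

(** * Rules of differentiation and integration *)

Section derivation_rules.
Context {R : realType}.
Implicit Types f g : R -> R.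

Lemma is_derive_id1 (x : R) : is_derive x 1 (fun y : R => y) 1.
Proof. exact: is_derive_id. Qed.

Lemma is_derive_cst1 (a x : R) : is_derive x 1 (fun _ : R => a) 0.
Proof. exact: is_derive_cst. Qed.

Lemma is_derive_add f g (x df dg : R) :
  is_derive x 1 f df -> is_derive x 1 g dg ->
  is_derive x 1 (fun y => f y + g y) (df + dg).
Proof. by move=> *; exact: is_deriveD. Qed.

Lemma is_derive_opp f (x df : R) :
  is_derive x 1 f df -> is_derive x 1 (fun y => - f y) (- df).
Proof. by move=> *; exact: is_deriveN. Qed.

Lemma is_derive_mul f g (x df dg : R) :
  is_derive x 1 f df -> is_derive x 1 g dg ->
  is_derive x 1 (fun y => f y * g y) (f x * dg + g x * df).
Proof. by move=> *; exact: is_deriveM. Qed.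

Lemma is_derive_mull (a : R) f (x df : R) :
  is_derive x 1 f df -> is_derive x 1 (fun y => a * f y) (a * df).
Proof. by move=> *; exact: (@is_deriveZ _ _ _ f a x 1 df). Qed.

Lemma is_derive_linear (a x : R) : is_derive x 1 (fun y : R => y * a) a.
Proof. by apply: is_derive_eq; rewrite /GRing.scale /= mulr0 mulr1 add0r. Qed.

Lemma is_derive_exp f n (x df : R) :
  is_derive x 1 f df -> is_derive x 1 (fun y => f y ^+ n)
    (n%:R * f x ^+ n.-1 * df).
Proof.
move=> fd; have := is_deriveX n fd.
by rewrite (_ : f ^+ n = (fun y => f y ^+ n))// exprfctE.
Qed.

Lemma is_derive_inv f (x df : R) : f x != 0 ->
  is_derive x 1 f df -> is_derive x 1 (fun y => (f y)^-1) (- (f x) ^- 2 * df).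
Proof.
move=> fx0 [fd fdf]; apply: DeriveDef; first exact: derivableV.
by rewrite deriveV// fdf.
Qed.

Lemma is_derive_comp1 f g (x df dg : R) :
  is_derive (g x) 1 f df -> is_derive x 1 g dg ->
  is_derive x 1 (fun y => f (g y)) (df * dg).
Proof. by move=> *; exact: is_derive1_comp. Qed.

Lemma is_derive_bigsum (I : finType) (h : I -> R -> R) (x : R) (dh : I -> R) :
  (forall i, is_derive x 1 (h i) (dh i)) ->
  is_derive x 1 (fun y => \sum_i h i y) (\sum_i dh i).
Proof.
move=> hd.
have -> : (fun y => \sum_i h i y) = \sum_i h i.
  by apply/funext => y; rewrite fct_sumE.
elim/big_ind2 : _ => // [|f df g dg fd gd]; first exact: is_derive_cst.
exact: is_deriveD.
Qed.

End derivation_rules.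

Section integration.
Context d (Y : measurableType d) (R : realType).

Lemma bounded_integrable (mu : {measure set Y -> \bar R}) (D : set Y)
    (f : Y -> R) (C : R) :
  measurable D -> (mu D < +oo)%E -> measurable_fun D f ->
  (forall x, D x -> `|f x| <= C) -> mu.-integrable D (EFin \o f).
Proof.
move=> mD Dfin mf fC; apply: measurable_bounded_integrable => //.
exists C; split; first exact: num_real.
by move=> M CM x Dx; apply: (le_trans (fC x Dx)); exact: ltW.
Qed.

(** Differentiation under the integral sign with a constant as dominating function:
    on a finite measure space a uniform bound on the derivative is enough. *)
Lemma is_derive_Rintegral (mu : {finite_measure set Y -> \bar R}) (B : set Y)
    (f df : R -> Y -> R) (u v a C : R) :
  measurable B -> u < a < v ->
  (forall x, u < x < v -> mu.-integrable B (EFin \o f x)) ->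
  (forall x y, u < x < v -> B y -> is_derive x 1 (f^~ y) (df x y)) ->
  (forall x y, u < x < v -> B y -> `|df x y| <= C) ->
  is_derive a 1 (fun x => \int[mu]_(y in B) f x y) (\int[mu]_(y in B) df a y).
Proof.
move=> mB auv intf fdf dfC.
pose G := cst `|C| : Y -> R.
have intG : mu.-integrable B (EFin \o G).
  apply: finite_measure_integrable_cst => //.
have Iuv x : `]u, v[%classic x -> u < x < v by rewrite /= in_itv.
have {}auv : `]u, v[%classic a by rewrite /= in_itv.
have {}intf x : `]u, v[%classic x -> mu.-integrable B (EFin \o f x).
  by move=> /Iuv/intf.
have derf x y : `]u, v[%classic x -> B y -> derivable (f^~ y) x 1.
  by move=> /Iuv xuv By; have [] := fdf x y xuv By.
have d1E x y : `]u, v[%classic x -> B y -> partial1of2 f x y = df x y.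
  by move=> /Iuv xuv By; rewrite partial1of2E; have [] := fdf x y xuv By.
have G_ub x y : `]u, v[%classic x -> B y -> `|partial1of2 f x y| <= G y.
  move=> xuv By; rewrite d1E//; apply: le_trans (ler_norm C).
  exact: dfC (Iuv _ xuv) By.
have G0 y : 0 <= G y by exact: normr_ge0.
apply: DeriveDef.
  by apply: (derivable_under_integral mB auv intf derf G0 intG G_ub).
rewrite -derive1E (differentiation_under_integral mB auv intf derf G0 intG G_ub).
by apply: eq_Rintegral => y; rewrite inE => By; rewrite -[LHS]/(partial1of2 f a y) d1E.
Qed.

(** The laws at hand are carried by a sphere or by an interval; integrals move
    freely between the whole space and the carrier. *)
Lemma Rintegral_full (mu : probability Y R) (S : set Y) (f : Y -> R) :
  measurable S -> mu S = 1%E -> measurable_fun setT f ->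
  \int[mu]_x f x = \int[mu]_(x in S) f x.
Proof.
move=> mS S1 mf; rewrite [RHS]Rintegral_mkcond /Rintegral; congr fine.
have mu0 : mu (~` S) = 0%E.
  by rewrite probability_setC// S1 subee.
apply: ae_eq_integral => //.
- exact/measurable_EFinP.
- apply/measurable_EFinP; apply/(measurable_restrictT _ _).1 => //.
  exact: measurable_funTS.
- exists (~` S); split => //; first exact: measurableC.
  by move=> x /= nfx Sx; apply: nfx => _; rewrite patchE mem_set.
Qed.

Lemma Rintegral_bigsum (mu : {measure set Y -> \bar R}) (D : set Y)
    (I : finType) (f : I -> Y -> R) : measurable D ->
  (forall i, mu.-integrable D (EFin \o f i)) ->
  \int[mu]_(x in D) (\sum_i f i x) = \sum_i \int[mu]_(x in D) f i x.
Proof.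
move=> mD intf; rewrite /Rintegral [RHS]sum_fine; last first.
  by move=> i _; apply: integrable_fin_num => //; exact: intf.
congr fine; have := integral_sum mD intf (index_enum I) xpredT.
by under eq_integral do rewrite sumEFin.
Qed.

Lemma integrable_mull (mu : {measure set Y -> \bar R}) (D : set Y)
    (f : Y -> R) (c : R) : measurable D ->
  mu.-integrable D (EFin \o f) -> mu.-integrable D (EFin \o (fun x => c * f x)).
Proof.
move=> mD intf; have := integrableZl mD c intf.
by congr integrable; apply/funext => x /=; rewrite EFinM.
Qed.

End integration.

(** * Rotations of the sphere *)

Section sphere.
Context {R : realType} {N : nat}.
Notation TN := (N.-tuple (measurableTypeR R)).

Definition sphere : set TN := [set x | \sum_(i < N) tnth x i ^+ 2 = N%:R].

Definition diag_form (a : 'I_N -> R) (x : N.-tuple R) : R :=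
  \sum_(i < N) a i * tnth x i ^+ 2.

Lemma measurable_diag_form (a : 'I_N -> R) :
  measurable_fun [set: TN] (diag_form a : TN -> R).
Proof.
rewrite /diag_form; apply: measurable_sum => i; apply: measurable_funM => //.
apply: measurable_funX; exact: measurable_tnth.
Qed.

Lemma measurable_sphere : measurable sphere.
Proof.
have -> : sphere = (diag_form (fun=> 1) : TN -> R) @^-1` [set N%:R].
  by apply/seteqP; split => x /=; rewrite /diag_form; under eq_bigr do rewrite mul1r.
rewrite -[X in measurable X]setTI; apply: measurable_diag_form => //.
Qed.

Lemma sum_sqr_rotate (Q : 'M[R]_N) (x : TN) : Q *m Q^T = 1%:M ->
  \sum_(i < N) tnth (rotate Q x) i ^+ 2 = \sum_(i < N) tnth x i ^+ 2.
Proof.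
move=> /mulmx1C QQ.
pose v : 'cV[R]_N := \col_j tnth x j.
have E : forall u : 'cV[R]_N, \sum_(i < N) u i 0 ^+ 2 = (u^T *m u) 0 0.
  by move=> u; rewrite mxE; apply: eq_bigr => i _; rewrite mxE expr2.
transitivity (\sum_(i < N) (Q *m v) i 0 ^+ 2).
  apply: eq_bigr => i _; rewrite tnth_mktuple mxE.
  by congr (_ ^+ 2); apply: eq_bigr => j _; rewrite mxE.
rewrite E trmx_mul -mulmxA (mulmxA Q^T) QQ mul1mx -E.
by apply: eq_bigr => i _; rewrite mxE.
Qed.

Lemma sphere_rotate (Q : 'M[R]_N) (x : TN) : Q *m Q^T = 1%:M ->
  sphere (rotate Q x) <-> sphere x.
Proof. by move=> QQ; rewrite /sphere /= sum_sqr_rotate. Qed.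

Lemma measurable_rotate (Q : 'M[R]_N) :
  measurable_fun [set: TN] (rotate Q : TN -> TN).
Proof.
apply/measurable_fun_tnthP => i.
rewrite (_ : _ \o _ = fun x : TN => \sum_(j < N) Q i j * tnth x j : R); last first.
  by apply/funext => x /=; rewrite tnth_mktuple.
apply: measurable_sum => j; apply: measurable_funM => //.
exact: measurable_tnth.
Qed.

Variable w : probability TN R.
Hypothesis uw : uniform_on_sphere w.

Lemma Rintegral_rotate (Q : 'M[R]_N) (f : TN -> R) (C : R) :
  Q *m Q^T = 1%:M -> measurable_fun setT f ->
  (forall x, sphere x -> `|f x| <= C) ->
  \int[w]_(x in sphere) f (rotate Q x) = \int[w]_(x in sphere) f x.
Proof.
move=> QQ mf fC; have mr := measurable_rotate Q.
have preS : (rotate Q : TN -> TN) @^-1` sphere = sphere.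
  by apply/seteqP; split => x /=; rewrite sphere_rotate.
rewrite /Rintegral; congr fine.
transitivity (\int[pushforward w (rotate Q : TN -> TN)]_(x in sphere) (f x)%:E)%E; last first.
  by apply: eq_measure_integral => A mA _; exact: (uw.2 Q QQ A mA).
rewrite integral_pushforward//.
- by rewrite preS.
- exact/measurable_EFinP.
- rewrite preS.
  pose g := (f \o (rotate Q : TN -> TN)).
  suff : w.-integrable sphere (EFin \o g) by [].
  apply: (@bounded_integrable _ _ _ w sphere g C) => //.
  + exact: measurable_sphere.
  + by rewrite [X in (X < _)%E](_ : _ = 1%E) ?ltry//; exact: uw.1.
  + apply: measurable_funTS; apply: measurableT_comp => //.
  + by move=> x Sx; apply: fC; apply/sphere_rotate.
- exact: measurable_sphere.
Qed.

End sphere.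

Section plane_rotation.
Context {R : realType} {N : nat}.
Variables (i j : 'I_N) (nij : i != j).

Let P : 'M[R]_N := delta_mx i i + delta_mx j j.
Let K : 'M[R]_N := delta_mx j i - delta_mx i j.

(** The exponential of [t K]: since [K^2 = - P] and [P] is the projection onto
    the plane (i, j), its series sums to this expression. *)
Definition plane_rotation (t : R) : 'M[R]_N :=
  1%:M + (cos t - 1) *: P + sin t *: K.

Lemma plane_rotation_orthogonal t :
  plane_rotation t *m (plane_rotation t)^T = 1%:M.
Proof.
have nji : (j == i) = false by rewrite eq_sym; exact: negbTE.
have nij' := negbTE nij.
have PP : P *m P = P.
  by rewrite /P mulmxDl !mulmxDr !mul_delta_mx_cond !eqxx nij' nji !mulr0n !mulr1n addr0 add0r.
have PK : P *m K = K.
  rewrite /P /K mulmxDl !mulmxBr !mul_delta_mx_cond !eqxx nij' nji !mulr0n !mulr1n.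
  by rewrite sub0r subr0 addrC.
have KP : K *m P = K.
  rewrite /P /K mulmxBl !mulmxDr !mul_delta_mx_cond !eqxx nij' nji !mulr0n !mulr1n.
  by rewrite add0r addr0.
have KK : K *m K = - P.
  rewrite /P /K mulmxBl !mulmxBr !mul_delta_mx_cond !eqxx nij' nji !mulr0n !mulr1n.
  by rewrite sub0r subr0 opprD addrC.
have PT : P^T = P by rewrite /P linearD /= !trmx_delta.
have KT : K^T = - K by rewrite /K linearB /= !trmx_delta opprB.
have TT (A B : 'M[R]_N) (b c : R) :
    (1%:M + b *: A + c *: B)^T = 1%:M + b *: A^T + c *: B^T.
  by rewrite !linearD /= !linearZ /= trmx1.
rewrite /plane_rotation TT PT KT.
rewrite !(mulmxDl, mulmxDr) !mul1mx !mulmx1 -!scalemxAl -!scalemxAr.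
rewrite !mulmxN PP PK KP KK opprK !scalerN.
have sc : sin t ^+ 2 = 1 - cos t ^+ 2 by rewrite -(cos2Dsin2 t); ring.
apply/matrixP => k l; rewrite !mxE.
transitivity ((k == l)%:R + (2 * (cos t - 1) + (cos t - 1) ^+ 2 + sin t ^+ 2) *
  (((k == i) && (l == i))%:R + ((k == j) && (l == j))%:R)).
  by ring.
by rewrite sc; ring.
Qed.

Lemma plane_rotation0 : plane_rotation 0 = 1%:M.
Proof. by rewrite /plane_rotation cos0 sin0 subrr !scale0r !addr0. Qed.

Lemma tnth_plane_rotation t (x : N.-tuple R) k :
  tnth (rotate (plane_rotation t) x) k =
  tnth x k + (cos t - 1) * (((k == i)%:R + (k == j)%:R) * tnth x k) +
  sin t * ((k == j)%:R * tnth x i - (k == i)%:R * tnth x j).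
Proof.
rewrite tnth_mktuple.
have E (u v : 'I_N) : \sum_(l < N) (delta_mx u v : 'M[R]_N) k l * tnth x l =
    (k == u)%:R * tnth x v.
  rewrite (bigD1 v)//= big1 ?addr0 ?mxE ?eqxx ?andbT// => l lv.
  by rewrite mxE (negbTE lv) andbF mul0r.
have E1 : \sum_(l < N) (1%:M : 'M[R]_N) k l * tnth x l = tnth x k.
  rewrite (bigD1 k)//= big1 ?addr0 ?mxE ?eqxx ?mul1r// => l lk.
  by rewrite mxE eq_sym (negbTE lk) mul0r.
transitivity (\sum_(l < N) ((1%:M : 'M[R]_N) k l * tnth x l +
    (cos t - 1) * ((delta_mx i i : 'M[R]_N) k l * tnth x l +
      (delta_mx j j : 'M[R]_N) k l * tnth x l) +
    sin t * ((delta_mx j i : 'M[R]_N) k l * tnth x l - (delta_mx i j : 'M[R]_N) k l * tnth x l))).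
  by apply: eq_bigr => l _; rewrite !mxE; ring.
rewrite !big_split /= -!mulr_sumr !big_split /= sumrN !E E1.
congr (_ + _ * _ + _).
by rewrite mulrDl; congr (_ + _); case: eqP => [->|_]; rewrite ?mul0r.
Qed.

(** The rotations form a one-parameter group, so that the derivative at every [t]
    is the generator applied to the rotated point. *)
Lemma is_derive_plane_rotation (x : N.-tuple R) k (t : R) :
  is_derive t 1 (fun t : R => tnth (rotate (plane_rotation t) x) k)
    ((k == j)%:R * tnth (rotate (plane_rotation t) x) i -
     (k == i)%:R * tnth (rotate (plane_rotation t) x) j).
Proof.
have -> : (fun t => tnth (rotate (plane_rotation t) x) k) = fun t =>
    tnth x k + (cos t - 1) * (((k == i)%:R + (k == j)%:R) * tnth x k) +
    sin t * ((k == j)%:R * tnth x i - (k == i)%:R * tnth x j).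
  by apply/funext => u; exact: tnth_plane_rotation.
apply: is_derive_eq; rewrite /GRing.scale /=.
rewrite !tnth_plane_rotation !eqxx (negbTE nij) [j == i]eq_sym (negbTE nij).
have [->|ki] := eqVneq k i; have [kj|kj] := eqVneq _ j => /=.
- by move: nij; rewrite kj eqxx.
- by ring.
- by rewrite kj; ring.
- by ring.
Qed.

End plane_rotation.

(** * The determinant formula *)

Section quadratic_identity.
Context {R : realType} {N : nat}.
Notation TN := (N.-tuple (measurableTypeR R)).
Variable w : probability TN R.
Hypothesis uw : uniform_on_sphere w.
Hypothesis N0 : (0 < N)%N.

Lemma rotate1 (x : N.-tuple R) : rotate 1%:M x = x.
Proof.
apply: eq_from_tnth => k; rewrite tnth_mktuple (bigD1 k)//= big1 ?addr0.
  by rewrite mxE eqxx mul1r.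
by move=> l lk; rewrite mxE eq_sym (negbTE lk) mul0r.
Qed.

Section fixed_form.
Variables (a : 'I_N -> R) (m p : R).
Hypotheses (m0 : 0 < m) (ma : forall i, m <= a i) (p0 : 0 <= p).
Local Notation V := (diag_form a).

Let a0 i : 0 < a i := lt_le_trans m0 (ma i).

Lemma sphere_le (x : TN) k : sphere x -> tnth x k ^+ 2 <= N%:R :> R.
Proof.
by move=> <-; rewrite (bigD1 k)//= lerDl sumr_ge0// => i _; rewrite sqr_ge0.
Qed.

Lemma diag_form_term_le (x : TN) k : a k * tnth x k ^+ 2 <= V x.
Proof.
rewrite /diag_form (bigD1 k)//= lerDl sumr_ge0// => i _.
by rewrite mulr_ge0 ?sqr_ge0// ltW.
Qed.

Lemma diag_form_ge (x : TN) : sphere x -> m * N%:R <= V x.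
Proof.
move=> <-; rewrite mulr_sumr ler_sum// => i _.
by rewrite ler_wpM2r ?sqr_ge0.
Qed.

Let mN0 : 0 < m * N%:R. Proof. by rewrite mulr_gt0// ltr0n. Qed.

Lemma diag_form_gt0 (x : TN) : sphere x -> 0 < V x.
Proof. by move=> Sx; rewrite (lt_le_trans mN0)// diag_form_ge. Qed.

Lemma powR_diag_form_le (x : TN) : sphere x -> V x `^ (- p) <= (m * N%:R) `^ (- p).
Proof.
move=> Sx; rewrite !powRN lef_pV2 ?posrE ?powR_gt0 ?diag_form_gt0//.
have V0 := diag_form_gt0 Sx.
by rewrite ge0_ler_powR ?nnegrE ?(ltW mN0) ?(ltW V0)//; exact: diag_form_ge.
Qed.

(** Each derivative of a power of [V] lowers the exponent by one; this recovers
    the original power, for which a uniform bound is available. *)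
Lemma powR_diag_formS (x : TN) : sphere x -> V x `^ (- p - 1) = V x `^ (- p) / V x.
Proof.
move=> Sx; have V0 := diag_form_gt0 Sx.
by rewrite powRB ?powRr1 ?(ltW V0)// (gt_eqF V0) implybT.
Qed.

Lemma measurable_powR_diag_form (q : R) :
  measurable_fun [set: TN] (fun x : TN => V x `^ q).
Proof. exact: measurableT_comp (measurable_powR _) (measurable_diag_form _). Qed.

(** Domination, uniform over the sphere, of the derivative computed in
    [rotation_generator]: each [a_k x_k^2] is at most [V]. *)
Lemma rotation_generator_bound (x : TN) i j : sphere x ->
  `|(tnth x i ^+ 2 - tnth x j ^+ 2) * V x `^ (- p) -
    2 * p * (a j - a i) * tnth x i ^+ 2 * tnth x j ^+ 2 * V x `^ (- p - 1)| <=
  (N%:R + 2 * p * (2 * N%:R)) * (m * N%:R) `^ (- p).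
Proof.
move=> Sx; rewrite powR_diag_formS//.
have V0 := diag_form_gt0 Sx.
have E0 : 0 <= V x `^ (- p) by exact: powR_ge0.
have EC := powR_diag_form_le Sx.
set E := V x `^ (- p) in E0 EC *.
have xi := sphere_le i Sx; have xj := sphere_le j Sx.
have yi := diag_form_term_le x i; have yj := diag_form_term_le x j.
have xi0 : 0 <= tnth x i ^+ 2 :> R by exact: sqr_ge0.
have xj0 : 0 <= tnth x j ^+ 2 :> R by exact: sqr_ge0.
move: xi xj yi yj xi0 xj0; move: (tnth x i ^+ 2) (tnth x j ^+ 2) => /= u v.
move=> uN vN uV vV u0 v0.
have [ai0 aj0] := (a0 i, a0 j).
have -> : (u - v) * E - 2 * p * (a j - a i) * u * v * (E / V x) =
   ((u - v) - 2 * p * (u * (a j * v / V x) - v * (a i * u / V x))) * E by ring.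
rewrite normrM (ger0_norm E0) ler_pM//.
have qi0 : 0 <= a i * u / V x by rewrite divr_ge0 ?mulr_ge0// ltW.
have qj0 : 0 <= a j * v / V x by rewrite divr_ge0 ?mulr_ge0// ltW.
have qi1 : a i * u / V x <= 1 by rewrite ler_pdivrMr// mul1r.
have qj1 : a j * v / V x <= 1 by rewrite ler_pdivrMr// mul1r.
rewrite (le_trans (ler_normB _ _))// lerD//.
  by rewrite ler_norml; apply/andP; split; lra.
rewrite normrM ger0_norm ?mulr_ge0// ler_wpM2l ?mulr_ge0//.
move: (a i * u / V x) (a j * v / V x) qi0 qj0 qi1 qj1 => qi qj qi0 qj0 qi1 qj1.
rewrite ler_norml; apply/andP; split; nra.
Qed.

(** The mean of x_i x_j V^-p is constant along the rotations of the plane (i, j);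
    the integrand is its derivative at the identity. *)
Lemma rotation_generator i j : i != j ->
  \int[w]_(x in sphere)
    ((tnth x i ^+ 2 - tnth x j ^+ 2) * V x `^ (- p) -
     2 * p * (a j - a i) * tnth x i ^+ 2 * tnth x j ^+ 2 * V x `^ (- p - 1)) = 0.
Proof.
move=> nij.
pose D (x : TN) : R := (tnth x i ^+ 2 - tnth x j ^+ 2) * V x `^ (- p) -
     2 * p * (a j - a i) * tnth x i ^+ 2 * tnth x j ^+ 2 * V x `^ (- p - 1).
pose f (x : TN) : R := tnth x i * tnth x j * V x `^ (- p).
pose Q (t : R) := plane_rotation i j t.
have QQ t : Q t *m (Q t)^T = 1%:M by exact: plane_rotation_orthogonal.
have mf : measurable_fun setT f.
  apply: measurable_funM; last exact: measurable_powR_diag_form.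
  by apply: measurable_funM; exact: measurable_tnth.
have fC (x : TN) : sphere x -> `|f x| <= N%:R * (m * N%:R) `^ (- p).
  move=> Sx; rewrite /f normrM ler_pM//; last first.
    by rewrite ger0_norm ?powR_ge0// powR_diag_form_le.
  have := sphere_le i Sx; have := sphere_le j Sx.
  by rewrite ler_norml => ? ?; apply/andP; split; nra.
have Sfin : (w sphere < +oo)%E by rewrite uw.1 ltry.
have H : is_derive (0 : R) 1 (fun t => \int[w]_(x in sphere) f (rotate (Q t) x))
    (\int[w]_(x in sphere) D (rotate (Q 0) x)).
  apply: (@is_derive_Rintegral _ _ _ w sphere (fun t x => f (rotate (Q t) x))
    (fun t x => D (rotate (Q t) x)) (-1) 1 0
    ((N%:R + 2 * p * (2 * N%:R)) * (m * N%:R) `^ (- p))).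
  - exact: measurable_sphere.
  - by rewrite ltrN10 ltr01.
  - move=> t _.
    pose g := f \o (rotate (Q t) : TN -> TN).
    suff : w.-integrable sphere (EFin \o g) by [].
    apply: (bounded_integrable (C := N%:R * (m * N%:R) `^ (- p))) => //.
    + exact: measurable_sphere.
    + apply: measurable_funTS; apply: measurableT_comp => //.
      exact: measurable_rotate.
    + by move=> x Sx; apply: fC; apply/sphere_rotate.
  - move=> t x _ Sx.
    have Sy : sphere (rotate (Q t) x : TN) by apply/sphere_rotate.
    have V0 := diag_form_gt0 Sy.
    have dV : is_derive t 1 (fun t => V (rotate (Q t) x))
      (2 * (a j - a i) * tnth (rotate (Q t) x) i * tnth (rotate (Q t) x) j).
      have := is_derive_bigsum (fun k => is_derive_mull (a k)
        (is_derive_exp 2 (is_derive_plane_rotation nij x k t))).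
      rewrite /diag_form; congr is_derive.
      rewrite (bigD1 i)//= (bigD1 j) 1?eq_sym//= big1 ?addr0; last first.
        by move=> k /andP[ki kj]; rewrite (negbTE ki) (negbTE kj) /=; ring.
      by rewrite !eqxx [j == i]eq_sym (negbTE nij) /= /Q; ring.
    have := is_derive_mul
      (is_derive_mul (is_derive_plane_rotation nij x i t)
                     (is_derive_plane_rotation nij x j t))
      (is_derive_comp1 (is_derive1_powR (- p) V0) dV).
    congr is_derive.
    by rewrite !eqxx [j == i]eq_sym (negbTE nij) /D /= -/(Q t); ring.
  - by move=> t x _ Sx; apply: rotation_generator_bound; apply/sphere_rotate.
have := H; rewrite (_ : (fun t => _) = fun=> \int[w]_(x in sphere) f x); last first.
  by apply/funext => t; exact: (Rintegral_rotate uw (QQ t) mf fC).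
move=> [_ H0]; transitivity (\int[w]_(x in sphere) D (rotate (Q 0) x)).
  by apply: eq_Rintegral => x _; rewrite /Q plane_rotation0 rotate1.
by rewrite -H0 derive_cst.
Qed.

End fixed_form.

Let p : R := N%:R / 2.
Let p0 : 0 <= p. Proof. by rewrite divr_ge0. Qed.

Lemma integrable_moment (a : 'I_N -> R) (m : R) i : 0 < m ->
  (forall i, m <= a i) ->
  w.-integrable sphere
    (EFin \o (fun x : TN => tnth x i ^+ 2 * diag_form a x `^ (- p - 1) : R)).
Proof.
move=> m0 ma; have a0 k : 0 < a k by exact: lt_le_trans (ma k).
apply: (bounded_integrable (C := (a i)^-1 * (m * N%:R) `^ (- p))).
- exact: measurable_sphere.
- by rewrite (le_lt_trans (probability_le1 _ measurable_sphere)) ?ltry.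
- apply: measurable_funTS.
  apply: measurable_funM; last exact: measurable_powR_diag_form.
  by apply: measurable_funX; exact: measurable_tnth.
- move=> x Sx; have V0 := diag_form_gt0 m0 ma Sx.
  rewrite ger0_norm; last by rewrite mulr_ge0 ?powR_ge0 ?sqr_ge0.
  rewrite (powR_diag_formS p m0 ma Sx) mulrA mulrAC.
  rewrite ler_pM ?powR_ge0 ?powR_diag_form_le//.
    by rewrite divr_ge0 ?sqr_ge0// ltW.
  rewrite ler_pdivrMr// mulrC ler_pdivlMr// mulrC.
  exact: (diag_form_term_le m0 ma).
Qed.

(** Summing the rotation identities of the planes (i, j) over j, the quadratic
    terms collapse through sum_j a_j x_j^2 = V and sum_j x_j^2 = N. The exponent
    N/2 is the one for which the identity closes on the two moments below. *)
Lemma sphere_moment_identity (a : 'I_N -> R) (m : R) i : 0 < m ->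
  (forall i, m <= a i) ->
  N%:R * (a i * \int[w]_(x in sphere)
      (tnth x i ^+ 2 * diag_form a x `^ (- p - 1))) =
  \int[w]_(x in sphere) (diag_form a x `^ (- p)).
Proof.
move=> m0 ma.
have Sfin : (w sphere < +oo)%E by rewrite uw.1 ltry.
have mS := @measurable_sphere R N.
have N0' : 0 < N%:R :> R by rewrite ltr0n.
have a0 k : 0 < a k by exact: lt_le_trans (ma k).
pose V := diag_form a.
pose D j (x : TN) : R := (tnth x i ^+ 2 - tnth x j ^+ 2) * V x `^ (- p) -
     2 * p * (a j - a i) * tnth x i ^+ 2 * tnth x j ^+ 2 * V x `^ (- p - 1).
have mD j : measurable_fun setT (D j).
  apply: measurable_funB; apply: measurable_funM;
    do ?exact: measurable_powR_diag_form.
    by apply: measurable_funB; apply: measurable_funX; exact: measurable_tnth.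
  apply: measurable_funM; last by apply: measurable_funX; exact: measurable_tnth.
  by apply: measurable_funM => //; apply: measurable_funX; exact: measurable_tnth.
have iD j : w.-integrable sphere (EFin \o D j).
  apply: (bounded_integrable mS Sfin); first exact: measurable_funTS.
  by move=> x Sx; apply: (rotation_generator_bound m0 ma p0 i j Sx).
have D0 j : \int[w]_(x in sphere) D j x = 0.
  have [ij|ij] := eqVneq i j; last exact: (rotation_generator m0 ma p0 ij).
  transitivity (\int[w]_(x in sphere) (0 : R)).
    by rewrite -ij; apply: eq_Rintegral => x _; rewrite /D; ring.
  by rewrite Rintegral_cst// mul0r.
pose g (x : TN) : R := V x `^ (- p).
pose h (x : TN) : R := tnth x i ^+ 2 * V x `^ (- p - 1).
have mg : measurable_fun setT g by exact: measurable_powR_diag_form.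
have mh : measurable_fun setT h.
  apply: measurable_funM; last exact: measurable_powR_diag_form.
  by apply: measurable_funX; exact: measurable_tnth.
have ig : w.-integrable sphere (EFin \o g).
  apply: (bounded_integrable (C := (m * N%:R) `^ (- p))) => //.
    exact: measurable_funTS.
  by move=> x Sx; rewrite ger0_norm ?powR_ge0// powR_diag_form_le.
have ih : w.-integrable sphere (EFin \o h) by exact: (integrable_moment i m0 ma).
have sumD (x : TN) : sphere x ->
    \sum_j D j x = N%:R * (N%:R * (a i * h x)) - N%:R * g x.
  move=> Sx; have V0 := diag_form_gt0 m0 ma Sx.
  rewrite /D /h (powR_diag_formS p m0 ma Sx) -/(g x).
  pose u := tnth x i ^+ 2 : R.
  pose c := N%:R * u * (g x / V x).
  (* Here c = 2 p u g / V: after summation over j, the term c V cancels N u g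
     because 2 p = N. *)
  transitivity (\sum_j (u * g x + (c * a i - g x) * tnth x j ^+ 2 -
      c * (a j * tnth x j ^+ 2))).
    by apply: eq_bigr => j _; rewrite -/(V x) -/(g x) -/u /c /p; field; rewrite gt_eqF.
  rewrite !big_split /= sumrN -!mulr_sumr -/(diag_form a x) -/(V x) Sx.
  rewrite sumr_const card_ord -[_ *+ N]mulr_natr /c -/u.
  by field; rewrite gt_eqF.
have : \int[w]_(x in sphere) (N%:R * (N%:R * (a i * h x)) - N%:R * g x) = 0.
  transitivity (\int[w]_(x in sphere) \sum_j D j x).
    by apply: eq_Rintegral => x; rewrite inE => Sx; rewrite sumD.
  by rewrite Rintegral_bigsum// big1.
rewrite RintegralB//; [|by do !apply: integrable_mull|exact: integrable_mull].
rewrite !RintegralZl//; [|by do !apply: integrable_mull..].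
move/eqP; rewrite subr_eq0 => /eqP/mulfI -> //; by rewrite gt_eqF.
Qed.

(** Along the path a_i = exp(s l_i) from the unit form to the given one,
    [sphere_moment_identity] shows that the moment G satisfies
    G' = - (sum_i l_i) G / 2, which integrates to the formula. *)
Lemma sphere_determinant_exp (l : 'I_N -> R) :
  \int[w]_(x in sphere) (diag_form (fun i => expR (l i)) x `^ (- p)) =
  N%:R `^ (- p) * expR (- 2^-1 * \sum_i l i).
Proof.
have Sfin : (w sphere < +oo)%E by rewrite uw.1 ltry.
have mS := @measurable_sphere R N.
have N0' : 0 < N%:R :> R by rewrite ltr0n.
pose a (s : R) i := expR (s * l i).
pose L : R := \sum_i l i.
pose B : R := \sum_i `|l i|.
pose G s := \int[w]_(x in sphere) (diag_form (a s) x `^ (- p)).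
have lB i : `|l i| <= B by rewrite /B (bigD1 i)//= lerDl sumr_ge0.
have B0 : 0 <= B by exact: sumr_ge0.
pose m (s : R) := expR (- (`|s| + 1) * B).
have ma s t i : s - 1 < t < s + 1 -> m s <= a t i.
  move=> /andP[st ts]; rewrite ler_expR mulNr lerNl -mulrN.
  have t1 : `|t| <= `|s| + 1.
    have := ler_norm s; have := ler_norm (- s); rewrite normrN => ? ?.
    by rewrite ler_norml; apply/andP; split; lra.
  by rewrite (le_trans (ler_norm _))// normrM normrN ler_pM.
have dG (s : R) : is_derive s 1 G (- 2^-1 * L * G s).
  pose M := p * B * (m s * N%:R) `^ (- p).
  pose dg t (x : TN) := (- p * diag_form (a t) x `^ (- p - 1)) *
      (\sum_i l i * a t i * tnth x i ^+ 2).
  have sin : s - 1 < s < s + 1 by apply/andP; split; lra.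
  have -> : - 2^-1 * L * G s = \int[w]_(x in sphere) dg s x.
    have ms0 : 0 < m s by exact: expR_gt0.
    have mas i : m s <= a s i by exact: ma.
    transitivity (\int[w]_(x in sphere)
      (\sum_i (- p * (l i * a s i) * (tnth x i ^+ 2 * diag_form (a s) x `^ (- p - 1))))).
      rewrite Rintegral_bigsum//; last first.
        by move=> i; apply: integrable_mull => //; exact: (integrable_moment i ms0 mas).
      rewrite /L -mulrA mulr_suml mulr_sumr; apply: eq_bigr => i _.
      rewrite RintegralZl//; last exact: (integrable_moment i ms0 mas).
      by rewrite /G -(sphere_moment_identity i ms0 mas) /p; field.
    apply: eq_Rintegral => x _; rewrite /dg mulr_sumr.
    by apply: eq_bigr => i _; ring.
  apply: (@is_derive_Rintegral _ _ _ w sphere (fun s x => diag_form (a s) x `^ (- p))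
    dg (s - 1) (s + 1) s M) => //.
  - move=> t st.
    apply: (bounded_integrable (C := (m s * N%:R) `^ (- p))) => //.
      by apply: measurable_funTS; exact: measurable_powR_diag_form.
    move=> x Sx; rewrite ger0_norm ?powR_ge0//.
    by apply: powR_diag_form_le => //; [exact: expR_gt0|move=> i; exact: ma].
  - move=> t x st Sx.
    have V0 : 0 < diag_form (a t) x.
      by apply: (@diag_form_gt0 _ (m s)) => //; [exact: expR_gt0|move=> i; exact: ma].
    have dV : is_derive t 1 (fun t => diag_form (a t) x)
        (\sum_i l i * a t i * tnth x i ^+ 2).
      rewrite /diag_form; apply: is_derive_bigsum => i.
      have := is_derive_mull (tnth x i ^+ 2) (is_derive_comp1
        (g := fun y => y * l i) (is_derive_expR (t * l i)) (is_derive_linear (l i) t)).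
      rewrite (_ : (fun y => _) = (fun y => a y i * tnth x i ^+ 2)); last first.
        by apply/funext => y; rewrite /a mulrC.
      by congr is_derive; rewrite /a; ring.
    exact: (is_derive_comp1 (is_derive1_powR (- p) V0) dV).
  - move=> t x st Sx; rewrite /dg /M.
    have m0 := expR_gt0 (- (`|s| + 1) * B).
    have mat i : m s <= a t i by exact: ma.
    have V0 : 0 < diag_form (a t) x := diag_form_gt0 m0 mat Sx.
    rewrite (powR_diag_formS p m0 mat Sx).
    have -> : p * B * (m s * N%:R) `^ (- p) =
      (p * ((m s * N%:R) `^ (- p) / diag_form (a t) x)) * (B * diag_form (a t) x).
      by field; rewrite gt_eqF.
    rewrite normrM ler_pM//.
      rewrite mulNr normrN ger0_norm ?mulr_ge0 ?invr_ge0 ?powR_ge0 ?(ltW V0)//.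
      rewrite ler_wpM2l// ler_wpM2r ?invr_ge0 ?(ltW V0)//.
      exact: powR_diag_form_le.
    rewrite (le_trans (ler_norm_sum _ _ _))// /diag_form mulr_sumr ler_sum// => i _.
    rewrite -mulrA normrM ler_pM// ger0_norm// mulr_ge0 ?sqr_ge0//.
    exact: expR_ge0.
pose H s := G s * expR (2^-1 * L * s).
have dH (s : R) : is_derive s 1 H 0.
  have := is_derive_mul (dG s) (is_derive_comp1
     (g := fun y => 2^-1 * L * y) (is_derive_expR (2^-1 * L * s))
     (is_derive_mull (2^-1 * L) (is_derive_id1 s))).
  by congr is_derive; ring.
have G0E : G 0 = N%:R `^ (- p).
  transitivity (\int[w]_(x in sphere) (N%:R `^ (- p))).
    apply: eq_Rintegral => x; rewrite inE => Sx; congr (_ `^ _).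
    rewrite -[RHS]Sx; apply: eq_bigr => i _.
    by rewrite /a mul0r expR0 mul1r.
  have w1 : w sphere = 1%E by exact: uw.1.
  by rewrite Rintegral_cst// (_ : fine _ = 1) ?mulr1//; exact: (congr1 fine w1).
have G1E : G 1 = \int[w]_(x in sphere) (diag_form (fun i => expR (l i)) x `^ (- p)).
  apply: eq_Rintegral => x _; congr (_ `^ _); apply: eq_bigr => i _.
  by rewrite /a mul1r.
rewrite -G1E -G0E -/L.
have : G 1 * expR (2^-1 * L * 1) = G 0 * expR (2^-1 * L * 0).
  exact: is_derive_0_is_cst 1 0 dH.
move: (G 0) (G 1) => g0 g1.
rewrite mulr0 expR0 !mulr1 => <-.
by rewrite -mulrA -expRD mulNr subrr expR0 mulr1.
Qed.

End quadratic_identity.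

(** * Laplace asymptotics on the sphere *)

Section sphere_laplace.
Context {R : realType}.

Lemma ln_le_sub1 (x : R) : 0 < x -> ln x <= x - 1.
Proof.
move=> x0; have := @le_ln1Dx R (x - 1); rewrite (_ : 1 + (x - 1) = x); last by ring.
by apply; lra.
Qed.

Lemma ln_ge_1subV (x : R) : 0 < x -> 1 - x^-1 <= ln x.
Proof.
move=> x0; have := @ln_le_sub1 x^-1; rewrite invr_gt0 lnV ?posrE// => /(_ x0); lra.
Qed.

(** The lower bound that makes the exponential Chebyshev inequality effective:
    the linear term is exact and the error quadratic. *)
Lemma ln1D_ge (v : R) : - 2^-1 <= v -> v - 2 * v ^+ 2 <= ln (1 + v).
Proof.
move=> v2; have v1 : 0 < 1 + v by lra.
have := ln_ge_1subV v1; apply: le_trans.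
have -> : 1 - (1 + v)^-1 = v / (1 + v) by field; rewrite gt_eqF.
rewrite ler_pdivlMr//; nra.
Qed.

Context {N : nat}.
Notation TN := (N.-tuple (measurableTypeR R)).
Variable w : probability TN R.
Hypothesis uw : uniform_on_sphere w.
Hypothesis N0 : (0 < N)%N.

Lemma sphere_determinant (a : 'I_N -> R) : (forall i, 0 < a i) ->
  \int[w]_(x in sphere) (diag_form a x `^ (- (N%:R / 2))) =
  N%:R `^ (- (N%:R / 2)) * expR (- 2^-1 * \sum_i ln (a i)).
Proof.
move=> a0; rewrite -(sphere_determinant_exp uw N0 (fun i => ln (a i))).
apply: eq_Rintegral => x _; congr (_ `^ _); apply: eq_bigr => i _.
by rewrite lnK ?posrE.
Qed.

Lemma positive_lower_bound (a : 'I_N -> R) : (forall i, 0 < a i) ->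
  exists2 m, 0 < m & forall i, m <= a i.
Proof.
move=> a0; exists (\sum_i (a i)^-1 + 1)^-1 => [|i].
  by rewrite invr_gt0 ltr_wpDl// sumr_ge0// => i _; rewrite invr_ge0 ltW.
rewrite invf_ple ?posrE// ?ltr_wpDl//; last first.
  by rewrite sumr_ge0// => j _; rewrite invr_ge0 ltW.
rewrite (bigD1 i)//= -addrA lerDl addr_ge0// sumr_ge0// => j _.
by rewrite invr_ge0 ltW.
Qed.

Lemma integrable_sphere_expR (c : R) (a : 'I_N -> R) :
  w.-integrable sphere (EFin \o (fun x : TN => expR (c * diag_form a x))).
Proof.
apply: (bounded_integrable (C := expR (`|c| * \sum_i `|a i| * N%:R))).
- exact: measurable_sphere.
- by rewrite (le_lt_trans (probability_le1 _ measurable_sphere)) ?ltry.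
- apply: measurable_funTS; apply: measurableT_comp => //.
  by apply: measurable_funM => //; exact: measurable_diag_form.
- move=> x Sx; rewrite ger0_norm ?expR_ge0// ler_expR.
  rewrite (le_trans (ler_norm _))// normrM ler_wpM2l//.
  rewrite (le_trans (ler_norm_sum _ _ _))// ler_sum// => i _.
  by rewrite normrM ler_wpM2l// ger0_norm ?sqr_ge0//; exact: sphere_le.
Qed.

Lemma integrable_sphere_powR (a : 'I_N -> R) : (forall i, 0 < a i) ->
  w.-integrable sphere (EFin \o (fun x : TN => diag_form a x `^ (- (N%:R / 2)))).
Proof.
move=> /positive_lower_bound[m m0 ma].
apply: (bounded_integrable (C := (m * N%:R) `^ (- (N%:R / 2)))).
- exact: measurable_sphere.
- by rewrite (le_lt_trans (probability_le1 _ measurable_sphere)) ?ltry.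
- by apply: measurable_funTS; exact: measurable_powR_diag_form.
- move=> x Sx; rewrite ger0_norm ?powR_ge0//.
  by apply: powR_diag_form_le => //; exact: divr_ge0.
Qed.

(** With w = V/N, raising w^(1/2) exp(-w/2) <= exp(-1/2) to the power N compares
    exp(-V/2) with w^(-N/2), whose mean is known. *)
Lemma sphere_laplace_le (a : 'I_N -> R) : (forall i, 0 < a i) ->
  \int[w]_(x in sphere) expR (- 2^-1 * diag_form a x) <=
  expR (- (N%:R / 2) - 2^-1 * \sum_i ln (a i)).
Proof.
move=> a0; have [m m0 ma] := positive_lower_bound a0.
have N0' : 0 < N%:R :> R by rewrite ltr0n.
have mS := @measurable_sphere R N.
pose c := N%:R `^ (N%:R / 2) * expR (- (N%:R / 2)) : R.
have -> : expR (- (N%:R / 2) - 2^-1 * \sum_i ln (a i)) =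
    \int[w]_(x in sphere) (c * (diag_form a x `^ (- (N%:R / 2)))).
  rewrite RintegralZl//; last exact: integrable_sphere_powR.
  rewrite sphere_determinant// /c powRN expRD mulNr.
  by field; rewrite gt_eqF ?powR_gt0.
apply: le_Rintegral => //.
- exact: integrable_sphere_expR.
- by apply: integrable_mull => //; exact: integrable_sphere_powR.
- move=> x Sx; have V0 := diag_form_gt0 N0 m0 ma Sx.
  rewrite /c /powR !gt_eqF// -!expRD ler_expR.
  have := @ln_le_sub1 (diag_form a x / N%:R); rewrite divr_gt0// => /(_ isT).
  rewrite ln_div ?posrE// => H.
  have : N%:R / 2 * (ln (diag_form a x) - ln N%:R) <=
         N%:R / 2 * (diag_form a x / N%:R - 1) by rewrite ler_wpM2l// divr_ge0.
  by rewrite mulrBr mulrBr (_ : N%:R / 2 * (diag_form a x / N%:R) =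
    2^-1 * diag_form a x); [lra|field; rewrite gt_eqF].
Qed.

(** Exponential Chebyshev bound for the law tilted by V^(-N/2): the determinant
    formula at the shifted form a + s plays the role of an exponential moment. *)
Lemma sphere_tilted_tail (a : 'I_N -> R) (p s c : R) :
  0 < p -> (forall i, p <= a i) -> \sum_i (a i)^-1 = N%:R ->
  `|s| <= p / 2 -> 0 < c -> 0 < c + s ->
  ((c + s) / c) `^ (N%:R / 2) *
    \int[w]_(x in sphere) (diag_form (fun i => a i + s) x `^ (- (N%:R / 2))) <=
  N%:R `^ (- (N%:R / 2)) * expR (- 2^-1 * \sum_i ln (a i)) *
    expR (- (N%:R / 2) * (s * (1 - c^-1) - 2 * s ^+ 2 / p)).
Proof.
move=> p0 pa suma sp c0 cs0.
have [sp1 sp2] : - (p / 2) <= s /\ s <= p / 2.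
  by move: sp; rewrite ler_norml => /andP[].
have a0 i : 0 < a i by exact: lt_le_trans (pa i).
have as0 i : 0 < a i + s by have := pa i; lra.
rewrite sphere_determinant// mulrCA -!mulrA ler_wpM2l ?powR_ge0//.
rewrite /powR gt_eqF ?divr_gt0// -!expRD ler_expR.
have lnc : ln ((c + s) / c) <= s / c.
  apply: le_trans (ln_le_sub1 _) _; first exact: divr_gt0.
  by rewrite (_ : (c + s) / c - 1 = s / c)//; field; rewrite gt_eqF.
have lna : \sum_i ln (a i) + N%:R * (s - 2 * s ^+ 2 / p) <= \sum_i ln (a i + s).
  have -> : N%:R * (s - 2 * s ^+ 2 / p) = \sum_i ((s - 2 * s ^+ 2 / p) * (a i)^-1).
    by rewrite -mulr_sumr suma mulrC.
  rewrite -big_split /= ler_sum// => i _.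
  have -> : a i + s = a i * (1 + s / a i) by field; rewrite gt_eqF.
  have sai : - 2^-1 <= s / a i.
    by rewrite ler_pdivlMr//; have := pa i; nra.
  rewrite lnM ?posrE//; last by lra.
  rewrite lerD2l (le_trans _ (ln1D_ge sai))//.
  have : (s / a i) ^+ 2 <= s ^+ 2 * (p^-1 * (a i)^-1).
    rewrite expr_div_n ler_wpM2l ?sqr_ge0// -invfM.
    by rewrite lef_pV2 ?posrE ?mulr_gt0 ?exprn_gt0// expr2 ler_wpM2r// ltW.
  lra.
have : N%:R / 2 * ln ((c + s) / c) <= N%:R / 2 * (s / c).
  by rewrite ler_wpM2l// divr_ge0.
lra.
Qed.

(** Lower half: under the law tilted by V^(-N/2) the form V concentrates at N
    when the mean of the 1/a_i is 1, and there exp(-V/2) is comparable to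
    exp(-N/2) (V/N)^(-N/2). *)
Lemma sphere_laplace_ge (a : 'I_N -> R) (p k : R) :
  0 < p -> p <= 1 -> 0 < k -> k <= 2^-1 ->
  (forall i, p <= a i) -> \sum_i (a i)^-1 = N%:R ->
  3 <= N%:R * (p * k ^+ 2 / 64) ->
  expR (- (N%:R * (2^-1 + k)) - 2^-1 * \sum_i ln (a i)) <=
  \int[w]_(x in sphere) expR (- 2^-1 * diag_form a x).
Proof.
move=> p0 p1 k0 k2 pa suma N3.
have half_of_main (x y : R) : x <= y + (x * 4^-1 + x * 4^-1) -> x / 2 <= y by lra.
have a0 i : 0 < a i by exact: lt_le_trans (pa i).
have N0' : 0 < N%:R :> R by rewrite ltr0n.
have mS := @measurable_sphere R N.
pose h : R := N%:R / 2.
have h0 : 0 <= h by exact: divr_ge0.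
(* The tilt: of the order of the deviation k, so that the linear gain t k exceeds
   the quadratic loss t^2 / p, and below p / 2, so that the shifted forms stay
   positive. *)
pose t : R := p * k / 8.
have t0 : 0 < t by rewrite /t; nra.
have tp : t <= p / 2 by rewrite /t; nra.
have tk : t <= k / 4 by rewrite /t; nra.
pose A (s : R) (x : TN) : R := diag_form (fun i => a i + s) x `^ (- h).
pose Z := \int[w]_(x in sphere) expR (- 2^-1 * diag_form a x).
pose c1 : R := N%:R `^ (- h) * expR (h * (1 + k)).
pose cp : R := ((1 + k + t) / (1 + k)) `^ h.
pose cm : R := ((1 - k - t) / (1 - k)) `^ h.
pose e (x : TN) : R := expR (- 2^-1 * diag_form a x).
have iA s : `|s| <= p / 2 -> w.-integrable sphere (EFin \o A s).
  rewrite ler_norml => /andP[s1 s2].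
  by apply: integrable_sphere_powR => i; have := pa i; lra.
have pointwise (x : TN) : sphere x ->
    A 0 x <= c1 * e x + (cp * A t x + cm * A (- t) x).
  move=> Sx.
  have AE s : A s x = (diag_form a x + s * N%:R) `^ (- h).
    congr (_ `^ _); rewrite -[in RHS]Sx mulr_sumr -big_split /=.
    by apply: eq_bigr => i _; rewrite mulrDl.
  have A0 s : 0 <= A s x by exact: powR_ge0.
  have V0 := diag_form_gt0 N0 p0 pa Sx.
  have Vp := diag_form_ge pa Sx.
  have [W VE] : exists W, diag_form a x = W * N%:R.
    by exists (diag_form a x / N%:R); rewrite mulfVK// gt_eqF.
  have W0 : 0 < W by move: V0; rewrite VE pmulr_lgt0.
  have Wp : p <= W by move: Vp; rewrite VE ler_pM2r.
  have chern s c : 0 < c -> 0 < c + s -> 0 < W + s -> 0 <= s * (W - c) ->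
      A 0 x <= ((c + s) / c) `^ h * A s x.
    move=> c0 cs0 Ws0 sWc.
    rewrite !AE mul0r addr0 VE -mulrDl.
    rewrite !powRM ?invr_ge0 ?(ltW W0) ?(ltW Ws0) ?(ltW N0') ?(ltW c0) ?(ltW cs0)//.
    rewrite mulrA ler_wpM2r ?powR_ge0// !powRN.
    rewrite -[leLHS]mul1r ler_pdivrMr ?powR_gt0// mulrAC ler_pdivlMr ?powR_gt0// mul1r.
    rewrite -!powRM ?mulr_ge0 ?invr_ge0 ?(ltW W0) ?(ltW Ws0) ?(ltW c0) ?(ltW cs0)//.
    rewrite ge0_ler_powR ?nnegrE ?mulr_ge0 ?invr_ge0 ?(ltW W0) ?(ltW Ws0) ?(ltW c0) ?(ltW cs0)//.
    by rewrite mulrAC ler_pdivlMr//; nra.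
  (* Outside the window |W - 1| < k a shifted form dominates; inside it exp(-V/2)
     does. *)
  have [Wk|Wk] := leP (1 + k) W.
    have : A 0 x <= cp * A t x by apply: chern; nra.
    move/le_trans; apply; rewrite addrCA lerDl addr_ge0 ?mulr_ge0 ?powR_ge0//.
    exact: expR_ge0.
  have [Wk'|Wk'] := leP W (1 - k).
    have : A 0 x <= cm * A (- t) x.
      by rewrite /cm; apply: chern; nra.
    move/le_trans; apply; rewrite addrA lerDr addr_ge0 ?mulr_ge0 ?powR_ge0//.
    exact: expR_ge0.
  apply: (@le_trans _ _ (c1 * e x)); last first.
    by rewrite lerDl addr_ge0 ?mulr_ge0 ?powR_ge0.
  have VN : W * N%:R != 0 by rewrite mulf_neq0 ?gt_eqF.
  rewrite AE mul0r addr0 /c1 /e VE /powR (negbTE VN) (gt_eqF N0') -!expRD ler_expR.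
  rewrite lnM ?posrE//.
  have lnW := ln_ge_1subV W0.
  have : W - 1 - ln W <= k.
    apply: (@le_trans _ _ ((W - 1) ^+ 2 / W)).
      rewrite (_ : (W - 1) ^+ 2 / W = W - 1 - (1 - W^-1)); first lra.
      by field; rewrite gt_eqF.
    rewrite ler_pdivrMr//; nra.
  move=> HW; have : h * (W - 1 - ln W) <= h * k by rewrite ler_wpM2l.
  by rewrite /h; lra.
pose D : R := N%:R `^ (- h) * expR (- 2^-1 * \sum_i ln (a i)).
have D0 : 0 < D by rewrite mulr_gt0 ?powR_gt0 ?expR_gt0.
have small : expR (- h * (t * k / 4)) <= 4^-1.
  rewrite -[- h * _]opprK expRN lef_pV2 ?posrE ?expR_gt0//.
  apply: le_trans (expR_ge1Dx _).
  have -> : - (- h * (t * k / 4)) = N%:R * (p * k ^+ 2 / 64) by rewrite /h /t; field.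
  lra.
have tailp : cp * \int[w]_(x in sphere) A t x <= D * 4^-1.
  apply: le_trans (sphere_tilted_tail p0 pa suma _ _ _) _.
  - by rewrite gtr0_norm.
  - by lra.
  - by lra.
  rewrite ler_wpM2l ?(ltW D0)//; apply: le_trans small.
  rewrite ler_expR -/h !mulNr lerN2 ler_wpM2l//.
  have -> : t * (1 - (1 + k)^-1) - 2 * t ^+ 2 / p = t * (k / (1 + k)) - t * k / 4.
    by rewrite /t; field; apply/andP; split; rewrite gt_eqF//; lra.
  have : k / 2 <= k / (1 + k).
    by rewrite ler_wpM2l ?(ltW k0)// lef_pV2 ?posrE; lra.
  nra.
have tailm : cm * \int[w]_(x in sphere) A (- t) x <= D * 4^-1.
  apply: le_trans (@sphere_tilted_tail a p (- t) (1 - k) p0 pa suma _ _ _) _.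
  - by rewrite normrN gtr0_norm.
  - by lra.
  - by lra.
  rewrite ler_wpM2l ?(ltW D0)//; apply: le_trans small.
  rewrite ler_expR -/h !mulNr lerN2 ler_wpM2l//.
  have -> : - (t * (1 - (1 - k)^-1)) - 2 * (- t) ^+ 2 / p = t * (k / (1 - k)) - t * k / 4.
    by rewrite /t; field; apply/andP; split; rewrite gt_eqF//; lra.
  have : k / 2 <= k / (1 - k).
    by rewrite ler_wpM2l ?(ltW k0)// lef_pV2 ?posrE; lra.
  nra.
have main : D <= c1 * Z + (D * 4^-1 + D * 4^-1).
  have DE : D = \int[w]_(x in sphere) A 0 x.
    transitivity (\int[w]_(x in sphere) (diag_form a x `^ (- (N%:R / 2)))).
      exact: esym (sphere_determinant a0).
    apply: eq_Rintegral => x _.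
    by congr (_ `^ _); apply: eq_bigr => i _; rewrite addr0.
  have ie : w.-integrable sphere (EFin \o e) by exact: integrable_sphere_expR.
  have it : w.-integrable sphere (EFin \o A t) by apply: iA; rewrite gtr0_norm.
  have imt : w.-integrable sphere (EFin \o A (- t)).
    by apply: iA; rewrite normrN gtr0_norm.
  have i2 : w.-integrable sphere (EFin \o (fun x => cp * A t x + cm * A (- t) x)).
    by have := integrableD mS (integrable_mull cp mS it) (integrable_mull cm mS imt).
  have i3 : w.-integrable sphere
      (EFin \o (fun x => c1 * e x + (cp * A t x + cm * A (- t) x))).
    by have := integrableD mS (integrable_mull c1 mS ie) i2.
  rewrite {1}DE.
  apply: le_trans (le_Rintegral mS _ i3 pointwise) _.
    by apply: iA; rewrite normr0 divr_ge0// ltW.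
  rewrite RintegralD//; last exact: integrable_mull.
  rewrite RintegralD//; [|exact: integrable_mull|exact: integrable_mull].
  rewrite (@RintegralZl _ _ _ w sphere e c1 mS ie).
  rewrite (@RintegralZl _ _ _ w sphere (A t) cp mS it).
  rewrite (@RintegralZl _ _ _ w sphere (A (- t)) cm mS imt).
  exact: lerD (lexx _) (lerD tailp tailm).
have half : D / 2 <= c1 * Z by exact: half_of_main main.
have Nk : 2 <= N%:R * k.
  clear -N3 k0 p0 p1 k2 N0'.
  have pk : p * k / 64 <= 1 by nra.
  have : N%:R * k * (p * k / 64) <= N%:R * k * 1.
    by rewrite ler_wpM2l// mulr_ge0 ?ltW.
  lra.
rewrite -/Z -(ler_pM2l (_ : 0 < c1)); last first.
  by rewrite mulr_gt0 ?powR_gt0 ?expR_gt0.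
apply: le_trans half; rewrite expRD.
set q := expR (- (2^-1 * _)); set u := expR (- _).
have -> : c1 * (u * q) = N%:R `^ (- h) * q * (expR (h * (1 + k)) * u).
  by rewrite /c1 (mulrC u) mulrACA.
rewrite /D mulNr -/q ler_wpM2l ?mulr_ge0 ?powR_ge0 ?expR_ge0// /u -expRD.
have -> : h * (1 + k) - (N%:R * (2^-1 + k)) = - (N%:R * k / 2) by rewrite /h; field.
rewrite expRN lef_pV2 ?posrE ?expR_gt0//.
by apply: le_trans (expR_ge1Dx _); clear -Nk; lra.
Qed.

End sphere_laplace.

(** * Spectrum of a real symmetric matrix *)

Section spectral_theorem.
Context {R : realType}.

(** Over R[i] the matrix is Hermitian, hence unitarily diagonalisable with real
    eigenvalues; a root in R of the characteristic polynomial is an eigenvalue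
    over R as well. *)
Lemma symmetric_eigenvalue n (A : 'M[R]_n.+1) : A^T = A ->
  exists r, eigenvalue A r.
Proof.
move=> AT; pose C : numClosedFieldType := R[i].
pose f : {rmorphism R -> C} := real_complex R.
pose B : 'M[C]_n.+1 := map_mx f A.
have Breal : B \is a realmx.
  by apply/mxOverP => i j; rewrite mxE; apply/complex_realP; exists (A i j).
have Bsym : B \is symmetricmx.
  apply/is_hermitianmxP; rewrite expr0 scale1r map_mx_id//.
  by apply/matrixP => i j; rewrite !mxE -{1}AT mxE.
have Bherm := realsym_hermsym Bsym Breal.
have /hermitian_normalmx/orthomx_spectralP BE := Bherm.
have /mxOverP/(_ 0 0) := hermitian_spectral_diag_real Bherm.
move=> /complex_realP[r rE]; exists r.
rewrite eigenvalue_root_char -(fmorph_root f) map_char_poly -/B.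
rewrite -eigenvalue_root_char; apply/eigenvalueP.
exists (row 0 (spectralmx B)).
  rewrite -row_mul {2}BE mulmxA mulmxA mulmxV ?spectral_unit// mul1mx.
  rewrite row_mul row_diag_mx -scalemxAl -rowE.
  by rewrite rE.
apply/eqP => /(congr1 (fun X => X *m invmx (spectralmx B))).
rewrite mul0mx -row_mul mulmxV ?spectral_unit// => /rowP/(_ 0)/eqP.
by rewrite !mxE eqxx oner_eq0.
Qed.

(** The induction step of the spectral theorem: moving an eigenvector to the
    first coordinate axis splits off a block of size one. *)
Lemma orthogonal_with_first_row n (v : 'rV[R]_n.+1) : v *m v^T = 1%:M ->
  exists2 H : 'M[R]_n.+1, H *m H^T = 1%:M & row 0 H = v.
Proof.
move=> vv; pose e : 'rV[R]_n.+1 := delta_mx 0 0.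
have ee : e *m e^T = 1%:M.
  by rewrite /e trmx_delta mul_delta_mx; apply/matrixP => i j; rewrite !mxE !ord1.
have [ve|ve] := eqVneq v e.
  exists 1%:M; first by rewrite trmx1 mulmx1.
  by rewrite ve; apply/rowP => j; rewrite !mxE eq_sym.
(* The reflection in the hyperplane bisecting v and the first basis vector. *)
pose u := e - v.
have [c uu] : exists c, u *m u^T = c%:M.
  by exists ((u *m u^T) 0 0); apply/matrixP => i j; rewrite !ord1 [RHS]mxE eqxx mulr1n.
have c0 : c != 0.
  apply: contra ve => /eqP c0; rewrite eq_sym -subr_eq0 -/u.
  have : \sum_j u 0 j ^+ 2 = 0.
    transitivity ((u *m u^T) 0 0); last by rewrite uu c0 mxE mul0rn.
    by rewrite [RHS]mxE; apply: eq_bigr => j _; rewrite [u^T _ _]mxE expr2.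
  move/eqP; rewrite psumr_eq0; last by move=> j _; exact: sqr_ge0.
  move=> /allP u0; apply/eqP/rowP => j; rewrite [RHS]mxE.
  by apply/eqP; rewrite -sqrf_eq0; exact: u0 (mem_index_enum j).
have eu : 2 *: (e *m u^T) = c%:M.
  have uT : u^T = e^T - v^T by rewrite /u linearB.
  rewrite -uu uT /u !(mulmxBl, mulmxBr) ee vv.
  have -> : v *m e^T = e *m v^T.
    rewrite -[LHS]trmxK trmx_mul trmxK.
    by apply/matrixP => i j; rewrite !ord1 !mxE.
  by apply/matrixP => i j; rewrite !mxE; ring.
pose H : 'M[R]_n.+1 := 1%:M - (2 / c) *: (u^T *m u).
exists H.
  have -> : H^T = H.
    by rewrite /H linearB /= linearZ /= trmx_mul trmxK trmx1.
  have SS : (u^T *m u) *m (u^T *m u) = c *: (u^T *m u).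
    by rewrite mulmxA -(mulmxA u^T) uu mul_mx_scalar -scalemxAl.
  rewrite /H; move: (u^T *m u) SS => S SS.
  rewrite mulmxBl !mulmxBr !mul1mx !mulmx1 -scalemxAl -scalemxAr SS.
  apply/matrixP => i j; rewrite !mxE; move: (S i j) => x; field => //.
rewrite rowE -/e /H mulmxBr mulmx1 -scalemxAr mulmxA.
have -> : e *m u^T = (c / 2)%:M.
  have := congr1 (fun X => 2^-1 *: X) eu.
  by rewrite scalerA mulVf ?pnatr_eq0// scale1r => ->; rewrite scale_scalar_mx mulrC.
rewrite mul_scalar_mx scalerA (_ : 2 / c * (c / 2) = 1); last by field.
by rewrite scale1r /u opprB addrC subrK.
Qed.

Lemma symmetric_block n (B : 'M[R]_(1 + n)) r : B^T = B ->
  row 0 B = r *: delta_mx 0 0 -> B = block_mx r%:M 0 0 (drsubmx B).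
Proof.
move=> BT Bul.
have B0j j : B 0 j = r *+ (j == 0).
  by move/rowP/(_ j) : Bul; rewrite !mxE /= => ->; rewrite mulr_natr.
have Bj0 j : B j 0 = r *+ (j == 0) by rewrite -BT mxE B0j.
have l0 : lshift n (0 : 'I_1) = 0 by apply/val_inj.
have r0 (j : 'I_n) : (rshift 1 j == 0) = false by [].
rewrite -[LHS]submxK; congr block_mx; apply/matrixP => i j; rewrite !mxE ?ord1.
- by rewrite l0 B0j eqxx.
- by rewrite l0 B0j r0 mulr0n.
- by rewrite l0 Bj0 r0 mulr0n.
Qed.

Lemma real_spectral n (A : 'M[R]_n) : A^T = A ->
  exists Q : 'M[R]_n, exists2 l : 'rV[R]_n,
    Q *m Q^T = 1%:M & Q *m A *m Q^T = diag_mx l.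
Proof.
elim: n A => [|n IH] A AT.
  by exists 1%:M, 0; apply/matrixP; case.
have [r /eigenvalueP[v0 v0A v0n0]] := symmetric_eigenvalue AT.
pose c := \sum_j v0 0 j ^+ 2.
have c0 : 0 < c.
  rewrite lt_def sumr_ge0 ?andbT; last by move=> j _; exact: sqr_ge0.
  apply: contra v0n0; rewrite psumr_eq0; last by move=> j _; exact: sqr_ge0.
  move=> /allP v00; apply/eqP/rowP => j; rewrite [RHS]mxE.
  by apply/eqP; rewrite -sqrf_eq0; exact: v00 (mem_index_enum j).
pose v := (Num.sqrt c)^-1 *: v0.
have vA : v *m A = r *: v by rewrite -scalemxAl v0A scalerA mulrC -scalerA.
have vv : v *m v^T = 1%:M.
  apply/matrixP => i j; rewrite !ord1 !mxE eqxx mulr1n.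
  transitivity (\sum_j c^-1 * v0 0 j ^+ 2).
    apply: eq_bigr => k _; rewrite !mxE -{3}(sqr_sqrtr (ltW c0)) -exprVn; ring.
  by rewrite -mulr_sumr mulVf// gt_eqF.
have [H HH H0] := orthogonal_with_first_row vv.
pose B : 'M[R]_(1 + n) := H *m A *m H^T.
have BT : B^T = B by rewrite /B !trmx_mul trmxK AT mulmxA.
have Bul : row 0 B = r *: delta_mx 0 0.
  rewrite /B !row_mul H0 vA -scalemxAl; congr (_ *: _).
  by rewrite -H0 -row_mul HH; apply/rowP => j; rewrite !mxE eq_sym.
have BE := symmetric_block BT Bul.
have DT : (drsubmx B)^T = drsubmx B by rewrite trmx_drsub BT.
have [Q [l QQ QB]] := IH (drsubmx B) DT.
pose K : 'M[R]_(1 + n) := block_mx 1%:M 0 0 Q.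
have KT : K^T = block_mx 1%:M 0 0 Q^T.
  by rewrite /K tr_block_mx !trmx0 trmx1.
have KK : K *m K^T = 1%:M :> 'M[R]_(1 + n).
  rewrite KT /K mulmx_block !mulmx0 !mul0mx !addr0 !add0r mulmx1 QQ.
  by rewrite -scalar_mx_block.
have KBK : K *m B *m K^T = diag_mx (row_mx r%:M l).
  rewrite BE KT /K !mulmx_block !mulmx0 !mul0mx !addr0 !add0r mul1mx mulmx1 QB.
  rewrite diag_mx_row; congr block_mx; [|exact: mul0mx|exact: mul0mx].
  by apply/matrixP => i j; rewrite !ord1 !mxE.
exists (K *m (H : 'M[R]_(1 + n))), (row_mx r%:M l : 'rV[R]_(1 + n)).
  by rewrite trmx_mul mulmxA -(mulmxA _ H) HH mulmx1; exact: KK.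
rewrite -KBK trmx_mul /B !mulmxA//.
Qed.

End spectral_theorem.

Section spectrum.
Context {R : realType} {N : nat}.

Lemma char_poly_similar (Q A : 'M[R]_N) : Q *m Q^T = 1%:M ->
  char_poly (Q *m A *m Q^T) = char_poly A.
Proof.
move=> QQ; rewrite /char_poly.
have QQ' : map_mx polyC Q *m map_mx polyC Q^T = 1%:M :> 'M[{poly R}]_N.
  by rewrite -map_mxM QQ map_mx1.
have -> : char_poly_mx (Q *m A *m Q^T) =
    map_mx polyC Q *m char_poly_mx A *m map_mx polyC Q^T.
  rewrite /char_poly_mx mulmxBr mulmxBl !map_mxM; congr (_ - _).
  by rewrite mul_mx_scalar -scalemxAl QQ' scale_scalar_mx mulr1.
rewrite !det_mulmx mulrAC -det_mulmx QQ' det1 mul1r//.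
Qed.

Lemma spectrum_spec (A : 'M[R]_N) (Q : 'M[R]_N) (l : 'rV[R]_N) :
  Q *m Q^T = 1%:M -> Q *m A *m Q^T = diag_mx l ->
  sorted >=%R (spectrum A) /\ perm_eq (spectrum A) [seq l 0 i | i <- enum 'I_N].
Proof.
move=> QQ QA; pose s := [seq l 0 i | i <- enum 'I_N].
have cA : char_poly A = \prod_(x <- s) ('X - x%:P).
  rewrite -(char_poly_similar A QQ) QA char_poly_trig ?diag_mx_is_trig//.
  rewrite big_map big_enum /=.
  by apply: eq_bigr => i _; rewrite mxE eqxx mulr1n.
have : exists t, [set s : seq R |
    sorted >=%R s /\ char_poly A = \prod_(x <- s) ('X - x%:P)] t.
  exists (sort >=%R s); split; first by apply: sort_sorted => x y; exact: le_total.
  by rewrite cA; apply: perm_big; rewrite perm_sym perm_sort.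
move=> /(xgetPex [::])[sA pA]; split => //.
by apply: prod_XsubC_eq; rewrite -cA -pA.
Qed.

End spectrum.

Section diagonalization.
Context {R : realType} {N : nat}.

Lemma spectral_decomposition (A : 'M[R]_N) : A^T = A ->
  [/\ sorted >=%R (spectrum A), size (spectrum A) = N &
    exists2 Q : 'M[R]_N, Q *m Q^T = 1%:M &
      Q *m A *m Q^T = diag_mx (\row_i (spectrum A)`_i)].
Proof.
move=> AT; have [Q [l QQ QA]] := real_spectral AT.
have [sA pA] := spectrum_spec QQ QA.
have szA : size (spectrum A) = N by rewrite (perm_size pA) size_map size_enum_ord.
split => //.
have /tuple_permP[p sE] : perm_eq (spectrum A) [tuple l 0 i | i < N].
  by rewrite (perm_trans pA)//= perm_refl.
have lE (i : 'I_N) : (spectrum A)`_i = l 0 (p i).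
  by rewrite sE (nth_map i) ?size_enum_ord// nth_ord_enum !tnth_mktuple.
exists (row_perm p Q).
  apply/matrixP => i j; move/matrixP/(_ (p i) (p j)) : QQ.
  rewrite !mxE (inj_eq perm_inj) => <-.
  by apply: eq_bigr => k _; rewrite !mxE.
apply/matrixP => i j; move/matrixP/(_ (p i) (p j)) : QA.
rewrite !mxE (inj_eq perm_inj) lE => <-.
apply: eq_bigr => k _; rewrite !mxE; congr (_ * _).
by apply: eq_bigr => m _; rewrite !mxE.
Qed.

Lemma size_spectrum (A : 'M[R]_N) : A^T = A -> size (spectrum A) = N.
Proof. by case/spectral_decomposition. Qed.

Lemma spectrum_nonincreasing (A : 'M[R]_N) i j : A^T = A ->
  (i <= j)%N -> (j < N)%N -> (spectrum A)`_j <= (spectrum A)`_i.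
Proof.
move=> AT ij jN; have [sA szA _] := spectral_decomposition AT.
have tr : transitive (>=%R : rel R) by move=> y x z xy yz; exact: le_trans yz xy.
by apply: (sorted_leq_nth tr (fun x => lexx x) 0 sA) => //; rewrite inE szA// (leq_ltn_trans ij).
Qed.

Lemma sum_spectrum (A : 'M[R]_N) (f : R -> R) : A^T = A ->
  \sum_(x <- spectrum A) f x = \sum_(i < N) f (spectrum A)`_i.
Proof. by move=> AT; rewrite (big_nth 0) size_spectrum// big_mkord. Qed.

(** Traces of powers are polynomial in the entries: through them the symmetric
    functions of the spectrum are seen to be measurable. *)
Lemma trace_expM (A : 'M[R]_N) k : A^T = A ->
  \tr (iter k (mulmx A) 1%:M) = \sum_(i < N) (spectrum A)`_i ^+ k.
Proof.
move=> AT; have [_ _ [Q QQ QA]] := spectral_decomposition AT.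
have QQ' := mulmx1C QQ.
have E : Q *m iter k (mulmx A) 1%:M *m Q^T =
    diag_mx (\row_i (spectrum A)`_i ^+ k).
  elim: k => [|k IH] /=.
    by rewrite mulmx1 QQ; apply/matrixP => i j; rewrite !mxE expr0.
  have -> : Q *m (A *m iter k (mulmx A) 1%:M) *m Q^T =
      (Q *m A *m Q^T) *m (Q *m iter k (mulmx A) 1%:M *m Q^T).
    by rewrite !mulmxA -[Q *m A *m Q^T *m Q]mulmxA QQ' mulmx1.
  rewrite QA IH mulmx_diag; congr diag_mx; apply/rowP => j.
  by rewrite !mxE exprS.
transitivity (\tr (Q *m iter k (mulmx A) 1%:M *m Q^T)).
  by rewrite mxtrace_mulC mulmxA QQ' mul1mx.
by rewrite E mxtrace_diag; apply: eq_bigr => i _; rewrite mxE.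
Qed.

Lemma quad_form_rotate (A Q : 'M[R]_N) (l : 'I_N -> R) (x : N.-tuple R) :
  Q *m Q^T = 1%:M -> Q *m A *m Q^T = diag_mx (\row_i l i) ->
  quad_form A x = diag_form l (rotate Q x).
Proof.
move=> QQ QA; have QQ' := mulmx1C QQ.
have -> : A = Q^T *m diag_mx (\row_i l i) *m Q.
  by rewrite -QA !mulmxA QQ' mul1mx -mulmxA QQ' mulmx1.
pose v : 'cV[R]_N := \col_j tnth x j.
have E (B : 'M[R]_N) : quad_form B x = (v^T *m B *m v) 0 0.
  rewrite mxE /quad_form exchange_big /=; apply: eq_bigr => j _.
  rewrite !mxE mulr_suml; apply: eq_bigr => i _.
  by rewrite !mxE; ring.
rewrite E !mulmxA -(mulmxA _ Q v) -trmx_mul mxE.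
apply: eq_bigr => i _; rewrite tnth_mktuple.
have -> : \sum_(j < N) Q i j * tnth x j = (Q *m v) i 0.
  by rewrite mxE; apply: eq_bigr => j _; rewrite mxE.
by rewrite mul_mx_diag !mxE; ring.
Qed.

Notation TN := (N.-tuple (measurableTypeR R)).

Lemma measurable_quad_form (A : 'M[R]_N) :
  measurable_fun [set: TN] (quad_form A : TN -> R).
Proof.
apply: measurable_sum => i; apply: measurable_sum => j.
by apply: measurable_funM; [apply: measurable_funM => //|]; exact: measurable_tnth.
Qed.

Lemma partition_function_diag (w : probability TN R) (A : 'M[R]_N) (b : R) :
  uniform_on_sphere w -> A^T = A ->
  partition_function w A b =
  \int[w]_(x in sphere) expR (b * diag_form (fun i => (spectrum A)`_i) x).
Proof.
move=> uw AT; have [_ _ [Q QQ QA]] := spectral_decomposition AT.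
rewrite /partition_function (@Rintegral_full _ _ _ w sphere); first last.
- apply: measurableT_comp => //; apply: measurable_funM => //.
  exact: measurable_quad_form.
- exact: uw.1.
- exact: measurable_sphere.
pose f (x : TN) : R := expR (b * diag_form (fun i => (spectrum A)`_i) x).
transitivity (\int[w]_(x in sphere) f (rotate Q x)).
  by apply: eq_Rintegral => x _; rewrite (quad_form_rotate _ QQ QA).
apply: (@Rintegral_rotate _ _ w uw Q f
  (expR (`|b| * \sum_(i < N) (`|(spectrum A)`_i| * N%:R))) QQ).
  apply: measurableT_comp => //; apply: measurable_funM => //.
  exact: measurable_diag_form.
move=> x Sx; rewrite ger0_norm ?expR_ge0// ler_expR.
rewrite (le_trans (ler_norm _))// normrM ler_wpM2l//.
rewrite (le_trans (ler_norm_sum _ _ _))// ler_sum// => i _.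
by rewrite normrM ler_wpM2l// ger0_norm ?sqr_ge0//; exact: sphere_le.
Qed.

End diagonalization.

(** * Measurability of eigenvalues and of the free energy *)

Section measurability.
Context {R : realType} {N : nat} d (T : measurableType d) (M : T -> 'M[R]_N).
Hypothesis mM : forall i j, measurable_fun [set: T] (fun t => M t i j).
Hypothesis sM : forall t, (M t)^T = M t.

Lemma measurable_exponential_sum (c : R) :
  measurable_fun [set: T] (fun t => \sum_(i < N) expR (c * (spectrum (M t))`_i)).
Proof.
have mpow k i j : measurable_fun [set: T]
    (fun t => (iter k (mulmx (M t)) 1%:M : 'M[R]_N) i j).
  elim: k i j => [|k IH] i j /=; first exact: measurable_cst.
  rewrite (_ : (fun t => _) = fun t => \sum_l M t i l *
      (iter k (mulmx (M t)) 1%:M : 'M[R]_N) l j); last first.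
    by apply/funext => t; rewrite mxE.
  by apply: measurable_sum => l; exact: measurable_funM.
apply: (measurable_fun_cvg (h := fun m t => \sum_(0 <= k < m)
    (c ^+ k / k`!%:R * \tr (iter k (mulmx (M t)) 1%:M : 'M[R]_N)))).
  move=> m; apply: measurable_sum => k; apply: measurable_funM => //.
  by apply: measurable_sum => i; exact: mpow.
move=> t _ /=.
rewrite (_ : (fun m => _) = (fun m : nat => \sum_(i < N)
    series (exp_coeff (c * (spectrum (M t))`_i)) m)); last first.
  apply/funext => m; rewrite /series/= exchange_big /=; apply: eq_bigr => k _.
  rewrite trace_expM// mulr_sumr; apply: eq_bigr => i _.
  by rewrite /exp_coeff /= exprMn; ring.
apply: cvg_big => [|i _]; first exact: add_continuous.
exact: is_cvg_series_exp_coeff.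
Qed.

(** The k-th eigenvalue is the limit of (1/n) ln sum_(i >= k) exp(n lambda_i), and
    these sums are measurable once the previous eigenvalues are. *)
Lemma measurable_spectrum k : measurable_fun [set: T] (fun t => (spectrum (M t))`_k).
Proof.
have [kN|Nk] := ltnP k N; last first.
  rewrite (_ : (fun t => _) = fun=> 0); first exact: measurable_cst.
  by apply/funext => t; rewrite nth_default// size_spectrum.
elim/ltn_ind: k kN => k IH kN.
have N0 : 0 < N%:R :> R by rewrite ltr0n (leq_ltn_trans _ kN).
pose S n t := \sum_(i < N | (k <= i)%N) expR (n.+1%:R * (spectrum (M t))`_i).
have mS n : measurable_fun [set: T] (S n).
  rewrite (_ : S n = fun t => \sum_(i < N) expR (n.+1%:R * (spectrum (M t))`_i) -
      \sum_(i < N) (if (i < k)%N then expR (n.+1%:R * (spectrum (M t))`_i) else 0)).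
    apply: measurable_funB; first exact: measurable_exponential_sum.
    apply: measurable_sum => i; have [ik|ki] := ltnP i k; last exact: measurable_cst.
    apply: measurableT_comp => //; apply: measurable_funM => //.
    by apply: IH.
  apply/funext => t; rewrite -big_mkcond /= (bigID (fun i : 'I_N => (k <= i)%N)) /=.
  by under [in X in _ = _ + _ - X]eq_bigl do rewrite ltnNge; rewrite addrK.
apply: (measurable_fun_cvg (h := fun n t => n.+1%:R^-1 * ln (S n t))).
  by move=> n; apply: measurable_funM => //; apply: measurableT_comp.
move=> t _; set l := (spectrum (M t))`_k.
have Sge n : expR (n.+1%:R * l) <= S n t.
  rewrite /S (bigD1 (Ordinal kN))//= lerDl; apply: sumr_ge0 => i _.
  exact: expR_ge0.
have Sle n : S n t <= N%:R * expR (n.+1%:R * l).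
  apply: (@le_trans _ _ (\sum_(i < N) expR (n.+1%:R * l))); last first.
    by rewrite sumr_const card_ord -[leLHS]mulr_natl.
  rewrite /S big_mkcond /= ler_sum// => i _; case: ifP => ki; last exact: expR_ge0.
  by rewrite ler_expR ler_wpM2l// spectrum_nonincreasing.
apply: (@squeeze_cvgr _ _ _ _ (fun=> l) (fun n => l + ln N%:R * n.+1%:R^-1)).
- apply: nearW => n; have S0 : 0 < S n t by exact: lt_le_trans (expR_gt0 _) (Sge n).
  have lnS1 : n.+1%:R * l <= ln (S n t) by rewrite -ler_expR lnK ?posrE.
  have lnS2 : ln (S n t) <= ln N%:R + n.+1%:R * l.
    by rewrite -ler_expR lnK ?posrE// expRD lnK ?posrE.
  have n0 : 0 < n.+1%:R :> R by rewrite ltr0n.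
  apply/andP; split; first by rewrite mulrC ler_pdivlMr// mulrC.
  rewrite mulrC ler_pdivrMr// mulrDl -mulrA mulVf ?gt_eqF// mulr1.
  by rewrite addrC (mulrC l).
- exact: cvg_cst.
- rewrite -[X in _ --> X]addr0; apply: cvgD; first exact: cvg_cst.
  rewrite -[X in _ --> X](mulr0 (ln N%:R)); apply: cvgMr.
  exact: cvg_harmonic.
Qed.

Lemma measurable_sum_spectrum (f : R -> R) : measurable_fun [set: R] f ->
  measurable_fun [set: T] (fun t => \sum_(x <- spectrum (M t)) f x).
Proof.
move=> mf; rewrite (_ : (fun t => _) = fun t => \sum_(i < N) f (spectrum (M t))`_i).
  by apply: measurable_sum => i; apply: measurableT_comp => //; exact: measurable_spectrum.
by apply/funext => t; rewrite sum_spectrum.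
Qed.

(** By the Fubini-Tonelli theorem, since (t, x) |-> exp(b <x, M(t) x>) is jointly
    measurable. *)
Lemma measurable_free_energy (w : probability (N.-tuple (measurableTypeR R)) R) b :
  measurable_fun [set: T] (fun t => free_energy w (M t) b).
Proof.
apply: measurable_funM => //; apply: measurableT_comp => //.
rewrite /partition_function /Rintegral.
apply: measurableT_comp => //.
pose g (z : T * N.-tuple (measurableTypeR R)) :=
  (expR (b * quad_form (M z.1) z.2))%:E.
apply: (@measurable_fun_fubini_tonelli_F _ _ _ _ R w g).
  apply/measurable_EFinP; apply: measurableT_comp => //.
  apply: measurable_funM => //.
  apply: measurable_sum => i; apply: measurable_sum => j.
  apply: measurable_funM.
    apply: measurable_funM.
      by apply: (measurableT_comp (mM i j)); exact: measurable_fst.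
    by apply: (measurableT_comp (measurable_tnth i)); exact: measurable_snd.
  by apply: (measurableT_comp (measurable_tnth j)); exact: measurable_snd.
by move=> z; rewrite lee_fin expR_ge0.
Qed.

End measurability.

(** * Mass of a measure at a square-root edge *)

Lemma measurable_inv (R : realType) : measurable_fun [set: R] (fun x : R => x^-1).
Proof.
rewrite (_ : (fun x => _) = (fun x : R =>
    if 0 <= x then x `^ (-1) else - ((- x) `^ (-1)))); last first.
  apply/funext => x; have [x0|x0] := leP 0 x; first by rewrite powR_inv1.
  by rewrite powR_inv1 ?oppr_ge0 ?ltW// invrN opprK.
apply: measurable_fun_ifT; first exact: measurable_fun_ler.
  exact: measurable_powR.
by apply: measurableT_comp => //; apply: (measurableT_comp (measurable_powR _)).
Qed.

Section integral_bounds.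
Context d (Y : measurableType d) (R : realType).

Lemma Rintegral_le_cst (mu : {finite_measure set Y -> \bar R}) (A : set Y)
    (f : Y -> R) (c m : R) : measurable A -> mu.-integrable A (EFin \o f) ->
  0 <= c -> (forall x, A x -> f x <= c) -> (mu A <= m%:E)%E ->
  \int[mu]_(x in A) f x <= c * m.
Proof.
move=> mA intf c0 fc mum.
apply: (@le_trans _ _ (\int[mu]_(x in A) c)).
  by apply: le_Rintegral => //; exact: finite_measure_integrable_cst.
rewrite Rintegral_cst// ler_wpM2l// -lee_fin fineK//; exact: fin_num_measure.
Qed.

Lemma Rintegral_ge_cst (mu : {finite_measure set Y -> \bar R}) (A D : set Y)
    (f : Y -> R) (c m : R) : measurable A -> measurable D -> A `<=` D ->
  mu.-integrable D (EFin \o f) -> (forall x, D x -> 0 <= f x) ->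
  0 <= c -> (forall x, A x -> c <= f x) -> (m%:E <= mu A)%E ->
  c * m <= \int[mu]_(x in D) f x.
Proof.
move=> mA mD AD intf f0 c0 fc mum.
have intA : mu.-integrable A (EFin \o f) by exact: integrableS intf.
apply: (@le_trans _ _ (\int[mu]_(x in A) f x)); last first.
  rewrite /Rintegral fine_le//; [exact: integrable_fin_num..|].
  apply: ge0_subset_integral => //.
    by apply: measurable_int; exact: intf.
apply: (@le_trans _ _ (\int[mu]_(x in A) c)); last first.
  by apply: le_Rintegral => //; exact: finite_measure_integrable_cst.
rewrite Rintegral_cst// ler_wpM2l// -lee_fin fineK//; exact: fin_num_measure.
Qed.

End integral_bounds.

Section edge_density.
Context {R : realType}.
Variables (nu : probability (measurableTypeR R) R) (Cm Cp s : R).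
Hypothesis CmCp : Cm < Cp.
Hypothesis s0 : 0 < s.
Variable rho : R -> R.
Hypothesis mrho : measurable_fun [set: measurableTypeR R] rho.
Hypothesis rho0 : forall x, 0 <= rho x.
Hypothesis nuE : forall A : set (measurableTypeR R), measurable A ->
  nu A = (\int[lebesgue_measure]_(x in A) (rho x)%:E)%E.
Variable h : R -> R.
Hypothesis hO : h =O_ (Cp^'-) (fun x : R => Cp - x).
Hypothesis rhoE : \forall x \near Cp^'-,
  rho x = s * Num.sqrt (Cp - x) * (1 + h x).

Lemma density_set1 x : nu [set x] = 0%E.
Proof. by rewrite nuE//; exact: integral_set1. Qed.

(** Near the edge the correction 1 + O(C_+ - x) lies between 1/2 and 2. *)
Lemma edge_density : exists eta : R, [/\ 0 < eta, eta <= Cp - Cm &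
  forall x, Cp - eta < x < Cp ->
    s / 2 * Num.sqrt (Cp - x) <= rho x <= 2 * s * Num.sqrt (Cp - x)].
Proof.
have /eqO_exP[K /= K0 hK] := hO.
have H : \forall x \near Cp^'-,
    s / 2 * Num.sqrt (Cp - x) <= rho x <= 2 * s * Num.sqrt (Cp - x).
  near=> x.
  have xCp : x < Cp by near: x; exact: nbhs_left_lt.
  have xK : Cp - x < (2 * K)^-1.
    have : Cp - (2 * K)^-1 < x.
      near: x; apply: nbhs_left_gt; rewrite ltrBlDr ltrDl invr_gt0; lra.
    lra.
  have hx : `|h x| <= 2^-1.
    have : `|h x| <= K * `|Cp - x| by near: x.
    move/le_trans; apply; rewrite gtr0_norm ?subr_gt0//.
    have -> : 2^-1 = K * (2 * K)^-1 by field; rewrite gt_eqF.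
    by rewrite ler_pM2l// ltW.
  have -> : rho x = s * Num.sqrt (Cp - x) * (1 + h x) by near: x; exact: rhoE.
  have q0 : 0 <= s * Num.sqrt (Cp - x) by rewrite mulr_ge0 ?sqrtr_ge0// ltW.
  move: hx; rewrite ler_norml => /andP[h1 h2].
  by apply/andP; split; nra.
have [e /= e0 He] := H.
exists (Num.min e (Cp - Cm)); split.
- by rewrite lt_min e0 subr_gt0.
- by rewrite ge_min lexx orbT.
- move=> x /andP[x1 x2]; apply: He => //=.
  rewrite gtr0_norm ?subr_gt0//.
  have : Num.min e (Cp - Cm) <= e by rewrite ge_min lexx.
  lra.
Unshelve. all: by end_near. Qed.

Lemma density_measure_le (A : set R) (c l : R) : measurable A -> 0 <= c ->
  (forall x, A x -> rho x <= c) -> (lebesgue_measure A <= l%:E)%E ->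
  (nu A <= (c * l)%:E)%E.
Proof.
move=> mA c0 rc Al; rewrite nuE//.
apply: (@le_trans _ _ (\int[lebesgue_measure]_(x in A) (cst c%:E) x)%E).
  apply: ge0_le_integral => //.
  - by move=> x _; rewrite lee_fin.
  - by apply/measurable_EFinP; exact: measurable_funTS.
by rewrite integral_cst// EFinM lee_wpmul2l.
Qed.

Lemma density_measure_ge (A : set R) (c l : R) : measurable A -> 0 <= c ->
  (forall x, A x -> c <= rho x) -> (l%:E <= lebesgue_measure A)%E ->
  ((c * l)%:E <= nu A)%E.
Proof.
move=> mA c0 rc Al; rewrite nuE//.
apply: (@le_trans _ _ (\int[lebesgue_measure]_(x in A) (cst c%:E) x)%E).
  by rewrite integral_cst// EFinM lee_wpmul2l.
apply: ge0_le_integral => //.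
by apply/measurable_EFinP; exact: measurable_funTS.
Qed.

(** The square-root edge enters only through these masses: intervals within
    distance O(r^2) of the edge have mass O(r^3), and a shell at distance of order
    r^2 has at least a mass of that order. The distance to the edge is written as a
    square to keep the exponents integral. *)
Lemma edge_measure : exists r0 : R, [/\ 0 < r0, (2 * r0) ^+ 2 <= Cp - Cm &
  forall r, 0 < r -> r <= r0 ->
   [/\ (nu `](Cp - r ^+ 2)%R, Cp[%classic <= (2 * s * r ^+ 3)%:E)%E,
       (nu `](Cp - (2 * r) ^+ 2)%R, (Cp - r ^+ 2)%R]%classic <= (12 * s * r ^+ 3)%:E)%E &
       ((s / 8 * r ^+ 3)%:E <= nu `](Cp - r ^+ 2)%R, (Cp - (r / 2) ^+ 2)%R]%classic)%E]].
Proof.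
have [eta [eta0 etaC rhob]] := edge_density.
have [r0 r00 r0e] : exists2 r0 : R, 0 < r0 & (2 * r0) ^+ 2 <= eta.
  (* The shells between r and 2 r must stay in the region of the density bounds. *)
  exists (Num.sqrt eta / 2); first by rewrite divr_gt0 ?sqrtr_gt0.
  by rewrite mulrC divfK ?pnatr_eq0// sqr_sqrtr// ltW.
exists r0; split => //; first exact: le_trans r0e etaC.
move=> r rp rr0.
have r2e : (2 * r) ^+ 2 <= eta by nra.
have sqb x t : 0 <= t -> Cp - x <= t ^+ 2 -> Num.sqrt (Cp - x) <= t.
  by move=> t0 xt; rewrite -(ger0_norm t0) -sqrtr_sqr ler_wsqrtr.
have sqb' x t : 0 <= t -> t ^+ 2 <= Cp - x -> t <= Num.sqrt (Cp - x).
  by move=> t0 xt; rewrite -(ger0_norm t0) -sqrtr_sqr ler_wsqrtr.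
split.
- have -> : 2 * s * r ^+ 3 = (2 * s * r) * r ^+ 2 by ring.
  apply: density_measure_le => //; first by rewrite !mulr_ge0// ltW.
    move=> x /=; rewrite in_itv/= => /andP[x1 x2].
    have /andP[_] : s / 2 * Num.sqrt (Cp - x) <= rho x <= 2 * s * Num.sqrt (Cp - x).
      by apply: rhob; apply/andP; split => //; nra.
    move/le_trans; apply; rewrite ler_wpM2l ?mulr_ge0 ?(ltW s0)//.
    by apply: sqb; [exact: ltW|lra].
  rewrite lebesgue_measure_itv/= lte_fin ifT; last by nra.
  by rewrite -EFinB lee_fin; lra.
- have -> : 12 * s * r ^+ 3 = (2 * s * (2 * r)) * (3 * r ^+ 2) by ring.
  apply: density_measure_le => //; first by rewrite !mulr_ge0// ltW.
    move=> x /=; rewrite in_itv/= => /andP[x1 x2].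
    have /andP[_] : s / 2 * Num.sqrt (Cp - x) <= rho x <= 2 * s * Num.sqrt (Cp - x).
      by apply: rhob; apply/andP; split => //; nra.
    move/le_trans; apply; rewrite ler_wpM2l ?mulr_ge0 ?(ltW s0)//.
    by apply: sqb; [rewrite mulr_ge0// ltW|lra].
  rewrite lebesgue_measure_itv/= lte_fin ifT; last by nra.
  by rewrite -EFinB lee_fin; nra.
- apply: (@le_trans _ _ ((s / 2 * (r / 2)) * (3 / 4 * r ^+ 2))%:E).
    by rewrite lee_fin; have : 0 <= s * r ^+ 3 by [rewrite mulr_ge0 ?exprn_ge0// ltW]; nra.
  apply: density_measure_ge => //; first by rewrite !mulr_ge0// ltW.
    move=> x /=; rewrite in_itv/= => /andP[x1 x2].
    have /andP[+ _] : s / 2 * Num.sqrt (Cp - x) <= rho x <= 2 * s * Num.sqrt (Cp - x).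
      by apply: rhob; apply/andP; split => //; nra.
    apply: le_trans; rewrite ler_wpM2l ?mulr_ge0 ?(ltW s0)//.
    by apply: sqb'; [rewrite divr_ge0// ltW|lra].
  rewrite lebesgue_measure_itv/= lte_fin ifT; last by nra.
  by rewrite -EFinB lee_fin; nra.
Qed.

End edge_density.

(** * Resolvent moments *)

Section resolvent_moments.
Context {R : realType}.
Variables (nu : probability (measurableTypeR R) R) (Cm Cp : R).
Hypothesis CmCp : Cm < Cp.
Local Notation D := (`[Cm, Cp]%classic : set (measurableTypeR R)).
Hypothesis nuD : nu D = 1%E.

Definition resolvent_moment (n : nat) (z : R) : R :=
  \int[nu]_(x in D) ((z - x)^-1) ^+ n.
Local Notation K := resolvent_moment.

Let mD : measurable D. Proof. exact: measurable_itv. Qed.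

Let subm_gt0 (z : R) : Cp < z -> 0 < z - Cm. Proof. by move: CmCp; lra. Qed.

Lemma support_bounds (x : R) : D x -> Cm <= x <= Cp.
Proof. by rewrite /= in_itv. Qed.

Lemma measurable_resolvent n z :
  measurable_fun [set: measurableTypeR R] (fun x : R => ((z - x)^-1) ^+ n).
Proof.
apply: measurable_funX; apply: (measurableT_comp (@measurable_inv R)).
exact: measurable_funB.
Qed.

Lemma resolvent_bounds n z x : Cp < z -> D x ->
  (z - Cm)^-1 ^+ n <= ((z - x)^-1) ^+ n <= (z - Cp)^-1 ^+ n.
Proof.
move=> zCp /support_bounds/andP[x1 x2].
have z1 : 0 < z - Cp by lra.
have z2 : 0 < z - x by lra.
have z3 : 0 < z - Cm by lra.
by apply/andP; split; rewrite lerXn2r ?nnegrE ?invr_ge0 ?(ltW z1) ?(ltW z2) ?(ltW z3)//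
  lef_pV2 ?posrE//; lra.
Qed.

Lemma integrable_resolvent n z : Cp < z ->
  nu.-integrable D (EFin \o (fun x => ((z - x)^-1) ^+ n)).
Proof.
move=> zCp; apply: (bounded_integrable (C := (z - Cp)^-1 ^+ n)) => //.
- by rewrite (le_lt_trans (probability_le1 _ mD)) ?ltry.
- by apply: measurable_funTS; exact: measurable_resolvent.
- move=> x Dx; have /andP[x1 x2] := resolvent_bounds n zCp Dx.
  rewrite ger0_norm//; apply: le_trans x1.
  by rewrite exprn_ge0// invr_ge0 ltW// subm_gt0.
Qed.

Lemma Rintegral_support_cst c : \int[nu]_(_ in D) c = c.
Proof.
rewrite Rintegral_cst// (_ : fine _ = 1) ?mulr1//.
exact: (congr1 fine nuD).
Qed.

Lemma resolvent_moment_bounds n z : Cp < z ->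
  (z - Cm)^-1 ^+ n <= K n z <= (z - Cp)^-1 ^+ n.
Proof.
move=> zCp; rewrite -[X in X <= _ <= _]Rintegral_support_cst.
rewrite -[X in _ <= _ <= X]Rintegral_support_cst.
have iK := integrable_resolvent n zCp.
have ic c : nu.-integrable D (EFin \o (fun=> c)).
  exact: finite_measure_integrable_cst.
by apply/andP; split; apply: le_Rintegral => // x Dx;
  have /andP[] := resolvent_bounds n zCp Dx.
Qed.

Lemma resolvent_moment_gt0 n z : Cp < z -> 0 < K n z.
Proof.
move=> zCp; have /andP[+ _] := resolvent_moment_bounds n zCp.
by apply: lt_le_trans; rewrite exprn_gt0// invr_gt0 subm_gt0.
Qed.

Lemma is_derive_resolvent_moment n z : Cp < z ->
  is_derive z 1 (K n) (- n%:R * K n.+1 z).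
Proof.
move=> zCp; pose u := (z + Cp) / 2.
have uCp : Cp < u by rewrite /u; lra.
have uz : u < z < z + 1 by apply/andP; split; rewrite /u; lra.
have -> : - n%:R * K n.+1 z =
    \int[nu]_(x in D) (- n%:R * ((z - x)^-1) ^+ n.+1).
  by rewrite RintegralZl//; exact: integrable_resolvent.
rewrite /K.
apply: (@is_derive_Rintegral _ _ _ nu D
  (fun z x => ((z - x)^-1) ^+ n) (fun z x => - n%:R * ((z - x)^-1) ^+ n.+1)
  u (z + 1) z (n%:R * (u - Cp)^-1 ^+ n.+1)) => //.
- by move=> t /andP[ut _]; apply: integrable_resolvent; lra.
- move=> t x /andP[ut _] Dx; have /andP[x1 x2] := support_bounds Dx.
  have tx0 : t - x != 0 by rewrite gt_eqF//; lra.
  have dt : is_derive t 1 (fun y : R => y - x) 1.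
    by apply: is_derive_eq; rewrite subr0.
  have := is_derive_exp n (is_derive_inv (f := fun y => y - x) tx0 dt).
  congr is_derive; case: n => [|m]; first by rewrite !mul0r oppr0 mul0r.
  by rewrite /= -exprVn mulr1 mulrN -mulrA -exprD addn2 mulNr.
- move=> t x /andP[ut _] Dx; have /andP[x1 x2] := support_bounds Dx.
  have tCp : Cp < t by lra.
  have /andP[y1 y2] := resolvent_bounds n.+1 tCp Dx.
  have y0 : 0 <= (t - x)^-1 ^+ n.+1 by rewrite exprn_ge0// invr_ge0; lra.
  rewrite normrM normrN (ger0_norm y0) normr_nat; apply: ler_wpM2l => //.
  apply: (le_trans y2).
  rewrite lerXn2r ?nnegrE ?invr_ge0 ?subr_ge0 ?(ltW tCp) ?(ltW uCp)//.
  by rewrite lef_pV2 ?posrE; lra.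
Qed.

Lemma continuous_resolvent_moment n z : Cp < z -> {for z, continuous (K n)}.
Proof.
move=> zCp; have [dK _] := is_derive_resolvent_moment n zCp.
exact/differentiable_continuous/derivable1_diffP.
Qed.

Lemma resolvent_difference (z z' x : R) : z - x != 0 -> z' - x != 0 ->
  (z - x)^-1 - (z' - x)^-1 = (z' - z) * ((z - x)^-1 * (z' - x)^-1).
Proof. by move=> zx z'x; field; apply/andP. Qed.

Lemma resolvent_moment_diff_le z z' : Cp < z -> z <= z' ->
  K 1 z - K 1 z' <= (z' - z) * K 2 z.
Proof.
move=> zCp zz'; have z'Cp : Cp < z' by lra.
rewrite -RintegralB//; [|exact: (integrable_resolvent 1)..].
rewrite -RintegralZl//; last exact: integrable_resolvent.
apply: le_Rintegral => //.
- have := integrableB mD (integrable_resolvent 1 zCp) (integrable_resolvent 1 z'Cp).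
  by congr integrable; apply/funext => x /=; rewrite EFinB.
- by apply: integrable_mull => //; exact: integrable_resolvent.
move=> x Dx; have /andP[x1 x2] := support_bounds Dx.
rewrite !expr1 resolvent_difference ?gt_eqF; [|lra..].
rewrite ler_wpM2l ?subr_ge0// expr2; apply: ler_wpM2l.
  by rewrite invr_ge0; lra.
by rewrite lef_pV2 ?posrE; lra.
Qed.

Lemma resolvent_moment_diff_ge z z' : Cp < z -> z <= z' ->
  (z' - z) * K 2 z' <= K 1 z - K 1 z'.
Proof.
move=> zCp zz'; have z'Cp : Cp < z' by lra.
rewrite -RintegralB//; [|exact: (integrable_resolvent 1)..].
rewrite -RintegralZl//; last exact: integrable_resolvent.
apply: le_Rintegral => //.
- by apply: integrable_mull => //; exact: integrable_resolvent.
- have := integrableB mD (integrable_resolvent 1 zCp) (integrable_resolvent 1 z'Cp).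
  by congr integrable; apply/funext => x /=; rewrite EFinB.
move=> x Dx; have /andP[x1 x2] := support_bounds Dx.
rewrite !expr1 resolvent_difference ?gt_eqF; [|lra..].
rewrite ler_wpM2l ?subr_ge0// expr2; apply: ler_wpM2r.
  by rewrite invr_ge0; lra.
by rewrite lef_pV2 ?posrE; lra.
Qed.

Lemma resolvent_moment1_decreasing z z' : Cp < z -> z < z' -> K 1 z' < K 1 z.
Proof.
move=> zCp zz'; rewrite -subr_gt0.
apply: lt_le_trans (resolvent_moment_diff_ge zCp (ltW zz')).
by rewrite mulr_gt0 ?subr_gt0//; apply: resolvent_moment_gt0; lra.
Qed.

Section edge.
Variables (s r0 : R).
Hypotheses (s0 : 0 < s) (r00 : 0 < r0) (r0C : (2 * r0) ^+ 2 <= Cp - Cm).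
Hypothesis nuCp : nu [set Cp] = 0%E.
Hypothesis edge : forall r : R, 0 < r -> r <= r0 ->
   [/\ (nu `](Cp - r ^+ 2)%R, Cp[%classic <= (2 * s * r ^+ 3)%:E)%E,
       (nu `](Cp - (2 * r) ^+ 2)%R, (Cp - r ^+ 2)%R]%classic <= (12 * s * r ^+ 3)%:E)%E &
       ((s / 8 * r ^+ 3)%:E <= nu `](Cp - r ^+ 2)%R, (Cp - (r / 2) ^+ 2)%R]%classic)%E].

(** Only the shell at distance of order r^2 from the edge is kept. *)
Lemma resolvent_moment_edge_ge n (r : R) : 0 < r -> r <= r0 ->
  ((2 * r ^+ 2)^-1) ^+ n * (s / 8 * r ^+ 3) <= K n (Cp + r ^+ 2).
Proof.
move=> rp rr0; have [_ _ e3] := edge rp rr0.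
have r2 : 0 < r ^+ 2 by rewrite exprn_gt0.
have zCp : Cp < Cp + r ^+ 2 by lra.
have r2r0 : r ^+ 2 <= r0 ^+ 2 by rewrite lerXn2r ?nnegrE ?(ltW rp) ?(ltW r00).
have r2C : r ^+ 2 <= Cp - Cm.
  by move: r0C; rewrite exprMn; have := sqr_ge0 r0; lra.
apply: (@Rintegral_ge_cst _ _ _ nu `](Cp - r ^+ 2)%R, (Cp - (r / 2) ^+ 2)%R]%classic D
  (fun x => ((Cp + r ^+ 2 - x)^-1) ^+ n)) => //.
- move=> x /=; rewrite !in_itv/= => /andP[x1 x2].
  by apply/andP; split; nra.
- exact: integrable_resolvent.
- move=> x Dx; have /andP[+ _] := resolvent_bounds n zCp Dx.
  by apply: le_trans; rewrite exprn_ge0// invr_ge0; lra.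
- by rewrite exprn_ge0// invr_ge0; lra.
- move=> x /=; rewrite in_itv/= => /andP[x1 x2].
  have xp : 0 < Cp + r ^+ 2 - x by nra.
  rewrite lerXn2r ?nnegrE ?invr_ge0 ?(ltW xp)//; first by lra.
  by rewrite lef_pV2 ?posrE//; lra.
Qed.

(** Decomposition into dyadic shells: the points with t^2 < Cp - x <= 4 t^2 have
    mass O(t^3) and contribute O(t^3 / t^4); the sum over t = r, 2 r, 4 r, ... is
    geometric and dominated by the innermost shell. *)
Lemma resolvent_moment2_edge_le : exists C, 0 < C /\
  forall r : R, 0 < r -> r <= r0 -> K 2 (Cp + r ^+ 2) <= C / r.
Proof.
(* 24 s for the shells, 2 s for the points within r^2 of the edge, and the last
   term for the points at distance at least r0^2. *)
pose C := 26 * s + r0 * ((r0 ^+ 2)^-1) ^+ 2.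
have C0 : 0 < C by rewrite addr_gt0 ?mulr_gt0 ?exprn_gt0 ?invr_gt0 ?exprn_gt0.
exists C; split => // r rp rr0.
have r2 : 0 < r ^+ 2 by rewrite exprn_gt0.
have r02 : 0 < r0 ^+ 2 by rewrite exprn_gt0.
have r2r0 : r ^+ 2 <= r0 ^+ 2 by rewrite lerXn2r ?nnegrE ?(ltW rp) ?(ltW r00).
have r0C' : r0 ^+ 2 <= Cp - Cm by move: r0C; rewrite exprMn; lra.
have zCp : Cp < Cp + r ^+ 2 by lra.
pose f (x : measurableTypeR R) : R := ((Cp + r ^+ 2 - x)^-1) ^+ 2.
have intf : nu.-integrable D (EFin \o f) by exact: integrable_resolvent.
have subf (A : set R) : measurable A -> A `<=` D -> nu.-integrable A (EFin \o f).
  by move=> mA AD; exact: integrableS intf.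
have f_le (x y : R) : x <= Cp -> 0 < y -> y <= Cp + r ^+ 2 - x -> f x <= (y^-1) ^+ 2.
  move=> xCp y0 yx; rewrite /f lerXn2r ?nnegrE ?invr_ge0 ?(ltW y0)//; first by lra.
  by rewrite lef_pV2 ?posrE//; lra.
have shells k t : r <= t -> r0 <= t * 2 ^+ k -> t <= r0 ->
    \int[nu]_(x in `]Cp - r0 ^+ 2, Cp - t ^+ 2]) f x <= 24 * s / t.
  elim: k t => [|k IH] t rt r0t tr0.
    have -> : t = r0 by apply/eqP; rewrite eq_le tr0/= -[t]mulr1.
    rewrite set_itv_ge ?bnd_simp ?ltxx// Rintegral_set0.
    by rewrite divr_ge0 ?mulr_ge0 ?ltW.
  have tp : 0 < t by lra.
  have t20 : 0 < t ^+ 2 by rewrite exprn_gt0.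
  have tt0 : t ^+ 2 <= r0 ^+ 2 by rewrite lerXn2r ?nnegrE ?(ltW tp) ?(ltW r00).
  have rt2 : r ^+ 2 <= t ^+ 2 by rewrite lerXn2r ?nnegrE ?(ltW tp) ?(ltW rp).
  have t2C : (2 * t) ^+ 2 <= Cp - Cm by move: r0C; rewrite !exprMn; lra.
  have t24 : (2 * t) ^+ 2 = 4 * t ^+ 2 by ring.
  have [_ e2 _] := edge tp tr0.
  have shell : \int[nu]_(x in `](Cp - (2 * t) ^+ 2)%R, (Cp - t ^+ 2)%R]) f x <=
      (t ^+ 2)^-1 ^+ 2 * (12 * s * t ^+ 3).
    apply: Rintegral_le_cst => //.
    - apply: subf => // x /=; rewrite !in_itv/= => /andP[x1 x2].
      by apply/andP; split; lra.
    - by rewrite exprn_ge0// invr_ge0 exprn_ge0// ltW.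
    - move=> x /=; rewrite in_itv/= => /andP[x1 x2].
      by apply: f_le; lra.
  have shellE : (t ^+ 2)^-1 ^+ 2 * (12 * s * t ^+ 3) = 12 * s / t.
    by field; rewrite gt_eqF.
  rewrite {}shellE in shell.
  have [t2|t2] := leP (2 * t) r0; last first.
    have r02t : r0 ^+ 2 <= (2 * t) ^+ 2.
      by rewrite lerXn2r ?nnegrE ?(ltW r00) ?(ltW t2)// mulr_ge0// ltW.
    apply: (@le_trans _ _ (\int[nu]_(x in `](Cp - (2 * t) ^+ 2)%R, (Cp - t ^+ 2)%R]) f x)).
      rewrite /Rintegral fine_le//.
      - apply: integrable_fin_num => //; apply: subf => // x /=.
        by rewrite !in_itv/= => /andP[x1 x2]; apply/andP; split; lra.
      - apply: integrable_fin_num => //; apply: subf => // x /=.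
        by rewrite !in_itv/= => /andP[x1 x2]; apply/andP; split; lra.
      apply: ge0_subset_integral => //.
      - by apply: measurable_funTS; apply/measurable_EFinP; exact: measurable_resolvent.
      - by move=> x _; rewrite lee_fin sqr_ge0.
      - by move=> x /=; rewrite !in_itv/= => /andP[x1 x2]; apply/andP; split; lra.
    apply: (le_trans shell); apply: ler_wpM2r; first by rewrite invr_ge0 ltW.
    by rewrite ler_pM2r// ler_nat.
  have r02t : (2 * t) ^+ 2 <= r0 ^+ 2.
    by rewrite lerXn2r ?nnegrE ?(ltW r00)// mulr_ge0// ltW.
  have -> : `]Cp - r0 ^+ 2, Cp - t ^+ 2]%classic =
      `]Cp - r0 ^+ 2, Cp - (2 * t) ^+ 2]%classic `|`
      `](Cp - (2 * t) ^+ 2)%R, (Cp - t ^+ 2)%R]%classic.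
    by rewrite -itv_bndbnd_setU// bnd_simp; lra.
  rewrite Rintegral_setU//; first last.
  - apply/disj_setPS => x [/=]; rewrite !in_itv/= => /andP[_ x1] /andP[x2 _].
    by move: (le_lt_trans x1 x2); rewrite ltxx.
  - apply: subf; first exact: measurableU.
    by move=> x [] /=; rewrite !in_itv/= => /andP[x1 x2]; apply/andP; split; lra.
  have : \int[nu]_(x in `]Cp - r0 ^+ 2, Cp - (2 * t) ^+ 2]) f x <= 24 * s / (2 * t).
    apply: IH => //; first by lra.
    by rewrite (_ : 2 * t * 2 ^+ k = t * 2 ^+ k.+1)// exprS; ring.
  have -> : 24 * s / (2 * t) = 12 * s / t by field; rewrite gt_eqF.
  have -> : 24 * s / t = 12 * s / t + 12 * s / t by field; rewrite gt_eqF.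
  lra.
have inner : \int[nu]_(x in `](Cp - r ^+ 2)%R, Cp]) f x <= 2 * s / r.
  have [e1 _ _] := edge rp rr0.
  have -> : 2 * s / r = (r ^+ 2)^-1 ^+ 2 * (2 * s * r ^+ 3) by field; rewrite gt_eqF.
  apply: Rintegral_le_cst => //.
  - apply: subf => // x /=; rewrite !in_itv/= => /andP[x1 x2].
    by apply/andP; split; lra.
  - by rewrite exprn_ge0// invr_ge0 exprn_ge0// ltW.
  - by move=> x /=; rewrite in_itv/= => /andP[x1 x2]; apply: f_le; lra.
  - rewrite -(@setUitv1 _ _ _ _ true); last by rewrite bnd_simp; lra.
    apply: (le_trans (measureU2 _ _ _)) => //.
    by rewrite [X in (_ + X <= _)%E]nuCp adde0.
have middle : \int[nu]_(x in `]Cp - r0 ^+ 2, Cp - r ^+ 2]) f x <= 24 * s / r.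
  have [k rk] : exists k, r0 <= r * 2 ^+ k.
    exists (Num.bound (r0 / r)); rewrite mulrC -ler_pdivrMr//.
    by rewrite ltW// upper_nthrootP.
  exact: (shells k).
have outer : \int[nu]_(x in `[Cm, Cp - r0 ^+ 2]) f x <= (r0 ^+ 2)^-1 ^+ 2 * 1.
  apply: Rintegral_le_cst => //.
  - by apply: subf => // x /=; rewrite !in_itv/= => /andP[x1 x2]; apply/andP; split; lra.
  - by rewrite exprn_ge0// invr_ge0 exprn_ge0// ltW.
  - by move=> x /=; rewrite in_itv/= => /andP[x1 x2]; apply: f_le; lra.
  - exact: probability_le1.
have DE : D = (`[Cm, Cp - r0 ^+ 2]%classic `|` `]Cp - r0 ^+ 2, Cp - r ^+ 2]%classic)
    `|` `](Cp - r ^+ 2)%R, Cp]%classic.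
  by rewrite -!itv_bndbnd_setU// bnd_simp; lra.
have KE : K 2 (Cp + r ^+ 2) = \int[nu]_(x in `[Cm, Cp - r0 ^+ 2]) f x +
    \int[nu]_(x in `]Cp - r0 ^+ 2, Cp - r ^+ 2]) f x +
    \int[nu]_(x in `](Cp - r ^+ 2)%R, Cp]) f x.
  have DS : (`[Cm, Cp - r0 ^+ 2]%classic `|` `]Cp - r0 ^+ 2, Cp - r ^+ 2]%classic)
    `<=` D by rewrite DE; exact: subsetUl.
  rewrite /K [in LHS]DE Rintegral_setU//; first last.
  - apply/disj_setPS => x [/=]; rewrite !in_itv/= => x1 /andP[x2 _].
    by case: x1 => /andP[_ x1]; lra.
  - by rewrite -DE.
  - exact: measurableU.
  rewrite Rintegral_setU//; first last.
  - apply/disj_setPS => x [/=]; rewrite !in_itv/= => /andP[_ x1] /andP[x2 _].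
    by lra.
  - by apply: subf => //; exact: measurableU.
rewrite KE; apply: le_trans (lerD (lerD outer middle) inner) _.
have -> : C / r = (r0 ^+ 2)^-1 ^+ 2 * (r0 / r) + 24 * s / r + 2 * s / r.
  by rewrite /C; field; rewrite !gt_eqF.
rewrite !lerD2r ler_wpM2l//.
  by rewrite exprn_ge0// invr_ge0 exprn_ge0// ltW.
by rewrite ler_pdivlMr// mul1r.
Qed.

Let edge_point (z : R) : Cp < z -> z = Cp + (Num.sqrt (z - Cp)) ^+ 2.
Proof. by move=> zCp; rewrite sqr_sqrtr ?subr_ge0 ?ltW//; ring. Qed.

(** Finiteness of the critical inverse temperature. From C_+ + (2r)^2 to C_+ + r^2 the
    moment grows by at most 3 r^2 K_2 = O(r), which is summable along dyadic r. *)
Lemma resolvent_moment1_bounded : exists B, forall z, Cp < z -> K 1 z <= B.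
Proof.
have [C [C0 KC]] := resolvent_moment2_edge_le.
pose G r := K 1 (Cp + r ^+ 2).
pose B := G (r0 / 2) + 3 * C * r0.
have mono z z' : Cp < z -> z <= z' -> K 1 z' <= K 1 z.
  move=> zCp; rewrite le_eqVlt => /predU1P[->//|zz'].
  by apply/ltW/resolvent_moment1_decreasing.
have step r : 0 < r -> r <= r0 -> G r <= G (2 * r) + 3 * C * r.
  move=> rp rr0; rewrite -lerBlDl.
  have r2 : 0 < r ^+ 2 by rewrite exprn_gt0.
  have E : (2 * r) ^+ 2 = 4 * r ^+ 2 by ring.
  apply: (le_trans (@resolvent_moment_diff_le (Cp + r ^+ 2) (Cp + (2 * r) ^+ 2) _ _)).
  - lra.
  - lra.
  have := KC _ rp rr0.
  have -> : Cp + (2 * r) ^+ 2 - (Cp + r ^+ 2) = 3 * r ^+ 2 by ring.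
  have -> : 3 * C * r = 3 * r ^+ 2 * (C / r) by field; rewrite gt_eqF.
  by apply: ler_wpM2l; rewrite mulr_ge0// ltW.
have bound k r : 0 < r -> r <= r0 -> r0 <= r * 2 ^+ k.+1 ->
    G r <= G (r0 / 2) + 3 * C * (r0 - r).
  elim: k r => [|k IH] r rp rr0 r0r.
    have : G r <= G (r0 / 2).
      rewrite expr1 in r0r.
      have H : (r0 / 2) ^+ 2 <= r ^+ 2.
        by rewrite lerXn2r ?nnegrE ?(ltW rp) ?divr_ge0 ?(ltW r00)//; lra.
      have r02 : 0 < (r0 / 2) ^+ 2 by rewrite exprn_gt0// divr_gt0.
      by apply: mono; lra.
    move/le_trans; apply; rewrite lerDl mulr_ge0 ?mulr_ge0 ?(ltW C0)//; lra.
  have [r2|r2] := leP (2 * r) r0; last first.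
    have : G r <= G (r0 / 2).
      have H : (r0 / 2) ^+ 2 <= r ^+ 2.
        by rewrite lerXn2r ?nnegrE ?(ltW rp) ?divr_ge0 ?(ltW r00)//; lra.
      have r02 : 0 < (r0 / 2) ^+ 2 by rewrite exprn_gt0// divr_gt0.
      by apply: mono; lra.
    move/le_trans; apply; rewrite lerDl mulr_ge0 ?mulr_ge0 ?(ltW C0)//; lra.
  apply: (le_trans (step _ rp rr0)).
  have : G (2 * r) <= G (r0 / 2) + 3 * C * (r0 - 2 * r).
    apply: IH => //; first by lra.
    by rewrite (_ : 2 * r * 2 ^+ k.+1 = r * 2 ^+ k.+2)// [in RHS]exprS; ring.
  have -> : 3 * C * (r0 - r) = 3 * C * (r0 - 2 * r) + 3 * C * r by ring.
  lra.
exists B => z zCp.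
have zr0 : 0 < Num.sqrt (z - Cp) by rewrite sqrtr_gt0 subr_gt0.
rewrite (edge_point zCp); move: (Num.sqrt _) zr0 => r rp.
have [rr0|rr0] := leP r r0.
  have r0r : r0 <= r * 2 ^+ (Num.bound (r0 / r)).+1.
    rewrite mulrC -ler_pdivrMr// ltW// upper_nthrootP//.
  apply: (le_trans (bound _ _ rp rr0 r0r)); rewrite /B lerD2l ler_wpM2l ?mulr_ge0 ?(ltW C0)//.
  lra.
apply: (@le_trans _ _ (G (r0 / 2))); last by rewrite lerDl !mulr_ge0 ?ltW.
have H : (r0 / 2) ^+ 2 <= r ^+ 2.
  rewrite lerXn2r ?nnegrE ?(ltW rp) ?divr_ge0 ?(ltW r00)//.
  lra.
have r02 : 0 < (r0 / 2) ^+ 2 by rewrite exprn_gt0// divr_gt0.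
by apply: mono; lra.
Qed.

End edge.
End resolvent_moments.

Section edge_constants.
Context {R : realType}.
Variables (nu : probability (measurableTypeR R) R) (Cm Cp s : R).
Hypothesis CmCp : Cm < Cp.
Hypothesis nuD : nu `[Cm, Cp]%classic = 1%E.
Hypothesis s0 : 0 < s.
Local Notation K := (resolvent_moment nu Cm Cp).

(** Summary of the edge analysis in terms of resolvent moments, with one constant
    for both lower bounds. *)
Lemma edge_constants (rho : R -> R) :
  measurable_fun [set: measurableTypeR R] rho -> (forall x, 0 <= rho x) ->
  (forall A : set (measurableTypeR R), measurable A ->
     nu A = (\int[lebesgue_measure]_(x in A) (rho x)%:E)%E) ->
  (exists2 h : R -> R, h =O_ (Cp^'-) (fun x : R => Cp - x) &
     \forall x \near Cp^'-, rho x = s * Num.sqrt (Cp - x) * (1 + h x)) ->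
  (exists B : R, forall z, Cp < z -> K 1 z <= B) /\
  exists C c r0 : R, [/\ [/\ 0 < C, 0 < c & 0 < r0],
    forall r : R, 0 < r -> r <= r0 -> K 2 (Cp + r ^+ 2) <= C / r,
    forall r : R, 0 < r -> r <= r0 -> c / r <= K 2 (Cp + r ^+ 2) &
    forall r : R, 0 < r -> r <= r0 -> c / r ^+ 3 <= K 3 (Cp + r ^+ 2)].
Proof.
move=> mrho rho0 nuE [h hO rhoE].
have nuCp := density_set1 nuE Cp.
have [r0 [r00 r0C edge]] := edge_measure CmCp s0 mrho rho0 nuE hO rhoE.
split; first exact: (resolvent_moment1_bounded CmCp nuD s0 r00 r0C nuCp edge).
have [C [C0 K2C]] := resolvent_moment2_edge_le CmCp s0 r00 r0C nuCp edge.
exists C, (s / 64), r0; have ss := s0; split => //.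
- by split => //; exact: divr_gt0.
- move=> r rp rr0.
  apply: le_trans (resolvent_moment_edge_ge CmCp r00 r0C edge 2 rp rr0).
  have -> : (2 * r ^+ 2)^-1 ^+ 2 * (s / 8 * r ^+ 3) = (s / 32) / r.
    by field; rewrite gt_eqF.
  by rewrite ler_wpM2r ?invr_ge0 ?(ltW rp)//; lra.
- move=> r rp rr0.
  apply: le_trans (resolvent_moment_edge_ge CmCp r00 r0C edge 3 rp rr0).
  by rewrite le_eqVlt; apply/orP; left; apply/eqP; field; rewrite gt_eqF.
Qed.

End edge_constants.

(** * The edge value of the resolvent and the logarithmic potential *)

Section edge_limit.
Context {R : realType}.
Variables (nu : probability (measurableTypeR R) R) (Cm Cp : R).
Hypothesis CmCp : Cm < Cp.
Local Notation D := (`[Cm, Cp]%classic : set (measurableTypeR R)).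
Local Notation D' := (`[Cm, Cp[%classic : set (measurableTypeR R)).
Hypothesis nuD : nu D = 1%E.
Hypothesis nuCp : nu [set Cp] = 0%E.
Local Notation K := (resolvent_moment nu Cm Cp).
Hypothesis K1_bounded : exists B, forall z, Cp < z -> K 1 z <= B.

Let mD : measurable D. Proof. exact: measurable_itv. Qed.
Let mD' : measurable D'. Proof. exact: measurable_itv. Qed.
Let mCp : measurable ([set Cp] : set (measurableTypeR R)).
Proof. exact: measurable_set1. Qed.
Let D'D : D' `<=` D.
Proof. by move=> x /=; rewrite !in_itv/= => /andP[-> /ltW]. Qed.
Let inD' (x : R) : D' x -> Cm <= x /\ x < Cp.
Proof. by rewrite /= in_itv/= => /andP[]. Qed.

(** At the edge the kernel 1/(C_+ - x) is singular at x = C_+, where its value is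
    conventional; as this point has no mass, it is removed from the support. *)
Lemma integrable_halfopen (f : R -> R) : measurable_fun [set: measurableTypeR R] f ->
  nu.-integrable D' (EFin \o f) -> nu.-integrable D (EFin \o f).
Proof.
move=> mf /integrableP[_ iD']; apply/integrableP; split.
  by apply/measurable_EFinP; exact: measurable_funTS.
rewrite (@ge0_negligible_integral _ _ _ nu D [set Cp] _ mCp mD)// ?setDitv1r//.
by apply: measurableT_comp => //; apply/measurable_EFinP; exact: measurable_funTS.
Qed.

Lemma Rintegral_halfopen (f : R -> R) : nu.-integrable D (EFin \o f) ->
  \int[nu]_(x in D) f x = \int[nu]_(x in D') f x.
Proof.
move=> iD; rewrite /Rintegral; congr fine.
by rewrite (@negligible_integral _ _ _ nu D [set Cp] _ mCp mD)// setDitv1r.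
Qed.

Let z_ (n : nat) : R := Cp + n.+1%:R^-1.

Let z_gt n : Cp < z_ n. Proof. by rewrite ltrDl invr_gt0 ltr0n. Qed.

Let measurable_res z : measurable_fun [set: measurableTypeR R] (fun x : R => (z - x)^-1).
Proof. exact: (measurable_resolvent 1 z). Qed.

(** Monotone convergence as z decreases to the edge. *)
Lemma cvg_resolvent_moment_edge_ereal :
  (\int[nu]_(x in D') ((z_ n - x)^-1)%:E @[n --> \oo] -->
  \int[nu]_(x in D') ((Cp - x)^-1)%:E)%E.
Proof.
have lim (x : R) : D' x ->
    (fun n => ((z_ n - x)^-1)%:E) @ \oo --> ((Cp - x)^-1)%:E.
  move=> /inD'[x1 x2]; apply: cvg_EFin; first exact: nearW.
  apply: cvgV; first by rewrite gt_eqF// subr_gt0.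
  apply: cvgB; last exact: cvg_cst.
  rewrite -[X in _ --> X]addr0; apply: cvgD; first exact: cvg_cst.
  exact: cvg_harmonic.
have -> : (\int[nu]_(x in D') ((Cp - x)^-1)%:E)%E =
    (\int[nu]_(x in D') (limn (fun n => ((z_ n - x)^-1)%:E)))%E.
  by apply: eq_integral => x; rewrite inE => D'x; apply/esym/cvg_lim => //; exact: lim.
apply: cvg_monotone_convergence => //.
- by move=> n; apply/measurable_EFinP; apply: measurable_funTS.
- move=> n x /inD'[x1 x2]; rewrite lee_fin invr_ge0.
  by have := z_gt n; lra.
- move=> x /inD'[x1 x2] m n mn; rewrite lee_fin.
  have := z_gt m; have := z_gt n => ? ?.
  rewrite lef_pV2 ?posrE; [|lra|lra].
  by rewrite lerD2r /z_ lerD2l lef_pV2 ?posrE ?ltr0n// ler_nat.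
Qed.

Let res_moment_ereal n : (\int[nu]_(x in D') ((z_ n - x)^-1)%:E)%E = (K 1 (z_ n))%:E.
Proof.
rewrite /K /resolvent_moment Rintegral_halfopen; last first.
  exact: (integrable_resolvent nu CmCp 1 (z_gt n)).
rewrite /Rintegral fineK//; apply: integrable_fin_num => //.
apply: integrableS (integrable_resolvent nu CmCp 1 (z_gt n)) => //.
Qed.

Lemma integrable_resolvent_edge : nu.-integrable D (EFin \o (fun x => (Cp - x)^-1)).
Proof.
apply: integrable_halfopen => //.
apply/integrableP; split.
  by apply/measurable_EFinP; exact: measurable_funTS.
have -> : (\int[nu]_(x in D') `|(EFin \o (fun x : R => (Cp - x)^-1)%R) x|)%E =
    (\int[nu]_(x in D') ((Cp - x)^-1)%:E)%E.
  apply: eq_integral => x; rewrite inE => /inD'[x1 x2].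
  by rewrite /= ger0_norm// invr_ge0; lra.
have [B KB] := K1_bounded.
apply: (@le_lt_trans _ _ B%:E); last exact: ltry.
have /cvg_lim <- // := cvg_resolvent_moment_edge_ereal.
apply: lime_le; first by apply/cvg_ex; eexists; exact: cvg_resolvent_moment_edge_ereal.
by apply: nearW => n; rewrite res_moment_ereal lee_fin KB.
Qed.

Lemma cvg_resolvent_moment_edge : K 1 (z_ n) @[n --> \oo] --> K 1 Cp.
Proof.
rewrite {2}/K /resolvent_moment Rintegral_halfopen; last exact: integrable_resolvent_edge.
have -> : (fun n => K 1 (z_ n)) =
    (fun n => fine (\int[nu]_(x in D') ((z_ n - x)^-1)%:E)%E).
  by apply/funext => n; rewrite res_moment_ereal.
apply: fine_cvg; rewrite fineK; first exact: cvg_resolvent_moment_edge_ereal.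
apply: integrable_fin_num => //.
exact: integrableS integrable_resolvent_edge.
Qed.

Lemma resolvent_edge_diff_ge z : Cp < z -> (z - Cp) * K 2 z <= K 1 Cp - K 1 z.
Proof.
move=> zCp; have i1 := integrable_resolvent_edge.
have i1z := integrable_resolvent nu CmCp 1 zCp.
have i2z := integrable_resolvent nu CmCp 2 zCp.
have sub f : nu.-integrable D f -> nu.-integrable D' f by exact: integrableS.
rewrite /K /resolvent_moment !Rintegral_halfopen//.
rewrite -RintegralB//; [|exact: sub..].
rewrite -RintegralZl//; last exact: sub.
apply: le_Rintegral => //.
- by apply: integrable_mull => //; exact: sub.
- have := integrableB mD' (sub _ i1) (sub _ i1z).
  by congr integrable; apply/funext => x /=; rewrite EFinB.
move=> x /inD'[x1 x2].
rewrite !expr1 resolvent_difference ?gt_eqF; [|lra..].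
rewrite ler_wpM2l ?subr_ge0 ?(ltW zCp)// expr2; apply: ler_wpM2r.
  by rewrite invr_ge0; lra.
by rewrite lef_pV2 ?posrE; lra.
Qed.

Lemma resolvent_edge_gt z : Cp < z -> K 1 z < K 1 Cp.
Proof.
move=> zCp; rewrite -subr_gt0; apply: lt_le_trans (resolvent_edge_diff_ge zCp).
by rewrite mulr_gt0 ?subr_gt0//; exact: (resolvent_moment_gt0 CmCp nuD).
Qed.

Lemma resolvent_edge_gt0 : 0 < K 1 Cp.
Proof.
have z : Cp < Cp + 1 by rewrite ltrDl.
exact: lt_trans (resolvent_moment_gt0 CmCp nuD 1 z) (resolvent_edge_gt z).
Qed.

Lemma resolvent_moment1_surjective (y : R) : 0 < y -> y < K 1 Cp ->
  exists2 z, Cp < z & K 1 z = y.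
Proof.
move=> y0 yK.
have [n yn] : exists n, y < K 1 (z_ n).
  have := cvg_resolvent_moment_edge => /cvgr_gt/(_ _ yK)[n _ H].
  by exists n; exact: (H n (leqnn n)).
pose z2 := Num.max (z_ n) (Cp + y^-1).
have z2n : z_ n <= z2 by rewrite le_max lexx.
have z2Cp : Cp < z2 by exact: lt_le_trans (z_gt n) z2n.
have Kz2 : K 1 z2 <= y.
  have /andP[_] := resolvent_moment_bounds CmCp nuD 1 z2Cp.
  move/le_trans; apply; rewrite expr1.
  rewrite invf_ple ?posrE ?subr_gt0// lerBrDl.
  by rewrite le_max lexx orbT.
have cK : {within `[z_ n, z2], continuous (K 1)}.
  apply: continuous_in_subspaceT => x; rewrite inE/= in_itv/= => /andP[x1 _].
  apply: continuous_resolvent_moment => //; exact: lt_le_trans (z_gt n) x1.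
have [|z zin Kz] := IVT z2n cK (v := y).
  by rewrite ge_min le_max Kz2 (ltW yn) orbT.
exists z => //; move: zin; rewrite in_itv/= => /andP[z1 _].
exact: lt_le_trans (z_gt n) z1.
Qed.

Definition log_potential (z : R) : R := \int[nu]_(x in D) ln (z - x).
Local Notation J := log_potential.

(** Up to the edge the logarithm is integrable because the resolvent is. *)
Lemma ln_abs_le (y : R) : 0 <= y -> `|ln y| <= y^-1 + y.
Proof.
rewrite le_eqVlt => /predU1P[<-|y0].
  by rewrite ln0// normr0 invr0 addr0.
have y1 : 0 < y^-1 by rewrite invr_gt0.
have l1 := ln_le_sub1 y0; have l2 := ln_ge_1subV y0.
by rewrite ler_norml; apply/andP; split; lra.
Qed.

Lemma integrable_resolvent_ge z : Cp <= z ->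
  nu.-integrable D (EFin \o (fun x => (z - x)^-1)).
Proof.
rewrite le_eqVlt => /predU1P[<-|zCp]; first exact: integrable_resolvent_edge.
exact: (integrable_resolvent nu CmCp 1 zCp).
Qed.

Lemma integrable_sub z : nu.-integrable D (EFin \o (fun x => z - x)).
Proof.
apply: (bounded_integrable (C := `|z| + `|Cm| + `|Cp|)) => //.
- by rewrite (le_lt_trans (probability_le1 _ mD)) ?ltry.
- by apply: measurable_funTS; exact: measurable_funB.
- move=> x; rewrite /= in_itv/= => /andP[x1 x2].
  rewrite (le_trans (ler_normB _ _))// -addrA lerD2l ler_norml.
  have := ler_norm (- Cm); have := ler_norm Cp; rewrite normrN => ? ?.
  have := normr_ge0 Cm; have := normr_ge0 Cp => ? ?.
  by apply/andP; split; lra.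
Qed.

Lemma integrable_ln z : Cp <= z ->
  nu.-integrable D (EFin \o (fun x => ln (z - x))).
Proof.
move=> zCp.
have i : nu.-integrable D (EFin \o (fun x => (z - x)^-1 + (z - x))).
  by have := integrableD mD (integrable_resolvent_ge zCp) (integrable_sub z).
apply: le_integrable i => //.
  apply/measurable_EFinP; apply: measurable_funTS.
  by apply: (measurableT_comp (@measurable_ln R)); exact: measurable_funB.
move=> x /=; rewrite in_itv/= => /andP[x1 x2].
rewrite lee_fin; have zx : 0 <= z - x by lra.
rewrite [leRHS]ger0_norm ?ln_abs_le//.
by rewrite addr_ge0// invr_ge0.
Qed.

(** Integrated form of ln y <= y - 1 at y = (z - x)/(z0 - x). As K_1 is finite at
    the edge, the tangent point z0 = C_+ is included: this is the low-temperature
    saddle point. *)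
Lemma log_potential_tangent z0 z : Cp <= z0 -> Cp <= z ->
  J z <= J z0 + (z - z0) * K 1 z0.
Proof.
move=> z0Cp zCp.
have sub f : nu.-integrable D f -> nu.-integrable D' f by exact: integrableS.
have iz := integrable_ln zCp; have iz0 := integrable_ln z0Cp.
have ir : nu.-integrable D (EFin \o (fun x => (z0 - x)^-1)).
  exact: integrable_resolvent_ge.
have irc := integrable_mull (z - z0) mD ir.
rewrite /J /log_potential /K /resolvent_moment.
rewrite (Rintegral_halfopen iz) (Rintegral_halfopen iz0) (Rintegral_halfopen ir).
rewrite -RintegralZl//; last exact: sub.
rewrite -RintegralD//; [|exact: sub..].
apply: le_Rintegral => //; first exact: sub.
  by have := integrableD mD' (sub _ iz0) (sub _ irc).
move=> x /inD'[x1 x2].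
have p0 : 0 < z0 - x by lra.
have p : 0 < z - x by lra.
have : ln ((z - x) / (z0 - x)) <= (z - x) / (z0 - x) - 1.
  by apply: ln_le_sub1; exact: divr_gt0.
rewrite ln_div ?posrE//.
have -> : (z - x) / (z0 - x) - 1 = (z - z0) / (z0 - x) by field; rewrite gt_eqF.
lra.
Qed.

Lemma log_potential_le z z' : Cp <= z -> z <= z' -> J z <= J z'.
Proof.
move=> zCp zz'; have z'Cp : Cp <= z' by lra.
have iz := integrable_ln zCp; have iz' := integrable_ln z'Cp.
have sub f : nu.-integrable D f -> nu.-integrable D' f by exact: integrableS.
rewrite /J /log_potential (Rintegral_halfopen iz) (Rintegral_halfopen iz').
apply: le_Rintegral => //; [exact: sub..|].
by move=> x /inD'[x1 x2]; rewrite ler_ln ?posrE; lra.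
Qed.

(** Integrated form of ln y <= y - 1 at y = 2 b (z - x); it bounds the limiting free
    energy below by b times the mean of nu, as Jensen's inequality would. *)
Lemma log_potential_mean z b : Cp <= z -> 0 < b ->
  J z <= 2 * b * (z - \int[nu]_(x in D) x) - 1 - ln (2 * b).
Proof.
move=> zCp b0; have iz := integrable_ln zCp.
have ib := integrable_mull (2 * b) mD (integrable_sub z).
have sub f : nu.-integrable D f -> nu.-integrable D' f by exact: integrableS.
have ic c : nu.-integrable D (EFin \o (fun=> c)).
  exact: finite_measure_integrable_cst.
have ix : nu.-integrable D (EFin \o (fun x : R => x)).
  have := integrable_mull (-1) mD (integrable_sub 0).
  by congr integrable; apply/funext => x /=; rewrite sub0r mulN1r opprK.
have -> : 2 * b * (z - \int[nu]_(x in D) x) - 1 - ln (2 * b) =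
   \int[nu]_(x in D) (2 * b * (z - x) - (1 + ln (2 * b))).
  rewrite RintegralB// RintegralZl//; last exact: integrable_sub.
  rewrite RintegralB// !Rintegral_support_cst//; lra.
have iall : nu.-integrable D
    (EFin \o (fun x => 2 * b * (z - x) - (1 + ln (2 * b)))).
  have := integrableB mD ib (ic (1 + ln (2 * b))).
  by congr integrable; apply/funext => x /=; rewrite EFinB.
rewrite /J /log_potential (Rintegral_halfopen iz) (Rintegral_halfopen iall).
apply: le_Rintegral => //; [exact: sub..|].
move=> x /inD'[x1 x2].
have p : 0 < z - x by lra.
have b2 : 0 < 2 * b by lra.
have := @ln_le_sub1 R (2 * b * (z - x)); rewrite mulr_gt0// => /(_ isT).
rewrite lnM ?posrE//; lra.
Qed.

End edge_limit.

(** * Regularity of the limiting free energy *)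

Section derivative_criteria.
Context {R : realType}.
Implicit Types f g : R -> R.

Lemma is_derive_quadratic f (x M : R) :
  (\forall y \near x, `|f y - f x| <= M * (y - x) ^+ 2) -> is_derive x 1 f 0.
Proof.
move=> H; pose M1 := `|M| + 1.
have M0 : 0 < M1 by rewrite ltr_wpDl.
have lim : h^-1 *: (f (h + x) - f x) @[h --> 0^'] --> (0 : R).
  apply/cvgrPdist_le => e e0.
  have [d /= d0 Hd] := H.
  near=> h.
  have h0 : h != 0 by near: h; exact: nbhs_dnbhs_neq.
  have hd : `|h| < d by near: h; apply: dnbhs0_lt.
  have he : `|h| <= e / M1 by near: h; apply: dnbhs0_le; exact: divr_gt0.
  rewrite sub0r normrN normrM normfV ler_pdivrMl ?normr_gt0//.
  have := Hd (h + x); rewrite /ball_/= opprD addrCA subrr addr0 normrN => /(_ hd).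
  rewrite addrK => /le_trans; apply.
  apply: (@le_trans _ _ (M1 * h ^+ 2)).
    by rewrite ler_wpM2r ?sqr_ge0// (le_trans (ler_norm M))// lerDl.
  rewrite -[h ^+ 2]ger0_norm ?sqr_ge0// normrX expr2 mulrCA ler_wpM2l//.
  by rewrite mulrC -ler_pdivlMr.
apply: DeriveDef.
  by apply/cvg_ex; exists 0; under eq_fun do rewrite scaler1.
by apply/cvg_lim => //; under eq_fun do rewrite scaler1.
Unshelve. all: by end_near. Qed.

(** Envelope principle: the value of an optimisation problem has its increments
    pinched between those of the optimal slopes at the two ends, hence is
    differentiable wherever the optimal slope is continuous. *)
Lemma is_derive_sandwich f g (x : R) : {for x, continuous g} ->
  (\forall y \near x, (y - x) * g y <= f y - f x <= (y - x) * g x) ->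
  is_derive x 1 f (g x).
Proof.
move=> cg H.
have lim : h^-1 *: (f (h + x) - f x) @[h --> 0^'] --> g x.
  apply/cvgrPdist_le => e e0.
  have /cvgrPdist_le/(_ e e0) [d1 /= d10 Hd1] := cg.
  have [d /= d0 Hd] := H.
  near=> h.
  have h0 : h != 0 by near: h; exact: nbhs_dnbhs_neq.
  have hd : `|h| < d by near: h; apply: dnbhs0_lt.
  have hd1 : `|h| < d1 by near: h; apply: dnbhs0_lt.
  have := Hd (h + x); rewrite /ball_/= opprD addrCA subrr addr0 normrN => /(_ hd).
  rewrite addrK => /andP[B1 B2].
  have := Hd1 (h + x); rewrite /ball_/= opprD addrCA subrr addr0 normrN => /(_ hd1) G.
  rewrite -[X in X <= _]ger0_norm//; apply: le_trans G.
  rewrite ger0_norm// /GRing.scale/=.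
  have [hp|hn] := ltP 0 h.
    have q1 : g (h + x) <= h^-1 * (f (h + x) - f x) by rewrite ler_pdivlMl.
    have q2 : h^-1 * (f (h + x) - f x) <= g x by rewrite ler_pdivrMl.
    by rewrite !ger0_norm; lra.
  have {}hn : h < 0 by rewrite lt_neqAle h0.
  have q1 : h^-1 * (f (h + x) - f x) <= g (h + x).
    by rewrite ler_ndivrMl.
  have q2 : g x <= h^-1 * (f (h + x) - f x) by rewrite ler_ndivlMl.
  by rewrite !ler0_norm; lra.
apply: DeriveDef.
  by apply/cvg_ex; exists (g x); under eq_fun do rewrite scaler1.
by apply/cvg_lim => //; under eq_fun do rewrite scaler1.
Unshelve. all: by end_near. Qed.

Lemma is_derive_continuous f (x df : R) : is_derive x 1 f df -> {for x, continuous f}.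
Proof. by move=> [fd _]; exact/differentiable_continuous/derivable1_diffP. Qed.

End derivative_criteria.

Section limiting_free_energy.
Context {R : realType}.
Variables (nu : probability (measurableTypeR R) R) (Cm Cp : R).
Hypothesis CmCp : Cm < Cp.
Local Notation D := (`[Cm, Cp]%classic : set (measurableTypeR R)).
Hypothesis nuD : nu D = 1%E.
Hypothesis nuCp : nu [set Cp] = 0%E.
Local Notation K := (resolvent_moment nu Cm Cp).
Local Notation J := (log_potential nu Cm Cp).
Hypothesis K1_bounded : exists B, forall z, Cp < z -> K 1 z <= B.
Variables (C c r0 : R).
Hypotheses (C0 : 0 < C) (c0 : 0 < c) (r00 : 0 < r0).
Hypothesis K2_le : forall r : R, 0 < r -> r <= r0 -> K 2 (Cp + r ^+ 2) <= C / r.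
Hypothesis K2_ge : forall r : R, 0 < r -> r <= r0 -> c / r <= K 2 (Cp + r ^+ 2).
Hypothesis K3_ge : forall r : R, 0 < r -> r <= r0 -> c / r ^+ 3 <= K 3 (Cp + r ^+ 2).

Local Notation bc := (critical_beta nu Cm Cp).
Local Notation gh := (gamma_hat nu Cm Cp).

Lemma critical_betaE : bc = 2^-1 * K 1 Cp. Proof. by []. Qed.

Lemma critical_beta_gt0 : 0 < bc.
Proof.
rewrite critical_betaE mulr_gt0 ?invr_gt0//.
exact: (resolvent_edge_gt0 CmCp nuD nuCp K1_bounded).
Qed.

Lemma gamma_hatP (b : R) : 0 < b -> b < bc -> Cp < gh b /\ 2^-1 * K 1 (gh b) = b.
Proof.
move=> b0 bbc; rewrite /gamma_hat; set A := (X in xget 0 X).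
suff : exists z, A z by move=> /(xgetPex 0).
have [||z zCp Kz] := @resolvent_moment1_surjective R nu Cm Cp CmCp nuD nuCp K1_bounded (2 * b).
- by rewrite mulr_gt0.
- by move: bbc; rewrite critical_betaE; lra.
exists z; split => //; rewrite -[X in _ * X]/(K 1 z) Kz; lra.
Qed.

Lemma resolvent_moment1_inj z z' : Cp < z -> Cp < z' -> K 1 z = K 1 z' -> z = z'.
Proof.
move=> zCp z'Cp Kzz'; have [zz'|zz'|//] := ltgtP z z'.
  by have := resolvent_moment1_decreasing CmCp nuD zCp zz'; rewrite Kzz' ltxx.
by have := resolvent_moment1_decreasing CmCp nuD z'Cp zz'; rewrite Kzz' ltxx.
Qed.

Lemma half_resolvent_bounds z : Cp < z -> 0 < 2^-1 * K 1 z < bc.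
Proof.
move=> zCp; rewrite critical_betaE mulr_gt0 ?invr_gt0//=; last first.
  exact: (resolvent_moment_gt0 CmCp nuD).
by rewrite ltr_pM2l ?invr_gt0//; exact: (resolvent_edge_gt CmCp nuD nuCp K1_bounded).
Qed.

Lemma gamma_hatK z : Cp < z -> gh (2^-1 * K 1 z) = z.
Proof.
move=> zCp; have /andP[b0 bbc] := half_resolvent_bounds zCp.
have [ghCp Kgh] := gamma_hatP b0 bbc.
by apply: resolvent_moment1_inj => //; move: Kgh; lra.
Qed.

(** The minimiser over z >= Cp of b z - (J z + 1 + ln (2 b)) / 2: the critical point
    if there is one, the edge otherwise. *)
Definition saddle (b : R) : R := if b < bc then gh b else Cp.

Lemma saddle_ge (b : R) : 0 < b -> Cp <= saddle b.
Proof.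
rewrite /saddle => b0; case: ifPn => // bbc.
by apply/ltW; have [] := gamma_hatP b0 bbc.
Qed.

(** Above the critical point the slope K_1 of J at the edge is at most 2 b, so
    the tangent at the edge still gives the inequality to the right of it. *)
Lemma saddle_tangent (b z : R) : 0 < b -> Cp <= z ->
  J z <= J (saddle b) + (z - saddle b) * (2 * b).
Proof.
move=> b0 zCp.
apply: (le_trans (log_potential_tangent CmCp nuCp K1_bounded (saddle_ge b0) zCp)).
rewrite lerD2l /saddle; case: ifPn => bbc.
  have [_ Kgh] := gamma_hatP b0 bbc.
  by have -> : K 1 (gh b) = 2 * b by move: Kgh; lra.
rewrite ler_wpM2l ?subr_ge0//; move: bbc; rewrite -leNgt critical_betaE; lra.
Qed.

Definition saddle_slope (b : R) : R := if b < bc then - 2 / K 2 (gh b) else 0.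

Lemma is_derive_gamma_hat (b : R) : 0 < b -> b < bc ->
  is_derive b 1 gh (- 2 / K 2 (gh b)).
Proof.
move=> b0 bbc; have [ghCp Kgh] := gamma_hatP b0 bbc.
have K20 := resolvent_moment_gt0 CmCp nuD 2 ghCp.
have dK : is_derive (gh b) 1 (fun z => 2^-1 * K 1 z) (- (2^-1 * K 2 (gh b))).
  have := is_derive_mull 2^-1 (is_derive_resolvent_moment nu CmCp 1 ghCp).
  by congr is_derive; rewrite mulN1r mulrN.
have -> : - 2 / K 2 (gh b) = (- (2^-1 * K 2 (gh b)))^-1.
  by field; rewrite gt_eqF.
rewrite -{1}Kgh; apply: (@is_derive_inverse R (fun z => 2^-1 * K 1 z)).
- near=> z; apply: gamma_hatK; near: z; exact: lt_nbhsr.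
- near=> z; have zCp : Cp < z by near: z; exact: lt_nbhsr.
  apply: is_derive_continuous.
  exact: is_derive_mull (is_derive_resolvent_moment nu CmCp 1 zCp).
- by rewrite oppr_eq0 mulf_neq0// gt_eqF.
Unshelve. all: by end_near. Qed.

(** From (gamma_hat - Cp) K_2 <= K_1(Cp) - K_1(gamma_hat) = 2 (bc - b) and
    K_2 >= c / r at gamma_hat = Cp + r^2: the saddle point leaves the edge
    quadratically. *)
Lemma gamma_hat_near_critical : exists M b0 : R, [/\ 0 < M, 0 < b0, b0 < bc &
  forall b : R, b0 <= b -> b < bc -> exists r : R, [/\ 0 < r, r <= r0,
    gh b = Cp + r ^+ 2 & r <= M * (bc - b)]].
Proof.
have z0Cp : Cp < Cp + r0 ^+ 2 by rewrite ltrDl exprn_gt0.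
have /andP[b00 b0bc] := half_resolvent_bounds z0Cp.
exists (2 / c), (2^-1 * K 1 (Cp + r0 ^+ 2)); split => //; first exact: divr_gt0.
move=> b b0b bbc; have bp : 0 < b by exact: lt_le_trans b0b.
have [ghCp Kgh] := gamma_hatP bp bbc.
have gh_le : gh b <= Cp + r0 ^+ 2.
  rewrite leNgt; apply/negP => /(resolvent_moment1_decreasing CmCp nuD z0Cp).
  by move: Kgh b0b; lra.
exists (Num.sqrt (gh b - Cp)).
have r2 : Num.sqrt (gh b - Cp) ^+ 2 = gh b - Cp by rewrite sqr_sqrtr// subr_ge0 ltW.
have rp : 0 < Num.sqrt (gh b - Cp) by rewrite sqrtr_gt0 subr_gt0.
have rr0 : Num.sqrt (gh b - Cp) <= r0.
  rewrite -(ger0_norm (ltW r00)) -sqrtr_sqr ler_wsqrtr//; lra.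
have ghE : gh b = Cp + Num.sqrt (gh b - Cp) ^+ 2 by rewrite r2 addrC subrK.
split => //.
have := resolvent_edge_diff_ge CmCp nuCp K1_bounded ghCp.
have K2 := K2_ge rp rr0; rewrite -ghE in K2.
rewrite -{1}r2; move: (Num.sqrt _) rp K2 => r rp K2 H.
have cr : c * r <= r ^+ 2 * K 2 (gh b).
  have -> : c * r = r ^+ 2 * (c / r) by field; rewrite gt_eqF.
  by rewrite ler_wpM2l// exprn_ge0// ltW.
rewrite mulrAC ler_pdivlMr// mulrC.
by move: Kgh; rewrite critical_betaE; lra.
Qed.

(** At the critical point both one-sided derivatives vanish, the left one because
    the saddle point leaves the edge quadratically. *)
Lemma is_derive_saddle (b : R) : 0 < b -> is_derive b 1 saddle (saddle_slope b).
Proof.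
move=> b0; rewrite /saddle_slope; have [bbc|bbc|->] := ltgtP b bc.
- apply: near_eq_is_derive (is_derive_gamma_hat b0 bbc).
  near=> y; rewrite /saddle ifT//; near: y; exact: lt_nbhsl.
- apply: near_eq_is_derive (is_derive_cst1 Cp b).
  near=> y; rewrite /saddle ifF//; apply/negbTE; rewrite -leNgt ltW//.
  near: y; exact: lt_nbhsr.
- have [M [b1 [M0 b10 b1bc H]]] := gamma_hat_near_critical.
  apply: (@is_derive_quadratic _ _ _ (M ^+ 2)).
  near=> y; rewrite {2}/saddle ltxx /saddle; case: ifPn => ybc; last first.
    by rewrite subrr normr0 mulr_ge0 ?sqr_ge0.
  have b1y : b1 <= y by apply/ltW; near: y; exact: lt_nbhsr.
  have [r [rp rr0 -> rM]] := H _ b1y ybc.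
  rewrite [Cp + _]addrC addrK ger0_norm ?sqr_ge0// -exprMn.
  rewrite -[(M * (y - bc)) ^+ 2]sqrrN -mulrN opprB.
  by rewrite ler_sqr ?nnegrE ?(ltW rp)// (le_trans (ltW rp)).
Unshelve. all: by end_near. Qed.

Definition limiting_free_energy (b : R) : R :=
  b * saddle b - 2^-1 * (J (saddle b) + 1 + ln (2 * b)).
Local Notation F := limiting_free_energy.

Lemma limiting_free_energy_le (b z : R) : 0 < b -> Cp <= z ->
  F b <= b * z - 2^-1 * (J z + 1 + ln (2 * b)).
Proof. by move=> b0 zCp; have := saddle_tangent b0 zCp; rewrite /F; lra. Qed.

(** The infimum is approached from inside the open half-line beyond the edge, where
    the logarithm is a bounded test function on a neighbourhood of the support. *)
Lemma limiting_free_energy_approx (b e : R) : 0 < b -> 0 < e ->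
  exists2 z, Cp < z & b * z - 2^-1 * (J z + 1 + ln (2 * b)) <= F b + e.
Proof.
move=> b0 e0; rewrite /F /saddle; case: ifPn => bbc.
  by exists (gh b); [have [] := gamma_hatP b0 bbc|rewrite lerDl ltW].
have zCp : Cp < Cp + e / b by rewrite ltrDl divr_gt0.
exists (Cp + e / b) => //.
have := log_potential_le CmCp nuCp K1_bounded (lexx Cp) (ltW zCp).
have -> : b * (Cp + e / b) = b * Cp + e by field; rewrite gt_eqF.
lra.
Qed.

Lemma limiting_free_energy_mean (b : R) : 0 < b ->
  b * \int[nu]_(x in D) x <= F b.
Proof.
move=> b0; have := log_potential_mean CmCp nuD nuCp K1_bounded (saddle_ge b0) b0.
by rewrite /F; lra.
Qed.

(** Up to the explicit term ln(2b)/2 the free energy is an infimum of functions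
    affine in b with slopes z: the envelope principle applies with slope [saddle]. *)
Lemma is_derive_limiting_free_energy (b : R) : 0 < b ->
  is_derive b 1 F (saddle b - (2 * b)^-1).
Proof.
move=> b0.
pose E y := y * saddle y - 2^-1 * J (saddle y).
have dE : is_derive b 1 E (saddle b).
  apply: is_derive_sandwich; first exact: is_derive_continuous (is_derive_saddle b0).
  near=> y; have y0 : 0 < y by near: y; exact: lt_nbhsr.
  have := saddle_tangent b0 (saddle_ge y0); have := saddle_tangent y0 (saddle_ge b0).
  by rewrite /E => ? ?; apply/andP; split; lra.
have b20 : 0 < 2 * b by rewrite mulr_gt0.
have dln : is_derive b 1 (fun y => ln (2 * y)) ((2 * b)^-1 * 2).
  have := is_derive_comp1 (g := fun y => 2 * y) (is_derive1_ln b20)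
    (is_derive_mull 2 (is_derive_id1 b)).
  by rewrite mulr1.
have := is_derive_add dE (is_derive_opp (is_derive_mull 2^-1
  (is_derive_add (is_derive_cst1 1 b) dln))).
have -> : (fun y => E y + - (2^-1 * (1 + ln (2 * y)))) = F.
  by apply/funext => y; rewrite /E /F; lra.
by congr is_derive; field; rewrite gt_eqF.
Unshelve. all: by end_near. Qed.

Lemma derive1_limiting_free_energy (b : R) : 0 < b ->
  F^`() b = saddle b - (2 * b)^-1.
Proof. by move=> b0; rewrite derive1E; have [_ ->] := is_derive_limiting_free_energy b0. Qed.

Lemma is_derive_inv_linear (b : R) : 0 < b ->
  is_derive b 1 (fun y : R => (2 * y)^-1) (- (2 * b ^+ 2)^-1).
Proof.
move=> b0; have b2 : 2 * b != 0 by rewrite mulf_neq0// gt_eqF.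
have := is_derive_inv (f := fun y => 2 * y) b2 (is_derive_mull 2 (is_derive_id1 b)).
by congr is_derive; field; rewrite gt_eqF.
Qed.

Lemma is_derive_derive1_limiting_free_energy (b : R) : 0 < b ->
  is_derive b 1 (F^`()) (saddle_slope b + (2 * b ^+ 2)^-1).
Proof.
move=> b0.
have := is_derive_add (is_derive_saddle b0) (is_derive_opp (is_derive_inv_linear b0)).
rewrite opprK; apply: near_eq_is_derive.
near=> y; rewrite derive1_limiting_free_energy//; near: y; exact: lt_nbhsr.
Unshelve. all: by end_near. Qed.

Lemma derive2_limiting_free_energy (b : R) : 0 < b ->
  F^`(2) b = saddle_slope b + (2 * b ^+ 2)^-1.
Proof.
move=> b0; rewrite derive1nS derive1E.
by have [_ ->] := is_derive_derive1_limiting_free_energy b0.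
Qed.

Lemma is_derive_saddle_slope_lt (b : R) : 0 < b -> b < bc ->
  is_derive b 1 saddle_slope (8 * K 3 (gh b) / K 2 (gh b) ^+ 3).
Proof.
move=> b0 bbc; have [ghCp Kgh] := gamma_hatP b0 bbc.
have K20 := resolvent_moment_gt0 CmCp nuD 2 ghCp.
have K2n0 : K 2 (gh b) != 0 by rewrite gt_eqF.
have d1 := is_derive_comp1 (is_derive_resolvent_moment nu CmCp 2 ghCp)
  (is_derive_gamma_hat b0 bbc).
have d2 := is_derive_mull (- 2) (is_derive_inv (f := fun y => K 2 (gh y)) K2n0 d1).
apply: near_eq_is_derive.
  near=> y; rewrite /saddle_slope ifT//; near: y; exact: lt_nbhsl.
by move: d2; congr is_derive; field.
Unshelve. all: by end_near. Qed.

Lemma is_derive_saddle_slope_gt (b : R) : bc < b -> is_derive b 1 saddle_slope 0.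
Proof.
move=> bcb; apply: near_eq_is_derive (is_derive_cst1 0 b).
near=> y; rewrite /saddle_slope ifF//; apply/negbTE; rewrite -leNgt ltW//.
near: y; exact: lt_nbhsr.
Unshelve. all: by end_near. Qed.

(** Continuity at the critical point: K_2 tends to infinity at the edge. *)
Lemma continuous_saddle_slope (b : R) : 0 < b -> {for b, continuous saddle_slope}.
Proof.
move=> b0; have [bbc|bcb|bE] := ltgtP b bc.
- exact: is_derive_continuous (is_derive_saddle_slope_lt b0 bbc).
- exact: is_derive_continuous (is_derive_saddle_slope_gt bcb).
have [M [b1 [M0 b10 b1bc H]]] := gamma_hat_near_critical.
have slope0 : saddle_slope b = 0 by rewrite /saddle_slope bE ltxx.
rewrite /prop_for /continuous_at slope0.
apply/cvgrPdist_le => e e0; near=> y.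
rewrite sub0r normrN /saddle_slope; case: ifPn => ybc; last by rewrite normr0 ltW.
have b1y : b1 <= y by apply/ltW; near: y; apply: lt_nbhsr; rewrite bE.
have [r [rp rr0 -> rM]] := H _ b1y ybc.
have K2 := K2_ge rp rr0.
have cr : 0 < c / r by exact: divr_gt0.
rewrite mulNr normrN ger0_norm; last by rewrite divr_ge0// (le_trans (ltW cr)).
apply: (@le_trans _ _ (2 * (c / r)^-1)).
  by rewrite ler_wpM2l// lef_pV2 ?posrE// (lt_le_trans cr).
rewrite invf_div mulrA ler_pdivrMr//.
have yb : bc - y <= e * c / (2 * M).
  rewrite lerBlDl -lerBlDr; apply/ltW; near: y; apply: lt_nbhsr.
  by rewrite bE ltrBlDr ltrDl !(mulr_gt0, divr_gt0, invr_gt0).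
have : r <= M * (e * c / (2 * M)).
  by rewrite (le_trans rM)// ler_wpM2l// ltW.
have -> : M * (e * c / (2 * M)) = e * c / 2 by field; rewrite gt_eqF.
lra.
Unshelve. all: by end_near. Qed.

Lemma limiting_free_energy_C2 (b : R) : 0 < b ->
  [/\ derivable F b 1, derivable F^`() b 1 & {for b, continuous F^`(2)}].
Proof.
move=> b0; split.
- by have [] := is_derive_limiting_free_energy b0.
- by have [] := is_derive_derive1_limiting_free_energy b0.
have cont : {for b, continuous (fun y => saddle_slope y + (2 * y ^+ 2)^-1)}.
  apply: cvgD; first exact: continuous_saddle_slope.
  apply: cvgV; first by rewrite mulf_neq0// gt_eqF// exprn_gt0.
  by apply: cvgMr; exact: exprn_continuous.
rewrite /prop_for /continuous_at derive2_limiting_free_energy//.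
apply: cvg_trans cont; apply: near_eq_cvg.
near=> y; rewrite derive2_limiting_free_energy//; near: y; exact: lt_nbhsr.
Unshelve. all: by end_near. Qed.

Lemma is_derive_inv_square (b : R) : 0 < b ->
  is_derive b 1 (fun y : R => (2 * y ^+ 2)^-1) (- (b ^+ 3)^-1).
Proof.
move=> b0; have b2 : 2 * b ^+ 2 != 0 by rewrite mulf_neq0// expf_neq0// gt_eqF.
have := is_derive_inv (f := fun y => 2 * y ^+ 2) b2
  (is_derive_mull 2 (is_derive_exp 2 (is_derive_id1 b))).
by congr is_derive; field; rewrite gt_eqF.
Qed.

Lemma is_derive_derive2 (b dg : R) : 0 < b -> is_derive b 1 saddle_slope dg ->
  is_derive b 1 (F^`(2)) (dg - (b ^+ 3)^-1).
Proof.
move=> b0 dgb; have := is_derive_add dgb (is_derive_inv_square b0).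
apply: near_eq_is_derive.
near=> y; rewrite derive2_limiting_free_energy//; near: y; exact: lt_nbhsr.
Unshelve. all: by end_near. Qed.

Lemma derivable_derive2 (b : R) : 0 < b -> b != bc -> derivable F^`(2) b 1.
Proof.
move=> b0; have [bbc _|bcb _|//] := ltgtP b bc.
- by have [] := is_derive_derive2 b0 (is_derive_saddle_slope_lt b0 bbc).
- by have [] := is_derive_derive2 b0 (is_derive_saddle_slope_gt bcb).
Qed.

Lemma derive3_lt (b : R) : 0 < b -> b < bc ->
  F^`(3) b = 8 * K 3 (gh b) / K 2 (gh b) ^+ 3 - (b ^+ 3)^-1.
Proof.
move=> b0 bbc; rewrite derive1nS derive1E.
by have [_ ->] := is_derive_derive2 b0 (is_derive_saddle_slope_lt b0 bbc).
Qed.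

Lemma derive3_gt (b : R) : bc < b -> F^`(3) b = - (b ^+ 3)^-1.
Proof.
move=> bcb; have b0 := lt_trans critical_beta_gt0 bcb.
rewrite derive1nS derive1E.
by have [_ ->] := is_derive_derive2 b0 (is_derive_saddle_slope_gt bcb); rewrite sub0r.
Qed.

Let jump_contradiction (k x y z l X : R) : 0 < k -> k <= X ->
  `|x - y| < k / 8 -> `|x - z| < k / 8 ->
  `|l - - y| < k / 8 -> `|l - (X - z)| < k / 8 -> False.
Proof.
move=> k0 kX; rewrite !ltr_norml => /andP[? ?] /andP[? ?] /andP[? ?] /andP[? ?].
lra.
Qed.

(** On the left of the critical point the third derivative exceeds its regular
    part by 8 K_3 / K_2^3 >= 8 c / C^3, on the right by nothing. *)
Lemma no_limit_derive3 : ~ (exists l : R, F^`(3) b @[b --> bc^'] --> l).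
Proof.
move=> [l Fl]; have bc0 := critical_beta_gt0.
pose k := 8 * c / C ^+ 3.
have k0 : 0 < k by rewrite divr_gt0 ?mulr_gt0 ?exprn_gt0.
have k8 : 0 < k / 8 by rewrite divr_gt0.
have [M [b1 [M0 b10 b1bc H]]] := gamma_hat_near_critical.
have jump b : b1 <= b -> b < bc -> k <= 8 * K 3 (gh b) / K 2 (gh b) ^+ 3.
  move=> b1b bbc; have [r [rp rr0 -> _]] := H _ b1b bbc.
  have K3 := K3_ge rp rr0; have K2 := K2_le rp rr0.
  have K20 : 0 < K 2 (Cp + r ^+ 2).
    by apply: (lt_le_trans _ (K2_ge rp rr0)); exact: divr_gt0.
  have -> : k = 8 * (c / r ^+ 3) / (C / r) ^+ 3.
    by rewrite /k; field; rewrite !gt_eqF.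
  have Cr0 : 0 < C / r by exact: divr_gt0.
  apply: ler_pM.
  - by rewrite mulr_ge0// divr_ge0 ?exprn_ge0// ltW.
  - by rewrite invr_ge0 exprn_ge0// ltW.
  - by rewrite ler_wpM2l.
  - by rewrite lef_pV2 ?posrE ?exprn_gt0// lerXn2r ?nnegrE// ltW.
have cinv : (fun b : R => (b ^+ 3)^-1) @ bc --> (bc ^+ 3)^-1.
  apply: cvgV; first by rewrite gt_eqF// exprn_gt0.
  by exact: exprn_continuous.
have /cvgrPdist_lt/(_ _ k8) [d1 /= d10 Hd1] := cinv.
have /cvgrPdist_lt/(_ _ k8) [d2 /= d20 Hd2] := Fl.
pose d := Num.min (Num.min d1 d2) (bc - b1).
have d0 : 0 < d by rewrite !lt_min d10 d20 subr_gt0.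
have dd1 : d <= d1 by rewrite !ge_min lexx.
have dd2 : d <= d2 by rewrite !ge_min lexx !orbT.
have dbc : d <= bc - b1 by rewrite !ge_min lexx !orbT.
(* Two test points close enough to the critical point for all four errors to be
   below an eighth of the jump. *)
pose bl := bc - d / 2; pose br := bc + d / 2.
have nl : `|bc - bl| < d by rewrite /bl opprB addrC subrK gtr0_norm; lra.
have nr : `|bc - br| < d by rewrite /br opprD addrA subrr sub0r normrN gtr0_norm; lra.
have blbc : bl < bc by rewrite /bl; lra.
have brbc : bc < br by rewrite /br; lra.
have b1bl : b1 <= bl by rewrite /bl; lra.
have bl0 : 0 < bl by exact: lt_le_trans b1bl.
have := Hd2 bl (lt_le_trans nl dd2); rewrite lt_eqF// => /(_ isT).
have := Hd2 br (lt_le_trans nr dd2); rewrite gt_eqF// => /(_ isT).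
have := Hd1 bl (lt_le_trans nl dd1); have := Hd1 br (lt_le_trans nr dd1).
have El := derive3_lt bl0 blbc; have Er := derive3_gt brbc.
rewrite /= in El Er; rewrite El Er; have := jump _ b1bl blbc.
exact: (jump_contradiction k0).
Qed.

End limiting_free_energy.

(** * Free energy of a deterministic spectrum *)

Section diagonal_free_energy.
Context {R : realType} {N : nat}.
Local Notation TN := (N.-tuple (measurableTypeR R)).
Variable w : probability TN R.
Hypothesis uw : uniform_on_sphere w.
Hypothesis N0 : (0 < N)%N.
Local Notation log_mean l z := (N%:R^-1 * \sum_(i < N) ln (z - l i)).
Local Notation Z l b := (\int[w]_(x in sphere) expR (b * diag_form l x)).

(** As |x|^2 = N on the sphere, a shift of the spectrum is a scalar factor; a shift
    beyond the largest eigenvalue makes the exponent negative definite. *)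
Lemma partition_shift (l : 'I_N -> R) (b z : R) :
  Z l b = expR (b * z * N%:R) *
    \int[w]_(x in sphere) expR (- 2^-1 * diag_form (fun i => 2 * b * (z - l i)) x).
Proof.
rewrite -RintegralZl//; last 2 first.
- exact: measurable_sphere.
- exact: integrable_sphere_expR.
apply: eq_Rintegral => x; rewrite inE => Sx; rewrite -expRD; congr expR.
rewrite -[in RHS]Sx /diag_form !mulr_sumr -big_split /=; apply: eq_bigr => i _.
by field.
Qed.

Lemma partition_gt0 (l : 'I_N -> R) (b : R) : 0 < Z l b.
Proof.
pose C : R := \sum_i `|l i| * N%:R.
have mS := @measurable_sphere R N.
apply: (@lt_le_trans _ _ (\int[w]_(x in sphere) expR (- (`|b| * C)))).
  rewrite Rintegral_cst// (_ : fine _ = 1) ?mulr1 ?expR_gt0//.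
  exact: (congr1 fine uw.1).
apply: le_Rintegral => //.
- apply: (bounded_integrable (C := expR (- (`|b| * C)))) => //.
  + by rewrite (le_lt_trans (probability_le1 _ mS)) ?ltry.
  + by move=> x _; rewrite ger0_norm ?expR_ge0.
- exact: integrable_sphere_expR.
move=> x Sx; rewrite ler_expR.
have : `|b * diag_form l x| <= `|b| * C.
  rewrite normrM ler_wpM2l// (le_trans (ler_norm_sum _ _ _))// ler_sum// => i _.
  rewrite normrM ler_wpM2l// ger0_norm ?sqr_ge0//; exact: sphere_le.
by rewrite ler_norml => /andP[].
Qed.

Let N0' : 0 < N%:R :> R. Proof. by rewrite ltr0n. Qed.
Let Nn0 : N%:R != 0 :> R. Proof. by rewrite gt_eqF. Qed.

Let expR_le_ln (x y : R) : expR x <= y -> x <= ln y.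
Proof.
move=> xy; rewrite -[leLHS]expRK ler_ln// posrE ?expR_gt0//.
exact: lt_le_trans (expR_gt0 x) xy.
Qed.

Let sum_ln_scale (l : 'I_N -> R) (b z : R) : 0 < b -> (forall i, l i < z) ->
  \sum_i ln (2 * b * (z - l i)) = N%:R * (log_mean l z + ln (2 * b)).
Proof.
move=> b0 lz; rewrite mulrDr mulrA divff// mul1r addrC.
transitivity (\sum_(i < N) (ln (2 * b) + ln (z - l i))).
  apply: eq_bigr => i _; rewrite lnM ?posrE ?subr_gt0//; exact: mulr_gt0.
by rewrite big_split /= sumr_const card_ord -[_ *+ N]mulr_natl.
Qed.

Lemma log_partition_le (l : 'I_N -> R) (b z : R) : 0 < b -> (forall i, l i < z) ->
  N%:R^-1 * ln (Z l b) <= b * z - 2^-1 * (log_mean l z + 1 + ln (2 * b)).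
Proof.
move=> b0 lz; rewrite ler_pdivrMl//.
have a0 i : 0 < 2 * b * (z - l i) by rewrite !mulr_gt0// subr_gt0.
have Z0 := partition_gt0 l b.
rewrite -[leRHS]expRK ler_ln ?posrE ?expR_gt0//.
rewrite (partition_shift l b z).
apply: le_trans (ler_wpM2l (expR_ge0 _) (sphere_laplace_le uw N0 a0)) _.
rewrite -expRD ler_expR sum_ln_scale//.
by set L := N%:R^-1 * _; lra.
Qed.

(** The saddle point equation [sum 1/(z - l_i) = 2 b N] has its solution at
    distance at least [p/2b] from the top atom [c] of mass [p], which keeps the
    quadratic form uniformly nondegenerate. *)
Lemma saddle_equation (l : 'I_N -> R) (b c p : R) : 0 < b -> 0 < p -> p <= 1 ->
  (forall i, l i <= c) -> p * N%:R <= \sum_(i < N) (l i == c)%:R ->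
  exists z : R, [/\ c + p / (2 * b) <= z, z <= c + (2 * b)^-1 &
    \sum_i (2 * b * (z - l i))^-1 = N%:R].
Proof.
move=> b0 p0 p1 lc pN.
have b2 : 0 < 2 * b by exact: mulr_gt0.
pose g (z : R) : R := \sum_i (2 * b * (z - l i))^-1.
have pb : 0 < p / (2 * b) by exact: divr_gt0.
have bi : 0 < (2 * b)^-1 by rewrite invr_gt0.
have ab : c + p / (2 * b) <= c + (2 * b)^-1.
  by rewrite lerD2l -[leRHS]mul1r ler_wpM2r// invr_ge0 ltW.
have cg : {within `[c + p / (2 * b), c + (2 * b)^-1], continuous g}.
  apply: continuous_in_subspaceT => z; rewrite inE/= in_itv/= => /andP[z1 _].
  apply: cvg_big => [|i _]; first exact: add_continuous.
  apply: cvgV.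
    by rewrite gt_eqF// mulr_gt0//; have := lc i; lra.
  by apply: cvgMr; apply: cvgB; [exact: cvg_id|exact: cvg_cst].
have ga : N%:R <= g (c + p / (2 * b)).
  apply: (@le_trans _ _ (\sum_(i < N) (p^-1 * (l i == c)%:R))).
    by rewrite -mulr_sumr ler_pdivlMl.
  rewrite ler_sum// => i _; case: eqP => [->|_].
    rewrite mulr1 addrAC subrr add0r (_ : 2 * b * (p / (2 * b)) = p)//.
    by field; rewrite gt_eqF.
  by rewrite mulr0 invr_ge0 mulr_ge0 ?(ltW b2)//; have := lc i; lra.
have gb : g (c + (2 * b)^-1) <= N%:R.
  apply: (@le_trans _ _ (\sum_(i < N) 1)); last by rewrite sumr_const card_ord.
  rewrite ler_sum// => i _; rewrite invf_le1; last first.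
    by rewrite mulr_gt0//; have := lc i; lra.
  apply: (@le_trans _ _ (2 * b * (2 * b)^-1)); first by rewrite divff ?gt_eqF.
  by rewrite ler_wpM2l ?(ltW b2)//; have := lc i; lra.
have [|z zin gz] := IVT ab cg (v := N%:R).
  by rewrite ge_min le_max ga gb !orbT.
by exists z; move: zin; rewrite in_itv/= => /andP[].
Qed.

(** Gathering the eigenvalues above [c - 2 e] at [c] costs at most [2 b e] and
    creates the atom required by [saddle_equation]. *)
Lemma log_partition_ge (l : 'I_N -> R) (b c e p k : R) :
  0 < b -> 0 < e -> 0 < p -> p <= 1 -> 0 < k -> k <= 2^-1 ->
  (forall i, l i <= c) ->
  p * N%:R <= \sum_(i < N) (c - 2 * e <= l i)%R%:R ->
  3 <= N%:R * (p * k ^+ 2 / 64) ->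
  exists z : R, [/\ c < z, z <= c + (2 * b)^-1 &
    b * z - 2^-1 * (log_mean l z + 1 + ln (2 * b)) - k - 2 * b * e <=
    N%:R^-1 * ln (Z l b)].
Proof.
move=> b0 e0 p0 p1 k0 k2 lc pN N3.
pose l' i := if c - 2 * e <= l i then c else l i.
have l'c i : l' i <= c by rewrite /l'; case: ifP.
have ll' i : l i <= l' i by rewrite /l'; case: ifP.
have l'l i : l' i <= l i + 2 * e by rewrite /l'; case: ifP => ?; lra.
have b2 : 0 < 2 * b by exact: mulr_gt0.
have pN' : p * N%:R <= \sum_(i < N) (l' i == c)%:R.
  apply: le_trans pN _; rewrite ler_sum// => i _; rewrite ler_nat /l'.
  by case: ifP => //; rewrite eqxx.
have [z [z1 z2 sz]] := saddle_equation b0 p0 p1 l'c pN'.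
have pb : 0 < p / (2 * b) by exact: divr_gt0.
have cz : c < z by lra.
exists z; split => //.
have pa i : p <= 2 * b * (z - l' i).
  rewrite mulrC -ler_pdivrMr//; have := l'c i; lra.
have lz i : l i < z by exact: le_lt_trans (lc i) cz.
have l'z i : l' i < z by exact: le_lt_trans (l'c i) cz.
have Llog : log_mean l' z <= log_mean l z.
  rewrite ler_wpM2l ?invr_ge0// ler_sum// => i _.
  by rewrite ler_ln ?posrE ?subr_gt0// lerD2l lerN2.
have Z0 := partition_gt0 l b.
have ZZ : Z l' b * expR (- (2 * b * e * N%:R)) <= Z l b.
  rewrite -RintegralZr//; last 2 first.
  - exact: measurable_sphere.
  - exact: integrable_sphere_expR.
  apply: le_Rintegral => //.
  - exact: measurable_sphere.
  - have := integrable_mull (expR (- (2 * b * e * N%:R))) measurable_sphere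
      (integrable_sphere_expR w b l').
    by congr integrable; apply/funext => x /=; rewrite mulrC.
  - exact: integrable_sphere_expR.
  move=> x Sx; rewrite -expRD ler_expR.
  have : diag_form l' x <= diag_form l x + 2 * e * N%:R.
    rewrite -Sx mulr_sumr /diag_form -big_split /=; apply: ler_sum => i _.
    by rewrite -mulrDl ler_wpM2r ?sqr_ge0.
  move=> /(ler_wpM2l (ltW b0)); lra.
have {sz N3} ZL := sphere_laplace_ge uw N0 p0 p1 k0 k2 pa sz N3.
have Zl' : expR (b * z * N%:R - (N%:R * (2^-1 + k)) -
    2^-1 * (N%:R * (log_mean l' z + ln (2 * b)))) <= Z l' b.
  rewrite (partition_shift l' b z) -sum_ln_scale//.
  by rewrite -addrA expRD ler_wpM2l ?expR_ge0.
have := le_trans (ler_wpM2r (expR_ge0 _) Zl') ZZ.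
rewrite -expRD => /expR_le_ln H; rewrite ler_pdivlMl//; apply: le_trans H.
move: Llog; set L' := N%:R^-1 * _; set L := N%:R^-1 * _ => Llog.
have {Llog} : N%:R * L' <= N%:R * L by rewrite ler_wpM2l.
clear; lra.
Qed.

End diagonal_free_energy.

(** * Asymptotically almost sure events *)

Section aas.
Context {R : realType} (d : nat -> measure_display)
  (T : forall N, measurableType (d N)) (P : forall N, probability (T N) R).

(** Asymptotically almost surely; the exceptional events are only asked to be
    covered by measurable ones, so that stability under implication is free. *)
Definition aas (G : forall N, T N -> Prop) : Prop :=
  exists B : forall N, set (T N), [/\ forall N, measurable (B N),
    forall N t, ~ B N t -> G N t & P N (B N) @[N --> \oo] --> 0%E].

Lemma aas_mono (G H : forall N, T N -> Prop) :
  (forall N t, G N t -> H N t) -> aas G -> aas H.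
Proof. by move=> GH [B [mB BG BP]]; exists B; split => // N t /BG /GH. Qed.

Lemma aas_and (G H : forall N, T N -> Prop) :
  aas G -> aas H -> aas (fun N t => G N t /\ H N t).
Proof.
move=> [B [mB BG BP]] [C [mC CH CP]]; exists (fun N => B N `|` C N); split.
- by move=> N; exact: measurableU.
- by move=> N t; rewrite /= => /not_orP[/BG ? /CH ?].
apply: (@squeeze_cvge _ _ _ _ (cst 0%E) _ (fun N => P N (B N) + P N (C N))%E).
- apply: nearW => N; rewrite measure_ge0/=.
  exact: measureU2.
- exact: cvg_cst.
- by rewrite -[X in _ --> X]adde0; apply: cvgeD.
Qed.

(** The finite union bound needed to control a grid of test functions. *)
Lemma aas_forall_lt (m : nat) (G : nat -> forall N, T N -> Prop) :
  (forall i, aas (G i)) -> aas (fun N t => forall i, (i < m)%N -> G i N t).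
Proof.
move=> HG; elim: m => [|m IHm].
  exists (fun=> set0); split => //; under eq_fun do rewrite measure0.
  exact: cvg_cst.
apply: aas_mono (aas_and (HG m) IHm) => N t [Gm Gs] i.
by rewrite ltnS leq_eqVlt => /predU1P[->//|]; exact: Gs.
Qed.

Lemma aas_eventually (A : nat -> Prop) : (\forall N \near \oo, A N) ->
  aas (fun N _ => A N).
Proof.
move=> [N0 _ HA]; exists (fun N => if (N0 <= N)%N then set0 else setT); split.
- by move=> N; case: ifP.
- by move=> N t; case: ifP => [? _|_ /=]; [exact: HA|case].
- apply: cvg_near_cst; exists N0 => // N /= ->; exact: measure0.
Qed.

Lemma measurable_deviation (N : nat) (f : T N -> R) (c e : R) :
  measurable_fun [set: T N] f -> measurable [set t | e <= `|f t - c|].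
Proof.
move=> mf; rewrite -[X in measurable X]setTI.
apply: (measurable_fun_le (f := cst e) (g := fun t => `|f t - c|)) => //.
by apply: measurableT_comp => //; exact: measurable_funB.
Qed.

Lemma cvg_in_probability_aas (X : forall N, T N -> R) (c e : R) :
  (forall N, measurable_fun [set: T N] (X N)) -> 0 < e ->
  cvg_in_probability P X c -> aas (fun N t => `|X N t - c| < e).
Proof.
move=> mX e0 HX; exists (fun N => [set t | e <= `|X N t - c|]); split; last exact: HX.
- by move=> N; exact: measurable_deviation.
- by move=> N t /= /negP; rewrite -ltNge.
Qed.

Lemma aas_cvg_in_probability (X : forall N, T N -> R) (c : R) :
  (forall N, measurable_fun [set: T N] (X N)) ->
  (forall e, 0 < e -> aas (fun N t => `|X N t - c| < e)) ->
  cvg_in_probability P X c.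
Proof.
move=> mX HX e e0; have [B [mB BX BP]] := HX _ e0.
have mE N : measurable [set t | e <= `|X N t - c|].
  exact: measurable_deviation.
apply: (@squeeze_cvge _ _ _ _ (cst 0%E) _ (fun N => P N (B N))) => //.
- apply: nearW => N; rewrite measure_ge0/=; apply: le_measure; rewrite ?inE//.
  move=> t /= et; apply: contrapT => /BX; rewrite ltNge et//.
- exact: cvg_cst.
Qed.

End aas.

Section probability_limits.
Context {R : realType} (d : nat -> measure_display)
  (T : forall N, measurableType (d N)) (P : forall N, probability (T N) R).

Lemma cvg_in_distribution_dirac (X : forall N, T N -> R) (c : R) :
  (forall N, measurable_fun [set: T N] (X N)) ->
  cvg_in_probability P X c ->
  cvg_in_distribution P X (\d_(c : measurableTypeR R)).
Proof.
move=> mX XP; split => // f [cf [K fK]].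
have mf : measurable_fun [set: R] f by exact: continuous_measurable_fun.
have -> : \int[\d_(c : measurableTypeR R)]_x f x = f c.
  rewrite /Rintegral integral_dirac//; last by apply/measurable_EFinP.
  by rewrite diracT mul1e.
have K0 : 0 <= K by apply: le_trans (fK c).
have i1 N (g : T N -> R) : measurable_fun setT g -> (exists C, forall t, `|g t| <= C) ->
    (P N).-integrable setT (EFin \o g).
  move=> mg [C gC]; apply: (bounded_integrable (C := C)) => //.
  by rewrite (le_lt_trans (probability_le1 _ measurableT)) ?ltry.
have mfX N : measurable_fun [set: T N] (fun t => f (X N t)).
  by apply: measurableT_comp => //; exact: mX.
apply/cvgrPdist_le => e e0.
have e2 : 0 < e / 2 by exact: divr_gt0.
have [h h0 fh] : exists2 h, 0 < h & forall x, `|x - c| < h -> `|f x - f c| <= e / 2.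
  have /cvgrPdist_le/(_ _ e2)[h /= h0 Hh] := cf c.
  by exists h => // x xc; rewrite distrC; apply: Hh; rewrite /= distrC.
have e4 : 0 < e / (4 * (K + 1)) by rewrite divr_gt0// mulr_gt0// ltr_wpDl.
pose B N := [set t | h <= `|X N t - c|].
have mB N : measurable (B N) by exact: measurable_deviation.
have small : \forall N \near \oo, (P N (B N) <= (e / (4 * (K + 1)))%:E)%E.
  have := XP _ h0 => /fine_cvgP[fP] /cvgrPdist_le/(_ _ e4) H.
  near=> N; have fin : P N (B N) \is a fin_num by exact: fin_num_measure.
  rewrite -(fineK fin) lee_fin.
  have : `|0 - fine (P N (B N))| <= e / (4 * (K + 1)) by near: N.
  by rewrite sub0r normrN; apply: le_trans; exact: ler_norm.
near=> N.
have PB : (P N (B N) <= (e / (4 * (K + 1)))%:E)%E by near: N.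
have iX : (P N).-integrable setT (EFin \o (fun t => f (X N t))).
  by apply: i1 => //; exists K.
have ic : (P N).-integrable setT (EFin \o (fun _ => f c)) by apply: i1 => //; exists K.
have P1 : fine (P N setT) = 1 by rewrite probability_setT.
have -> : f c = \int[P N]_t (f c) by rewrite Rintegral_cst// P1 mulr1.
have mg : measurable_fun [set: T N] (fun t => f c - f (X N t)) by exact: measurable_funB.
have gK t : `|f c - f (X N t)| <= 2 * K.
  by rewrite (le_trans (ler_normB _ _))// mulrDl mul1r lerD.
rewrite -RintegralB//.
apply: le_trans (le_normr_Rintegral _ _) _ => //.
  by apply: i1 => //; exists (2 * K).
apply: (@le_trans _ _ (\int[P N]_t (e / 2 + 2 * K * \1_(B N) t))).
  apply: le_Rintegral => //.
  - apply: i1; first exact: measurableT_comp.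
    by exists (2 * K) => t; rewrite normr_id.
  - apply: i1.
      by apply: measurable_funD => //; exact: measurable_funM.
    exists (e / 2 + 2 * K) => t; rewrite ger0_norm.
      rewrite lerD2l ler_piMr ?mulr_ge0// indicE; by case: (_ \in _).
    by rewrite addr_ge0 ?(ltW e2)// !mulr_ge0// indicE.
  move=> t _; rewrite indicE; have [tB|tB] := boolP (t \in B N).
    by rewrite mulr1 (le_trans (gK t))// lerDr ltW.
  rewrite mulr0 addr0 distrC; apply: fh; rewrite ltNge.
  by apply/negP => ht; move: tB; rewrite notin_setE; apply.
rewrite RintegralD//; last 2 first.
- by apply: i1 => //; exists (e / 2) => t; rewrite ger0_norm// ltW.
- apply: i1.
    exact: measurable_funM.
  exists (2 * K) => t; rewrite ger0_norm.
    rewrite ler_piMr ?mulr_ge0// indicE; by case: (_ \in _).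
  by rewrite !mulr_ge0// indicE.
rewrite Rintegral_cst// P1 mulr1 RintegralZl//; last first.
  apply: i1; first exact: measurable_indic.
  by exists 1 => t; rewrite indicE ger0_norm//; case: (_ \in _).
have -> : \int[P N]_t \1_(B N) t = fine (P N (B N)).
  by rewrite /Rintegral integral_indic// setIT.
have : fine (P N (B N)) <= e / (4 * (K + 1)).
  by rewrite -lee_fin fineK// fin_num_measure.
have K2 : 0 <= 2 * K by rewrite mulr_ge0.
move=> /(ler_wpM2l K2).
have : 2 * K * (e / (4 * (K + 1))) <= e / 2.
  have K1 : 0 < K + 1 by rewrite ltr_wpDl.
  rewrite mulrA ler_pdivrMr ?mulr_gt0//; nra.
lra.
Unshelve. all: by end_near. Qed.

End probability_limits.

(** * Quantiles of the limiting measure *)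

Section quantiles.
Context {R : realType} (nu : probability (measurableTypeR R) R) (Cm Cp : R).
Hypothesis nuD : nu `[Cm, Cp]%classic = 1%E.
Hypothesis nu_atomless : forall x : R, nu [set x] = 0%E.

Let mI (i : interval R) : measurable ([set` i] : set (measurableTypeR R)).
Proof. exact: measurable_itv. Qed.

Let tail_anti (x y : R) : x <= y -> (nu `[y, +oo[%classic <= nu `[x, +oo[%classic)%E.
Proof.
move=> xy; apply: le_measure; rewrite ?inE//.
by move=> t /=; rewrite !in_itv/= !andbT; exact: le_trans.
Qed.

Let tail_Cm (x : R) : x <= Cm -> nu `[x, +oo[%classic = 1%E.
Proof.
move=> xC; apply/eqP; rewrite eq_le probability_le1//= -nuD le_measure ?inE//.
by move=> t /=; rewrite !in_itv/= andbT => /andP[+ _]; exact: le_trans.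
Qed.

Let tail_Cp (x : R) : Cp < x -> nu `[x, +oo[%classic = 0%E.
Proof.
move=> Cx; apply/eqP; rewrite eq_le measure_ge0 andbT.
have <- : nu (~` `[Cm, Cp]%classic) = 0%E by rewrite probability_setC// nuD subee.
rewrite le_measure ?inE//; first exact: measurableC.
move=> t /=; rewrite !in_itv/= andbT => xt /andP[_]; apply/negP; rewrite -ltNge.
exact: lt_le_trans xt.
Qed.

(** Intermediate value theorem for the tail function, which is left continuous in
    general and right continuous for want of atoms: the supremum of the points with
    tail at least [q] works. *)
Lemma quantile_exists (q : R) : 0 < q -> q < 1 ->
  exists g : R, nu `[g, +oo[%classic = q%:E.
Proof.
move=> q0 q1.
pose A := [set x : R | (q%:E <= nu `[x, +oo[%classic)%E].
have ACm : A Cm by rewrite /A /= tail_Cm// lee_fin ltW.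
have ACp : ubound A Cp.
  move=> x; rewrite /A /= => qx; rewrite leNgt; apply/negP => xCp.
  by move: qx; rewrite tail_Cp// lee_fin leNgt q0.
have supA : has_sup A by split; [exists Cm|exists Cp].
exists (sup A); apply/eqP; rewrite eq_le; apply/andP; split.
- have -> : nu `[sup A, +oo[%classic = nu `]sup A, +oo[%classic.
    have -> : `[sup A, +oo[%classic = [set sup A] `|` `]sup A, +oo[%classic :> set R.
      apply/seteqP; split => x /=; rewrite !in_itv/= !andbT.
        by rewrite le_eqVlt => /predU1P[->|]; [left|right].
      by case=> [->|/ltW].
    rewrite measureU//; last first.
      apply/seteqP; split => x //=.
      by rewrite in_itv/= andbT => -[->]; rewrite ltxx.
    by rewrite [X in (X + _)%E](nu_atomless (sup A)) add0e.
  pose F (n : nat) : set (measurableTypeR R) := `[sup A + n.+1%:R^-1, +oo[%classic.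
  have cvgF : nu (F n) @[n --> \oo] --> nu (\bigcup_n F n).
    apply: nondecreasing_cvg_mu; first by move=> n; exact: mI.
      by apply: bigcup_measurable => n _; exact: mI.
    move=> m n mn; apply/subsetPset => x; rewrite /F /= !in_itv/= !andbT.
    by apply: le_trans; rewrite lerD2l lef_pV2 ?posrE ?ltr0n// ler_nat.
  have -> : `]sup A, +oo[%classic = \bigcup_n F n :> set R.
    apply/seteqP; split => x.
      rewrite /= in_itv/= andbT -subr_gt0 => x0.
      have [n Hn] : exists n : nat, n.+1%:R^-1 < x - sup A.
        have [n _ H] := near_infty_natSinv_lt (PosNum x0); by exists n; exact: H n (leqnn n).
      by exists n => //; rewrite /F /= in_itv/= andbT -lerBrDl ltW.
    move=> [n _]; rewrite /F /= !in_itv/= !andbT; apply: lt_le_trans.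
    by rewrite ltrDl invr_gt0 ltr0n.
  have /cvg_lim <- // := cvgF.
  apply: lime_le; first by apply/cvg_ex; eexists; exact: cvgF.
  apply: nearW => n; rewrite leNgt; apply/negP => /ltW Fn.
  have : sup A + n.+1%:R^-1 <= sup A by apply: sup_upper_bound.
  by rewrite gerDl leNgt invr_gt0 ltr0n.
- pose F (n : nat) : set (measurableTypeR R) := `[sup A - n.+1%:R^-1, +oo[%classic.
  have cvgF : nu (F n) @[n --> \oo] --> nu (\bigcap_n F n).
    apply: nonincreasing_cvg_mu.
    - exact: (le_lt_trans (probability_le1 nu (mI _)) (ltry 1)).
    - by move=> n; exact: mI.
    - by apply: bigcapT_measurable => ?; exact: mI.
    move=> m n mn; apply/subsetPset => x; rewrite /F /= !in_itv/= !andbT.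
    by apply: le_trans; rewrite lerD2l lerN2 lef_pV2 ?posrE ?ltr0n// ler_nat.
  have -> : `[sup A, +oo[%classic = \bigcap_n F n :> set R.
    apply/seteqP; split => x.
      rewrite /= in_itv/= andbT => Ax n _; rewrite /F /= in_itv/= andbT.
      by rewrite (le_trans _ Ax)// gerBl invr_ge0.
    move=> Fx; rewrite /= in_itv/= andbT leNgt; apply/negP => xA.
    have [n Hn] : exists n : nat, n.+1%:R^-1 < sup A - x.
      move: xA; rewrite -subr_gt0 => xA.
      by have [n _ H] := near_infty_natSinv_lt (PosNum xA); exists n; exact: H n (leqnn n).
    by have := Fx n I; rewrite /F /= in_itv/= andbT lerBlDr -lerBlDl leNgt Hn.
  have /cvg_lim <- // := cvgF.
  apply: lime_ge; first by apply/cvg_ex; eexists; exact: cvgF.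
  apply: nearW => n.
  have n0 : 0 < n.+1%:R^-1 :> R by rewrite invr_gt0 ltr0n.
  have [a Aa xa] := sup_adherent n0 supA.
  by apply: le_trans Aa _; apply: tail_anti; exact: ltW.
Qed.

(** A tail strictly between 0 and 1 can only be that of a point of the support. *)
Lemma classical_location_bounds (N k : nat) : (1 <= k <= N)%N ->
  Cm <= classical_location nu N k <= Cp.
Proof.
move=> /andP[k1 kN].
have N0 : 0 < N%:R :> R by rewrite ltr0n (leq_trans k1).
have k1R : 1 <= k%:R :> R by rewrite ler1n.
have kNR : k%:R <= N%:R :> R by rewrite ler_nat.
have q0 : 0 < (k%:R - 2^-1) / N%:R :> R by rewrite divr_gt0//; lra.
have q1 : (k%:R - 2^-1) / N%:R < 1 :> R by rewrite ltr_pdivrMr//; lra.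
rewrite /classical_location; set A := (X in xget 0 X).
have : A (xget 0 A) by have [g Ag] := quantile_exists q0 q1; exact: (xgetPex 0 (ex_intro _ g Ag)).
rewrite /A /=; move: (xget _ _) => g Ag; apply/andP; split.
- rewrite leNgt; apply/negP => /ltW /tail_Cm; rewrite Ag => -[qE].
  by move: q1; rewrite qE ltxx.
- rewrite leNgt; apply/negP => /tail_Cp; rewrite Ag => -[qE].
  by move: q0; rewrite qE ltxx.
Qed.

End quantiles.

(** * Convergence of the empirical spectrum *)

Lemma continuous_clamp {R : realType} (lo hi : R) (f : R -> R) : continuous f ->
  continuous (fun x => Num.max lo (Num.min hi (f x))).
Proof.
move=> cf x; apply: (@continuous_max R R (cst lo) (fun x => Num.min hi (f x))).
  exact: cst_continuous.
apply: (@continuous_min R R (cst hi) f); last exact: cf.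
exact: cst_continuous.
Qed.

Section rigid_ensemble.
Context {R : realType} (d : nat -> measure_display)
  (T : forall N, measurableType (d N)) (P : forall N, probability (T N) R).
Variable M : forall N, T N -> 'M[R]_N.
Hypothesis mM : forall N i j, measurable_fun [set: T N] (fun t => M t i j).
Hypothesis sM : forall N t, (@M N t)^T = M t.
Variables (nu : probability (measurableTypeR R) R) (Cm Cp : R).
Hypothesis CmCp : Cm < Cp.
Hypothesis nuD : nu `[Cm, Cp]%classic = 1%E.
Hypothesis nu_atomless : forall x : R, nu [set x] = 0%E.
Hypothesis rigid : rigidity P M nu.
Hypothesis weak : forall f : R -> R, bounded_continuous f ->
  cvg_in_probability P (fun N t => N%:R^-1 * \sum_(x <- spectrum (@M N t)) f x)
    (\int[nu]_x f x).
Local Notation J := (log_potential nu Cm Cp).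
Local Notation lam N t i := ((spectrum (@M N t))`_i).

(** Rigidity with exponent 1/3 gives errors at most N^(-1/3), uniformly in k; the
    classical locations lie in the support. *)
Lemma aas_spectrum_bounds (e : R) : 0 < e ->
  aas P (fun N t => forall i : 'I_N, Cm - e <= lam N t i <= Cp + e).
Proof.
move=> e0.
have e3 : 0 < 3^-1 :> R by rewrite invr_gt0.
have [N0 N00 HN] := rigid e3 ltr01.
pose E N := [set t | forall k, (1 <= k <= N)%N ->
  `|lam N t k.-1 - classical_location nu N k| <=
   (minn k (N.+1 - k))%:R `^ (- 3^-1) * N%:R `^ (- (2 / 3) + 3^-1)].
have mE N : measurable (E N).
  have -> : E N = \bigcap_k [set t | (1 <= k <= N)%N ->
      `|lam N t k.-1 - classical_location nu N k| <=
      (minn k (N.+1 - k))%:R `^ (- 3^-1) * N%:R `^ (- (2 / 3) + 3^-1)].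
    by apply/seteqP; split => t Et k; [move=> _|]; exact: Et.
  apply: bigcapT_measurable => k; case: (boolP (1 <= k <= N)%N) => kN; last first.
    by rewrite (_ : [set t | _] = setT)//; apply/seteqP; split.
  set C := _ * _.
  rewrite (_ : [set t | _] = setT `&` [set t | `|lam N t k.-1 - classical_location nu N k| <= C]).
    apply: (measurable_fun_le (f := fun t => `|lam N t k.-1 - classical_location nu N k|)
      (g := cst C)) => //.
    apply: measurableT_comp => //; apply: measurable_funB => //.
    exact: (measurable_spectrum (@mM N) (@sM N)).
  by apply/seteqP; split => t /=; [move=> /(_ isT); split|move=> [_ ? _]].
have aasE : aas P (fun N t => E N t).
  exists (fun N => ~` E N); split.
  - by move=> N; exact: measurableC.
  - by move=> N t /contrapT.
  apply: (@squeeze_cvge _ _ _ _ (cst 0%E) _ (fun N => (N%:R `^ (- 1))%:E)).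
  - exists N0.+1 => // N /= NN0; rewrite measure_ge0/=; exact: HN.
  - exact: cvg_cst.
  - apply: cvg_EFin; first exact: nearW.
    apply/cvgrPdist_le => x x0; near=> N.
    rewrite /= sub0r normrN powR_inv1// ger0_norm ?invr_ge0//.
    rewrite invf_ple ?posrE//.
      by near: N; exact: nbhs_infty_ger.
    by rewrite ltr0n; near: N; exact: nbhs_infty_gt.
have big : aas P (fun N _ => (N%:R `^ (- 3^-1) <= e)%R).
  apply: aas_eventually; near=> N.
  have NN : (e^-1) ^+ 3 <= N%:R by near: N; exact: nbhs_infty_ger.
  have ei : 0 < e^-1 by rewrite invr_gt0.
  have N1 : 0 < N%:R :> R by apply: lt_le_trans NN; rewrite exprn_gt0.
  rewrite powRN invf_ple ?posrE ?powR_gt0//.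
  have -> : e^-1 = (e^-1 ^+ 3) `^ 3^-1.
    rewrite -powR_mulrn ?(ltW ei)// -powRrM mulfV// powRr1//; exact: ltW.
  by apply: ge0_ler_powR; rewrite ?nnegrE ?invr_ge0 ?exprn_ge0// ltW.
apply: aas_mono (aas_and aasE big) => N t [Et Ne] i.
have iN : (1 <= i.+1 <= N)%N by rewrite ltn_ord.
have /andP[g1 g2] := classical_location_bounds nuD nu_atomless iN.
have {Et} := Et _ iN; rewrite /= => H.
have m1 : (minn i.+1 (N.+1 - i.+1))%:R `^ (- 3^-1) <= 1 :> R.
  have m0 : (1 <= minn i.+1 (N.+1 - i.+1))%N.
    by rewrite leq_min subSS subn_gt0 ltn_ord.
  have m0' : 1 <= (minn i.+1 (N.+1 - i.+1))%:R :> R by rewrite ler1n.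
  have m00 : 0 < (minn i.+1 (N.+1 - i.+1))%:R :> R by exact: lt_le_trans m0'.
  rewrite powRN invf_le1 ?powR_gt0//.
  have e1 : 1 `^ 3^-1 = 1 :> R by rewrite powR1.
  rewrite -[leLHS]e1.
  by apply: ge0_ler_powR; rewrite ?nnegrE ?invr_ge0// ltW.
have {m1} : (minn i.+1 (N.+1 - i.+1))%:R `^ (- 3^-1) * N%:R `^ (- (2 / 3) + 3^-1) <= e.
  have -> : - (2 / 3) + 3^-1 = - 3^-1 :> R by field.
  by apply: le_trans Ne; rewrite -[leRHS]mul1r ler_wpM2r ?powR_ge0.
move=> /(le_trans H); rewrite ler_norml => /andP[? ?].
apply/andP; split; lra.
Unshelve. all: by end_near. Qed.

Lemma aas_linear_statistic (f : R -> R) (e : R) : bounded_continuous f -> 0 < e ->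
  aas P (fun N t => `|N%:R^-1 * \sum_(i < N) f (lam N t i) - \int[nu]_x f x| < e).
Proof.
move=> bf e0.
have : aas P (fun N t => `|N%:R^-1 * \sum_(x <- spectrum (@M N t)) f x - \int[nu]_x f x| < e).
  apply: cvg_in_probability_aas => //; last exact: weak.
  move=> N; apply: measurable_funM => //.
  apply: (measurable_sum_spectrum (@mM N) (@sM N)).
  by apply: continuous_measurable_fun; case: bf.
by apply: aas_mono => N t; rewrite sum_spectrum.
Qed.

(** The logarithm is not a bounded test function, but it agrees with a truncation
    of itself on a neighbourhood of the support, which contains the spectrum. *)
Lemma aas_log_mean (z e : R) : Cp < z -> 0 < e ->
  aas P (fun N t => `|N%:R^-1 * \sum_(i < N) ln (z - lam N t i) - J z| < e).
Proof.
move=> zCp e0.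
pose h : R := (z - Cp) / 2.
have h0 : 0 < h by rewrite divr_gt0// subr_gt0.
pose lo : R := z - (Cp + h); pose hi : R := z - (Cm - h).
have lo0 : 0 < lo by rewrite /lo /h; lra.
have lohi : lo < hi by move: CmCp; rewrite /lo /hi; lra.
pose g (x : R) : R := Num.max lo (Num.min hi (z - x)).
have g1 x : lo <= g x by rewrite /g le_max lexx.
have g2 x : g x <= hi by rewrite /g ge_max (ltW lohi) ge_min lexx.
have gE x : Cm - h <= x -> x <= Cp + h -> g x = z - x.
  move=> x1 x2; rewrite /g /lo /hi min_r ?max_r//; lra.
have cg : continuous g.
  apply: continuous_clamp => x.
  by apply: cvgB; [exact: cvg_cst|exact: cvg_id].
have cf : continuous (fun x => ln (g x)).
  move=> x; apply: continuous_comp; first exact: cg.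
  by apply: continuous_ln; exact: lt_le_trans (g1 x).
have bf : bounded_continuous (fun x => ln (g x)).
  split => //; exists (`|ln lo| + `|ln hi|) => x.
  have gx0 : 0 < g x by exact: lt_le_trans (g1 x).
  have l1 : ln lo <= ln (g x) by rewrite ler_ln ?posrE.
  have l2 : ln (g x) <= ln hi by rewrite ler_ln ?posrE// (lt_trans lo0).
  have := ler_norm (ln hi); have := ler_norm (- ln lo); rewrite normrN.
  have := normr_ge0 (ln hi); have := normr_ge0 (ln lo).
  by rewrite ler_norml => *; apply/andP; split; lra.
have mD : measurable (`[Cm, Cp]%classic : set (measurableTypeR R)).
  exact: measurable_itv.
have JE : J z = \int[nu]_x ln (g x).
  rewrite (Rintegral_full mD nuD); last exact: continuous_measurable_fun.
  apply: eq_Rintegral => x; rewrite inE/= in_itv/= => /andP[x1 x2].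
  by rewrite gE//; lra.
rewrite JE.
apply: aas_mono (aas_and (aas_spectrum_bounds h0) (aas_linear_statistic bf e0)).
move=> N t [spec]; congr (`|_ * _ - _| < _).
by apply: eq_bigr => i _; have /andP[? ?] := spec i; rewrite gE.
Qed.

End rigid_ensemble.

(** * Convergence of the free energy *)

Section free_energy_limit.
Context {R : realType} (d : nat -> measure_display)
  (T : forall N, measurableType (d N)) (P : forall N, probability (T N) R).
Variable M : forall N, T N -> 'M[R]_N.
Hypothesis mM : forall N i j, measurable_fun [set: T N] (fun t => M t i j).
Hypothesis sM : forall N t, (@M N t)^T = M t.
Variable w : forall N, probability (N.-tuple (measurableTypeR R)) R.
Hypothesis uw : forall N, uniform_on_sphere (w N).
Variables (nu : probability (measurableTypeR R) R) (Cm Cp : R).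
Hypothesis CmCp : Cm < Cp.
Hypothesis nuD : nu `[Cm, Cp]%classic = 1%E.
Hypothesis nu_gt0 : forall a b : R, Cm <= a -> a < b -> b <= Cp ->
  (0 < nu `]a, b[%classic)%E.
Hypothesis nu_atomless : forall x : R, nu [set x] = 0%E.
Hypothesis K1_bounded : exists B, forall z, Cp < z -> resolvent_moment nu Cm Cp 1 z <= B.
Hypothesis rigid : rigidity P M nu.
Hypothesis weak : forall f : R -> R, bounded_continuous f ->
  cvg_in_probability P (fun N t => N%:R^-1 * \sum_(x <- spectrum (@M N t)) f x)
    (\int[nu]_x f x).
Local Notation J := (log_potential nu Cm Cp).
Local Notation F := (limiting_free_energy nu Cm Cp).
Local Notation lam N t i := ((spectrum (@M N t))`_i).
Local Notation FN N t b := (free_energy (w N) (@M N t) b).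

Let nuCp : nu [set Cp] = 0%E := nu_atomless Cp.
Let bounds := aas_spectrum_bounds mM sM nuD nu_atomless rigid.
Let log_mean := aas_log_mean mM sM CmCp nuD nu_atomless rigid weak.

Let aas_gt0 : aas P (fun N _ => (0 < N)%N).
Proof. by apply: aas_eventually; exact: nbhs_infty_gt. Qed.

Let free_energyE N t (b : R) : FN N t b =
  N%:R^-1 * ln (\int[w N]_(x in sphere)
    expR (b * diag_form (fun i : 'I_N => lam N t i) x)).
Proof. by rewrite /free_energy (partition_function_diag b (uw N) (sM t)). Qed.

Lemma aas_free_energy_le (b e : R) : 0 < b -> 0 < e ->
  aas P (fun N t => FN N t b <= F b + e).
Proof.
move=> b0 e0; have e2 : 0 < e / 2 by exact: divr_gt0.
have [z zCp Fz] := limiting_free_energy_approx CmCp nuD nuCp K1_bounded b0 e2.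
have h0 : 0 < (z - Cp) / 2 by rewrite divr_gt0// subr_gt0.
apply: aas_mono (aas_and aas_gt0 (aas_and (bounds h0) (log_mean zCp e0))).
move=> N t [N0 [spec]]; rewrite ltr_norml => /andP[L _].
rewrite free_energyE.
apply: le_trans (log_partition_le (uw N) N0 b0 (z := z) _) _.
  by move=> i; have /andP[_] := spec i; lra.
move: L Fz; set L := N%:R^-1 * _; lra.
Qed.

Let bump (e x : R) : R := Num.max 0 (Num.min 1 (2 / e * (x - (Cp - e)))).

(** A bump function supported in the window gives the lower bound; the proportion is
    half of the nu-mass of the half window where the bump equals 1. *)
Lemma aas_edge_proportion (e : R) : 0 < e -> exists p : R, [/\ 0 < p, p <= 1 &
  aas P (fun N t => p * N%:R <= \sum_(i < N) (Cp - e <= lam N t i)%R%:R)].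
Proof.
move=> e0; have e2 : 0 < 2 / e by exact: divr_gt0.
have b1 x : bump e x <= 1 by rewrite /bump ge_max ler01 ge_min lexx.
have b0 x : 0 <= bump e x by rewrite /bump le_max lexx.
have bb : bounded_continuous (bump e).
  split; last by exists 1 => x; rewrite ger0_norm.
  apply: continuous_clamp => x; apply: cvgMr.
  by apply: cvgB; [exact: cvg_id|exact: cvg_cst].
have mb : measurable_fun [set: measurableTypeR R] (bump e).
  by apply: continuous_measurable_fun; case: bb.
pose a : R := Num.max Cm (Cp - e / 2).
have aCp : a < Cp by rewrite /a gt_max CmCp/= ltrBlDr ltrDl divr_gt0.
have mA : measurable (`]a, Cp[%classic : set (measurableTypeR R)) by exact: measurable_itv.
have nuA : (0 < nu `]a, Cp[%classic)%E by apply: nu_gt0 => //; rewrite le_max lexx.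
have nuAf : nu `]a, Cp[%classic \is a fin_num by exact: fin_num_measure.
pose m : R := fine (nu `]a, Cp[%classic).
have m0 : 0 < m by rewrite /m fine_gt0// nuA (le_lt_trans (probability_le1 _ mA)) ?ltry.
have m1 : m <= 1 by rewrite -lee_fin fineK//; exact: probability_le1.
have ib : m <= \int[nu]_x bump e x.
  rewrite -[m]mul1r; apply: (@Rintegral_ge_cst _ _ _ nu `]a, Cp[%classic setT) => //.
  - apply: (bounded_integrable (C := 1)) => //.
      by rewrite (le_lt_trans (probability_le1 _ measurableT)) ?ltry.
    by move=> x _; rewrite ger0_norm.
  - move=> x /=; rewrite in_itv/= gt_max => /andP[/andP[_ x1] _].
    rewrite /bump le_max le_min lexx /= -ler_pdivrMl//.
    by apply/orP; right; rewrite invf_div mulr1; lra.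
  - by rewrite fineK.
exists (m / 2); split; [exact: divr_gt0|lra|].
have m2 : 0 < m / 2 by exact: divr_gt0.
apply: aas_mono (aas_and aas_gt0 (aas_linear_statistic mM sM weak bb m2)).
move=> N t [N0]; have N0' : 0 < N%:R :> R by rewrite ltr0n.
rewrite ltr_norml => /andP[H _].
have {H} : m / 2 <= N%:R^-1 * \sum_(i < N) bump e (lam N t i) by lra.
rewrite ler_pdivlMl// mulrC => /le_trans; apply; apply: ler_sum => i _.
have [|xe] := leP (Cp - e) (lam N t i); first by rewrite b1.
by rewrite /bump max_l// ge_min pmulr_rle0// subr_le0 (ltW xe) orbT.
Qed.

(** The saddle point of the modified spectrum is random, but it lies in a fixed
    bounded interval beyond the edge; the logarithmic mean increases in z, so that
    its convergence on a finite grid controls it at the saddle point, and the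
    variational inequality for F is used at the next grid point. *)
Lemma aas_free_energy_ge (b e : R) : 0 < b -> 0 < e ->
  aas P (fun N t => F b - e <= FN N t b).
Proof.
move=> b0 e0; have b2 : 0 < (2 * b)^-1 by rewrite invr_gt0 mulr_gt0.
pose h : R := e / (8 * b).
have h0 : 0 < h by rewrite divr_gt0// mulr_gt0.
have bh : b * h = e / 8 by rewrite /h; field; rewrite gt_eqF.
pose k : R := Num.min 2^-1 (e / 8).
have k0 : 0 < k by rewrite lt_min invr_gt0 ltr0n/= divr_gt0.
have k2 : k <= 2^-1 by rewrite ge_min lexx.
have k8 : k <= e / 8 by rewrite ge_min lexx orbT.
have e4 : 0 < e / 4 by exact: divr_gt0.
pose c : R := Cp + h.
have [p [p0 p1 Hp]] := aas_edge_proportion h0.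
have [m Hm] : exists m : nat, (2 * b)^-1 / h < m%:R.
  by exists (Num.truncn ((2 * b)^-1 / h)).+1; exact: truncnS_gt.
pose zj (j : nat) : R := c + j.+1%:R * h.
have zjCp j : Cp < zj j.
  by rewrite /zj /c -addrA ltrDl addr_gt0// mulr_gt0// ltr0n.
have grid := aas_forall_lt m (fun j => log_mean (zjCp j) e4).
have large : aas P (fun N _ => 3 <= N%:R * (p * k ^+ 2 / 64)).
  apply: aas_eventually; near=> N.
  rewrite -ler_pdivrMr; last by rewrite divr_gt0// mulr_gt0// exprn_gt0.
  by near: N; exact: nbhs_infty_ger.
apply: aas_mono (aas_and aas_gt0 (aas_and (bounds h0) (aas_and Hp (aas_and grid large)))).
move=> N t [N0 [spec [pN [Hgrid N3]]]].
have lc (i : 'I_N) : lam N t i <= c by have /andP[] := spec i.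
have pN' : p * N%:R <= \sum_(i < N) (c - 2 * h <= lam N t i)%R%:R.
  by have -> : c - 2 * h = Cp - h by rewrite /c; ring.
have [z [cz zc H]] := log_partition_ge (uw N) N0 b0 h0 p0 p1 k0 k2 lc pN' N3.
rewrite free_energyE; apply: le_trans H.
pose j := Num.truncn ((z - c) / h).
have zc0 : 0 <= (z - c) / h by rewrite divr_ge0 ?subr_ge0 ?(ltW cz) ?(ltW h0).
have /andP[j1 j2] := truncn_itv zc0.
have jm : (j < m)%N.
  rewrite -(ltr_nat R); apply: le_lt_trans j1 _; apply: le_lt_trans Hm.
  by rewrite ler_wpM2r ?invr_ge0 ?(ltW h0)//; lra.
have {j1} zj1 : zj j <= z + h.
  by move: j1; rewrite ler_pdivlMr// /zj -addn1 natrD; lra.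
have {j2} zj2 : z <= zj j.
  by move: j2; rewrite ltr_pdivrMr// /zj; lra.
have := Hgrid j jm; rewrite ltr_norml => /andP[_ L].
have lm : N%:R^-1 * \sum_(i < N) ln (z - lam N t i) <=
    N%:R^-1 * \sum_(i < N) ln (zj j - lam N t i).
  rewrite ler_wpM2l ?invr_ge0// ler_sum// => i _.
  have lz := le_lt_trans (lc i) cz.
  by rewrite ler_ln ?posrE ?subr_gt0 ?(lt_le_trans lz)// lerD2r.
have Fj := limiting_free_energy_le CmCp nuD nuCp K1_bounded b0 (ltW (zjCp j)).
have bz : b * zj j <= b * z + e / 8 by rewrite -bh -mulrDr ler_wpM2l// ltW.
have bh2 : 2 * b * h = e / 4 by rewrite -mulrA bh; field.
rewrite bh2; move: lm L Fj bz k8.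
set L1 := N%:R^-1 * \sum_(i < N) ln (z - _).
set L2 := N%:R^-1 * \sum_(i < N) ln (zj j - _).
move: (J _) (ln (2 * b)) (b * z) (b * zj j) (F b) => J1 lb bz1 bz2 Fb.
lra.
Unshelve. all: by end_near. Qed.

Lemma free_energy_cvg_in_distribution (b : R) : 0 < b ->
  cvg_in_distribution P (fun N t => FN N t b) (\d_(F b : measurableTypeR R)).
Proof.
move=> b0; have mF N : measurable_fun [set: T N] (fun t => FN N t b).
  exact: (measurable_free_energy (@mM N)).
apply: cvg_in_distribution_dirac => //.
apply: aas_cvg_in_probability => // e e0; have e2 : 0 < e / 2 by exact: divr_gt0.
apply: aas_mono (aas_and (aas_free_energy_le b0 e2) (aas_free_energy_ge b0 e2)).
by move=> N t [? ?]; rewrite ltr_norml; apply/andP; split; lra.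
Qed.

End free_energy_limit.

Theorem theorem2p9 (R : realType) (d : nat -> measure_display)
    (T : forall N, measurableType (d N)) (P : forall N, probability (T N) R)
    (M : forall N, T N -> 'M[R]_N)
    (M_measurable : forall N i j, measurable_fun [set: T N] (fun t => M N t i j))
    (M_symmetric : forall N t, (M N t)^T = M N t)
    (omega : forall N, probability (N.-tuple (measurableTypeR R)) R)
    (omega_uniform : forall N, uniform_on_sphere (omega N))
    (nu : probability (measurableTypeR R) R) (Cm Cp s : R)
    (H_regularity : regularity P M nu Cm Cp s)
    (H_rigidity : rigidity P M nu)
    (H_linear_statistics : linear_statistics P M nu Cm Cp)
    (H_tracy_widom : tracy_widom_limit P M Cp s) :
  let beta_c := critical_beta nu Cm Cp in
  exists F : R -> R,
    [/\ (* F takes values in [0, oo) when nu has nonnegative mean *)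
        0 <= \int[nu]_x x -> forall b : R, 0 < b -> 0 <= F b,
        forall b : R, 0 < b -> b != beta_c ->
          cvg_in_distribution P (fun N t => free_energy (omega N) (M N t) b)
            (\d_(F b : measurableTypeR R)),
        forall b : R, 0 < b ->
          [/\ derivable F b 1, derivable F^`() b 1 & {for b, continuous F^`(2)}],
        (* the third derivative exists away from beta_c and no choice of a value
           at beta_c makes it continuous there *)
        (forall b : R, 0 < b -> b != beta_c -> derivable F^`(2) b 1) /\
        ~ (exists l : R, F^`(3) b @[b --> beta_c^'] --> l) &
        (forall b : R, 0 < b -> b < beta_c ->
          F b = b * gamma_hat nu Cm Cp b -
                2^-1 * (\int[nu]_(k in `[Cm, Cp]) ln (gamma_hat nu Cm Cp b - k) +
                        1 + ln (2 * b))) /\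
        (forall b : R, beta_c <= b ->
          F b = b * Cp -
                2^-1 * (\int[nu]_(k in `[Cm, Cp]) ln (Cp - k) +
                        1 + ln (2 * b)))].
Proof.
move=> bc; have [weak [CmCp nuD] nu_gt0 s0 [rho [mrho rho0 nuE rhoh]]] := H_regularity.
have nu_atomless (x : R) : nu [set x] = 0%E by exact: (density_set1 nuE).
have [K1 [C [c [r0 [[C0 c0 r00] K2C K2c K3c]]]]] :=
  edge_constants CmCp nuD s0 mrho rho0 nuE rhoh.
have nuCp := nu_atomless Cp.
exists (limiting_free_energy nu Cm Cp); split.
- move=> mean0 b b0.
  apply: le_trans (limiting_free_energy_mean CmCp nuD nuCp K1 b0).
  rewrite mulr_ge0 ?(ltW b0)//.
  have <- // : \int[nu]_x x = \int[nu]_(x in (`[Cm, Cp]%classic : set (measurableTypeR R))) x.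
  by apply: Rintegral_full => //; exact: measurable_itv.
- move=> b b0 _.
  exact: (free_energy_cvg_in_distribution M_measurable M_symmetric omega_uniform
    CmCp nuD nu_gt0 nu_atomless K1 H_rigidity weak b0).
- move=> b b0.
  exact: (limiting_free_energy_C2 CmCp nuD nuCp K1 c0 r00 K2c b0).
- split.
    move=> b b0 bbc.
    exact: (derivable_derive2 CmCp nuD nuCp K1 c0 r00 K2c b0 bbc).
  exact: (no_limit_derive3 CmCp nuD nuCp K1 C0 c0 r00 K2C K2c K3c).
- split.
    by move=> b b0 bbc; rewrite /limiting_free_energy /saddle bbc.
  move=> b bcb; rewrite /limiting_free_energy /saddle ltNge.
  by rewrite -/bc bcb.
Qed.
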